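(* Let $q<0$ be a real number and let $\mu$ be a non-zero finite Borel measure on $S^{n-1}$. There exists a convex body $K\subset\mathbb{R}^n$ containing the origin in its interior such that $\mu(\cdot)=\widetilde{C}_q(K,\cdot)$ (equality of Borel measures on $S^{n-1}$) if and only if $\mu$ is not concentrated in any closed hemisphere of $S^{n-1}$.
   Context: Work in $\mathbb{R}^n$ with the standard inner product $x\cdot y$; $S^{n-1}$ is the unit sphere, and $du$ denotes integration with respect to spherical Lebesgue measure, i.e. $(n-1)$-dimensional Hausdorff measure $\mathcal{H}^{n-1}$, on $S^{n-1}$. A convex body is a compact convex subset of $\mathbb{R}^n$ with non-empty interior; $\mathcal{K}_o^n$ is the set of convex bodies containing the origin in their interior. For $K\in\mathcal{K}_o^n$, the support function is $h_K(v)=\max\{v\cdot x:x\in K\}$ and the radial function is $\rho_K(u)=\max\{\lambda>0:\lambda u\in K\}$, for $u,v\in S^{n-1}$. A unit vector $v$ is an outer unit normal of $K$ at $x\in\partial K$ if $x\cdot v=h_K(v)$. For $\eta\subset S^{n-1}$, the reverse radial Gauss image is $$\vec{\alpha}_K^*(\eta)=\{u\in S^{n-1}: \text{some } v\in\eta \text{ is an outer unit normal of } K \text{ at } \rho_K(u)u\}.$$ For $q\in\mathbb{R}$, the $q$-th dual curvature measure of $K\in\mathcal{K}_o^n$ is the finite Borel measure on $S^{n-1}$ given, for Borel $\eta\subset S^{n-1}$, by $$\widetilde{C}_q(K,\eta)=\frac1n\int_{\vec{\alpha}_K^*(\eta)}\rho_K^q(u)\,du.$$ (For Borel $\eta$ the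 set $\vec{\alpha}_K^*(\eta)$ is spherical Lebesgue measurable.) A closed hemisphere is a set $\{v\in S^{n-1}:v\cdot u\geq 0\}$ with $u\in S^{n-1}$; $\mu$ is concentrated in it if its complement has $\mu$-measure $0$. *)

(* Defs.v *)
From HB Require Import structures.
From mathcomp Require Import all_boot all_order all_algebra.
From mathcomp Require Import all_classical all_reals all_analysis.
Set Implicit Arguments.
Unset Strict Implicit.
Unset Printing Implicit Defensive.
Import Order.TTheory GRing.Theory Num.Theory.
Import numFieldNormedType.Exports.
Local Open Scope classical_set_scope.
Local Open Scope ring_scope.

(* The library norm on ['rV[R]_m] is the sup norm: it gives the usual topology
   (and is used below only through that topology), but the metric notions
   (unit sphere, diameter) must go through the Euclidean norm [enorm]. *)
Definition dot (R : realType) (m : nat) (x y : 'rV[R]_m) : R :=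
  \sum_(i < m) x 0 i * y 0 i.

Definition enorm (R : realType) (m : nat) (x : 'rV[R]_m) : R :=
  Num.sqrt (dot x x).

Section HausdorffMeasure.
Variables (R : realType) (m : nat).
Local Notation T := ('rV[R]_m).
Local Open Scope ereal_scope.

(* The volume omega_k of the unit ball of R^k, by the recursion
   omega_k = (2 pi / k) omega_(k-2). *)
Fixpoint ball_volume (k : nat) : R :=
  match k with
  | 0 => 1
  | 1 => 2
  | k'.+2 => 2 * pi / k'.+2%:R * ball_volume k'
  end%R.

(* For [A = set0] this is [-oo]. *)
Definition diameter (A : set T) : \bar R :=
  ereal_sup [set (enorm (p.1 - p.2))%:E | p in A `*` A].

(* The empty set is singled out because, for [k = 0], [(_ / 2) ^+ 0 = 1]. *)
Definition hausdorff_gauge (k : nat) (A : set T) : \bar R :=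
  if A == set0 then 0
  else (ball_volume k)%:E * (diameter A * (2^-1)%:E) ^+ k.

Definition hausdorff_delta (k : nat) (delta : R) (A : set T) : \bar R :=
  ereal_inf [set \sum_(i <oo) hausdorff_gauge k (F i) | F in
    [set F : (set T)^nat | A `<=` \bigcup_i F i /\
                           forall i, diameter (F i) <= delta%:E]].

(* The k-dimensional Hausdorff outer measure on R^m, normalized so that it
   agrees with Lebesgue measure on R^k. *)
Definition hausdorff (k : nat) (A : set T) : \bar R :=
  ereal_sup [set hausdorff_delta k delta A | delta in [set d : R | (0 < d)%R]].

Lemma ball_volume_ge0 (k : nat) : (0 <= ball_volume k)%R.
Proof.
suff : ((0 <= ball_volume k) && (0 <= ball_volume k.+1))%R by case/andP.
elim: k => [|k /andP[h1 h2]]; first by rewrite /= ler01 ler0n.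
rewrite h2 /= mulr_ge0 // divr_ge0 ?ler0n// mulr_ge0 ?ler0n//.
exact: pi_ge0.
Qed.

Lemma diameter_ge0 (A : set T) : A !=set0 -> 0 <= diameter A.
Proof.
move=> [x Ax]; apply: (@le_trans _ _ (enorm (x - x))%:E).
  by rewrite lee_fin sqrtr_ge0.
by apply: ereal_sup_ubound; exists (x, x).
Qed.

Lemma hausdorff_gauge_ge0 (k : nat) (A : set T) : 0 <= hausdorff_gauge k A.
Proof.
rewrite /hausdorff_gauge; case: eqVneq => // /set0P A0.
apply: mule_ge0; first by rewrite lee_fin ball_volume_ge0.
apply: expe_ge0; apply: mule_ge0; first exact: diameter_ge0.
by rewrite lee_fin invr_ge0 ler0n.
Qed.

Let discr := g_sigma_algebraType ([set: set T]).

Let trunc (k : nat) (delta : R) (A : set discr) : \bar R :=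
  if (A == set0) || (diameter A <= delta%:E) then hausdorff_gauge k A else +oo.

Let trunc0 k delta : trunc k delta set0 = 0.
Proof. by rewrite /trunc eqxx /= /hausdorff_gauge eqxx. Qed.

Let trunc_ge0 k delta A : 0 <= trunc k delta A.
Proof. by rewrite /trunc; case: ifP => // _; exact: hausdorff_gauge_ge0. Qed.

Let diameter0 : diameter set0 = -oo.
Proof.
rewrite /diameter (_ : [set _ | _ in _] = set0) ?ereal_sup0//.
by rewrite -subset0 => x [p [[]]].
Qed.

Let hausdorff_deltaE k delta :
  hausdorff_delta k delta = mu_ext (trunc k delta) :> (set T -> \bar R).
Proof.
apply/funext => A; apply/eqP; rewrite eq_le; apply/andP; split.
  apply: le_ereal_inf_tmp => _ [F [mF AF] <-].
  have [[i Fi]|nF] := pselect (exists i, trunc k delta (F i) = +oo).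
    by rewrite (eseries_pinfty _ _ Fi) ?leey// => j _; rewrite -ltNye
      (lt_le_trans _ (trunc_ge0 _ _ _)).
  have small i : (F i == set0) || (diameter (F i) <= delta%:E).
    apply/negPn/negP => /negbTE h; apply: nF; exists i.
    by rewrite /trunc h.
  apply: ereal_inf_lbound; exists F.
    by split => // i; have /orP[/eqP ->|//] := small i; rewrite diameter0 leNye.
  by apply: eq_eseriesr => i _; rewrite /trunc small.
apply: le_ereal_inf_tmp => _ [F [AF dF] <-].
apply: ereal_inf_lbound; exists F.
  by split => // i; exact: sub_sigma_algebra.
by apply: eq_eseriesr => i _; rewrite /trunc dF orbT.
Qed.

Lemma hausdorff_delta_ge0 k delta A : 0 <= hausdorff_delta k delta A.
Proof. by rewrite hausdorff_deltaE; exact: mu_ext_ge0. Qed.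

Lemma le_hausdorff_deltaT k delta A :
  (0 < delta)%R -> hausdorff_delta k delta A <= hausdorff k A.
Proof. by move=> d0; apply: ereal_sup_ubound; exists delta. Qed.

Lemma hausdorff0 (k : nat) : hausdorff k set0 = 0.
Proof.
apply/eqP; rewrite eq_le; apply/andP; split.
  apply: ge_ereal_sup => _ [d _ <-].
  by rewrite hausdorff_deltaE mu_ext0.
exact: le_trans (hausdorff_delta_ge0 k 1 set0) (le_hausdorff_deltaT _ _ ltr01).
Qed.

Lemma hausdorff_ge0 (k : nat) (A : set T) : 0 <= hausdorff k A.
Proof.
exact: le_trans (hausdorff_delta_ge0 k 1 A) (le_hausdorff_deltaT _ _ ltr01).
Qed.

Lemma le_hausdorff (k : nat) : {homo hausdorff k : A B / A `<=` B >-> A <= B}.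
Proof.
move=> A B AB; apply: ge_ereal_sup => _ [d d0 <-].
apply: le_trans (le_hausdorff_deltaT _ _ d0).
by rewrite hausdorff_deltaE; exact: le_mu_ext.
Qed.

Lemma hausdorff_sigma_subadditive (k : nat) : sigma_subadditive (hausdorff k).
Proof.
move=> A; apply: ge_ereal_sup => _ [d d0 <-].
apply: (@le_trans _ _ (\sum_(i <oo) hausdorff_delta k d (A i))).
  by rewrite hausdorff_deltaE; exact: mu_ext_sigma_subadditive.
apply: lee_nneseries => [i *|i *]; first exact: hausdorff_delta_ge0.
exact: le_hausdorff_deltaT.
Qed.

HB.instance Definition _ (k : nat) := isOuterMeasure.Build R T (hausdorff k)
  (hausdorff0 k) (hausdorff_ge0 k) (@le_hausdorff k)
  (@hausdorff_sigma_subadditive k).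

Definition hausdorff_outer (k : nat) : {outer_measure set T -> \bar R} :=
  @hausdorff k.

End HausdorffMeasure.

(* From here on the ambient space is R^(n+1), so that the unit sphere is
   never empty and [sphere R n] is the n-dimensional sphere S^n. *)

Definition sphere (R : realType) (n : nat) : set 'rV[R]_n.+1 :=
  [set x | enorm x = 1].

Lemma sphere_delta (R : realType) (n : nat) :
  sphere (delta_mx 0 0 : 'rV[R]_n.+1).
Proof.
rewrite /sphere /= /enorm /dot (bigD1 ord0) //= big1.
  by rewrite !mxE !eqxx mulr1 addr0 sqrtr1.
by move=> i i0; rewrite !mxE (negbTE i0) andbF mulr0.
Qed.

Definition sphere_type (R : realType) (n : nat) : Type := set_type (@sphere R n).

HB.instance Definition _ (R : realType) (n : nat) :=
  Topological.copy (sphere_type R n) (set_type (@sphere R n)).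
HB.instance Definition _ (R : realType) (n : nat) :=
  isPointed.Build (sphere_type R n) (SigSub (mem_set (sphere_delta R n))).

Definition svec (R : realType) (n : nat) (u : sphere_type R n) : 'rV[R]_n.+1 :=
  set_val u.

Definition borel_sphere (R : realType) (n : nat) :=
  g_sigma_algebraType (@open (sphere_type R n)).

(* The n-dimensional Hausdorff measure on R^(n+1), used on subsets of S^n. Its
   domain is the (complete) Caratheodory sigma-algebra, so that one can integrate
   over sets that are only known to be measurable up to a null set, such as the
   reverse radial Gauss image of a Borel set. *)
Definition spherical_measure (R : realType) (n : nat) :
    {measure set (caratheodory_type (hausdorff_outer R n.+1 n)) -> \bar R} :=
  hausdorff_outer R n.+1 n.

Section ConvexBodies.
Variables (R : realType) (n : nat).
Local Notation E := ('rV[R]_n.+1).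
Implicit Types (K : set E) (u v : E).

Definition convex_body K := [/\ convex_set K, compact K & K° !=set0].

(* Both suprema below are maxima when [K] is a convex body with the origin in
   its interior and, for [radial_function], [u] is nonzero. *)
Definition support_function K v : R := sup [set dot v x | x in K].

Definition radial_function K u : R := sup [set l : R | 0 < l /\ K (l *: u)].

(* To be used for [x] on the boundary of [K] and a unit vector [v]. *)
Definition outer_normal K (x v : E) := dot x v = support_function K v.

Definition reverse_radial_gauss_image K (eta : set (sphere_type R n)) : set E :=
  [set u | sphere u /\
     exists2 v, eta v & outer_normal K (radial_function K u *: u) (svec v)].

Definition dual_curvature_measure (q : R) K (eta : set (sphere_type R n)) :
    \bar R :=
  ((n.+1%:R^-1)%:E * \int[spherical_measure R n]_(u in
    reverse_radial_gauss_image K eta) (radial_function K u `^ q)%:E)%E.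

Definition closed_hemisphere (w : sphere_type R n) : set (sphere_type R n) :=
  [set v | 0 <= dot (svec v) (svec w)].

Definition concentrated_in (mu : set (sphere_type R n) -> \bar R)
    (A : set (sphere_type R n)) := mu (~` A) = 0%E.

End ConvexBodies.

(* Main.v *)
(* Put p = - q > 0. A convex body with the origin in its interior is the unit
   ball [gauge_ball N] of its gauge N = 1 / rho, so its q-th dual curvature
   measure is the integral of N^p over the reverse radial Gauss image, up to the
   dimensional constant. The solution is found by maximizing, over all gauges N
   with support function h_N, the scale-invariant functional
     J(N) = - int ln h_N dmu - (|mu| / p) ln (int N^p du).
   If a normalized N is small at a point w, then h_N is large on the open
   hemisphere around w; when mu is not concentrated in a closed hemisphere, these
   hemispheres have mass bounded below, so J is very negative on degenerate
   gauges and compactness gives a maximizer. Multiplying 1 / h_N by e^t on a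
   closed set A of normals and letting t tend to 0 yields
   mu(A) <= c int_(alpha^*(A)) N^p du. As almost every direction has a unique
   normal, the right-hand side is a measure in A; it has the same total mass as mu,
   so both measures agree, and a dilation absorbs the constant c.
   Conversely, for u close to - w every outer normal v at rho(u) u satisfies
   v . w < 0, so a dual curvature measure charges the complement of the closed
   hemisphere of w. *)
From HB Require Import structures.
From mathcomp Require Import all_boot all_order all_algebra.
From mathcomp Require Import all_classical all_reals all_analysis measurable_realfun.
From mathcomp Require Import ring lra zify.
Require Import Defs.
Set Implicit Arguments.
Unset Strict Implicit.
Unset Printing Implicit Defensive.
Import Order.TTheory GRing.Theory Num.Theory.
Import numFieldNormedType.Exports.
Local Open Scope classical_set_scope.
Local Open Scope ring_scope.

(** * Euclidean norm *)

(** No derivative of [J] is computed. For each closed [A] the competitor at [t > 0] only has to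
    yield an inequality, and equality of total masses turns these one-sided bounds into equality of
    measures. Closedness of [A] makes its unit vectors a compact set, which is what lets approximate
    normals converge to true ones as [t] tends to 0. Compactness of gauges is Tychonoff's theorem
    for functions below the Euclidean norm; closeness at finitely many points becomes uniform
    because normalized gauges are 1-Lipschitz. As surface measure is a Hausdorff outer measure built
    from coverings, three facts are derived from grids and Lipschitz charts: the sphere has finite
    measure, caps have positive measure, directions with two normals form a null set. One normal per
    direction is then chosen arbitrarily; the null ambiguity and the completeness of the
    Caratheodory sigma-algebra make the choice measurable. The factor [|mu| / p] in [J] is forced by
    scale invariance: replacing [N] by [c N] divides [h_N] by [c] and multiplies the energy by
    [c^p]. *)

Section Euclid.
Variables (R : realType) (m : nat).
Implicit Types (x y z : 'rV[R]_m) (a b : R).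

Lemma dotC x y : dot x y = dot y x.
Proof. by apply: eq_bigr => i _; rewrite mulrC. Qed.

Lemma dotDl x y z : dot (x + y) z = dot x z + dot y z.
Proof. by rewrite /dot -big_split; apply: eq_bigr => i _; rewrite mxE mulrDl. Qed.

Lemma dotZl a x y : dot (a *: x) y = a * dot x y.
Proof. by rewrite /dot big_distrr; apply: eq_bigr => i _; rewrite /= mxE mulrA. Qed.

Lemma dotNl x y : dot (- x) y = - dot x y.
Proof. by rewrite -scaleN1r dotZl mulN1r. Qed.

Lemma dotBl x y z : dot (x - y) z = dot x z - dot y z.
Proof. by rewrite dotDl dotNl. Qed.

Lemma dotDr x y z : dot z (x + y) = dot z x + dot z y.
Proof. by rewrite !(dotC z) dotDl. Qed.

Lemma dotZr a x y : dot x (a *: y) = a * dot x y.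
Proof. by rewrite !(dotC x) dotZl. Qed.

Lemma dotNr x y : dot x (- y) = - dot x y.
Proof. by rewrite !(dotC x) dotNl. Qed.

Lemma dotBr x y z : dot z (x - y) = dot z x - dot z y.
Proof. by rewrite !(dotC z) dotBl. Qed.

Lemma dot0l x : dot 0 x = 0.
Proof. by rewrite -(scale0r (0 : 'rV[R]_m)) dotZl mul0r. Qed.

Lemma dot_ge0 x : 0 <= dot x x.
Proof. by apply: sumr_ge0 => i _; rewrite -expr2 sqr_ge0. Qed.

Lemma enorm_ge0 x : 0 <= enorm x.
Proof. exact: sqrtr_ge0. Qed.

Lemma sqr_enorm x : enorm x ^+ 2 = dot x x.
Proof. by rewrite sqr_sqrtr // dot_ge0. Qed.

Lemma enormZ a x : enorm (a *: x) = `|a| * enorm x.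
Proof. by rewrite /enorm dotZl dotZr mulrA -expr2 sqrtrM ?sqr_ge0 // sqrtr_sqr. Qed.

Lemma enormN x : enorm (- x) = enorm x.
Proof. by rewrite -scaleN1r enormZ normrN1 mul1r. Qed.

Lemma enormBC x y : enorm (x - y) = enorm (y - x).
Proof. by rewrite -enormN opprB. Qed.

Lemma enorm0 : enorm (0 : 'rV[R]_m) = 0.
Proof. by rewrite /enorm dot0l sqrtr0. Qed.

Lemma coord_le_enorm x i : `|x 0 i| <= enorm x.
Proof.
rewrite -sqrtr_sqr /enorm ler_wsqrtr // /dot (bigD1 i) //= expr2 lerDl.
by apply: sumr_ge0 => j _; rewrite -expr2 sqr_ge0.
Qed.

Lemma coord_le_enormB x y i : `|x 0 i - y 0 i| <= enorm (x - y).
Proof. by have := coord_le_enorm (x - y) i; rewrite !mxE. Qed.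

Lemma enorm_eq0 x : (enorm x == 0) = (x == 0).
Proof.
apply/eqP/eqP => [x0|->]; last exact: enorm0.
apply/rowP => i; rewrite mxE; apply/normr0_eq0/le_anti.
by rewrite normr_ge0 andbT -x0 coord_le_enorm.
Qed.

Lemma enorm_gt0 x : (0 < enorm x) = (x != 0).
Proof. by rewrite lt_neqAle enorm_ge0 andbT eq_sym enorm_eq0. Qed.

Lemma Cauchy_Schwarz x y : dot x y <= enorm x * enorm y.
Proof.
have [->|y0] := eqVneq y 0; first by rewrite dotC dot0l enorm0 mulr0.
(* This vector is [enorm y] times the component of [x] orthogonal to [y]; its squared length is the
   gap between the squares of the two sides. *)
have := dot_ge0 (enorm y *: x - (dot x y / enorm y) *: y).
rewrite dotBl !dotBr !dotZl !dotZr -!sqr_enorm (dotC y x).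
have ey : 0 < enorm y by rewrite enorm_gt0.
have -> : enorm y * (enorm y * enorm x ^+ 2) - enorm y * (dot x y / enorm y * dot x y) -
  (dot x y / enorm y * (enorm y * dot x y) - dot x y / enorm y * (dot x y / enorm y * enorm y ^+ 2))
  = (enorm x * enorm y) ^+ 2 - dot x y ^+ 2 by field; rewrite lt0r_neq0.
rewrite subr_ge0 => h.
have [d0|/ltW d0] := leP 0 (dot x y); last by rewrite (le_trans d0)// mulr_ge0 ?enorm_ge0.
by rewrite -(ler_sqr _ _) ?nnegrE // mulr_ge0 ?enorm_ge0.
Qed.

Lemma Cauchy_Schwarz_abs x y : `|dot x y| <= enorm x * enorm y.
Proof.
by rewrite ler_norml Cauchy_Schwarz lerNl -dotNl -(enormN x) Cauchy_Schwarz.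
Qed.

Lemma enormD x y : enorm (x + y) <= enorm x + enorm y.
Proof.
rewrite -(ler_sqr _ _) ?nnegrE ?addr_ge0 ?enorm_ge0//.
rewrite sqr_enorm dotDl !dotDr -!sqr_enorm (dotC y) sqrrD.
by have := Cauchy_Schwarz x y; lra.
Qed.

Lemma enormB_le x y : enorm (x - y) <= enorm x + enorm y.
Proof. by rewrite -(enormN y) enormD. Qed.

Lemma ler_enormB x y : enorm x - enorm y <= enorm (x - y).
Proof. by rewrite lerBlDr -{1}(subrK y x) enormD. Qed.

Lemma ler_enorm_dist x y : `|enorm x - enorm y| <= enorm (x - y).
Proof. by rewrite ler_norml ler_enormB lerNl opprB enormBC ler_enormB. Qed.

Lemma enorm_triangle z x y : enorm (x - y) <= enorm (x - z) + enorm (z - y).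
Proof. by have := enormD (x - z) (z - y); rewrite addrA subrK. Qed.

Lemma enorm_le_sum x : enorm x <= \sum_(i < m) `|x 0 i|.
Proof.
rewrite -(ler_sqr _ _) ?nnegrE ?enorm_ge0 ?sumr_ge0//.
rewrite sqr_enorm /dot expr2 big_distrl /=; apply: ler_sum => i _.
rewrite (le_trans (ler_norm _))// normrM ler_wpM2l// (bigD1 i)//= lerDl.
exact: sumr_ge0.
Qed.

Lemma enorm_le_coord x e : (forall i, `|x 0 i| <= e) -> enorm x <= m%:R * e.
Proof.
move=> h; apply: le_trans (enorm_le_sum x) _.
apply: (@le_trans _ _ (\sum_(i < m) e)); first exact: ler_sum.
by rewrite sumr_const card_ord mulr_natl.
Qed.

(** The topology comes from the sup norm. Since [|x_i| <= enorm x <= m * max |x_i|], Euclidean balls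
    generate the same neighbourhoods, and everything metric below goes through this equivalence. *)
Lemma nbhs_enormP x (A : set 'rV[R]_m) :
  nbhs x A <-> exists2 e, 0 < e & forall y, enorm (x - y) < e -> A y.
Proof.
split.
  move=> /nbhs_ballP[e /= e0 h]; exists e => // y xy; apply: h; split=> // i j.
  rewrite ord1 /ball /=; apply: le_lt_trans xy.
  by have := coord_le_enorm (x - y) j; rewrite !mxE.
move=> [e e0 h]; apply/nbhs_ballP.
(* Dividing by [m.+1] rather than [m] covers [m = 0] and makes the final comparison strict. *)
have m0 : 0 < m.+1%:R :> R by rewrite ltr0n.
exists (e / m.+1%:R) => [/=|y xy]; first by rewrite divr_gt0.
apply: h; apply: (@le_lt_trans _ _ (m%:R * (e / m.+1%:R))).
  apply: enorm_le_coord => i; have := xy.2 0 i; rewrite /ball /= !mxE => /ltW.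
  by [].
rewrite mulrCA gtr_pMr// ltr_pdivrMr// mul1r ltr_nat.
by [].
Qed.

Lemma open_enormP (A : set 'rV[R]_m) :
  open A <-> forall x, A x -> exists2 e, 0 < e & forall y, enorm (x - y) < e -> A y.
Proof.
rewrite openE; split=> h x Ax; first by apply/nbhs_enormP; exact: h.
by apply/nbhs_enormP; exact: h.
Qed.

(** Gauges, support functions and distances are all Lipschitz, so continuity, measurability and
    attained extrema are drawn from this single notion. The sign of [L] is left free, which explains
    [|L| + 1] in the continuity proof. *)
Definition elipschitz (f : 'rV[R]_m -> R) (L : R) :=
  forall x y, `|f x - f y| <= L * enorm (x - y).

Lemma elipschitz_continuous f L : elipschitz f L -> continuous f.
Proof.
move=> h x; apply/(@cvgrPdist_lt _ _ _ _ (nbhs_filter x)) => e e0.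
have L0 : 0 < `|L| + 1 by rewrite ltr_pwDr.
apply/nbhs_enormP; exists (e / (`|L| + 1)); first exact: divr_gt0.
move=> y; rewrite ltr_pdivlMr// => xy.
apply: le_lt_trans (h x y) _; apply: le_lt_trans xy.
rewrite mulrC ler_wpM2l ?enorm_ge0// (le_trans (ler_norm _))// lerDl.
by [].
Qed.

Lemma elipschitz_enorm : elipschitz (@enorm R m) 1.
Proof. by move=> x y; rewrite mul1r ler_enorm_dist. Qed.

Lemma elipschitz_dot z : elipschitz (dot z) (enorm z).
Proof. by move=> x y; rewrite -dotBr Cauchy_Schwarz_abs. Qed.

Lemma continuous_enorm : continuous (@enorm R m).
Proof. exact: elipschitz_continuous elipschitz_enorm. Qed.

Lemma continuous_dot z : continuous (dot z).
Proof. exact: elipschitz_continuous (elipschitz_dot z). Qed.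

Lemma enorm_closed_bounded_compact (A : set 'rV[R]_m) b :
  closed A -> (forall x, A x -> enorm x <= b) -> compact A.
Proof.
move=> cA hb; apply: bounded_closed_compact => //.
exists b; split; first exact: num_real.
move=> M bM x Ax /=; rewrite /Num.norm /= mx_normrE.
apply/bigmax_leP; split=> [|[i j] _ /=].
  exact: le_trans (le_trans (enorm_ge0 x) (hb _ Ax)) (ltW bM).
by rewrite ord1 (le_trans (coord_le_enorm _ _))// (le_trans (hb _ Ax))// ltW.
Qed.

(** [phi] is the distance to [A], or the constant 1 when [A] is empty. Its superlevel sets exhaust
    the complement of [A] by closed sets at positive distance from [A]. *)
Lemma closed_elipschitz_zero (A : set 'rV[R]_m) : closed A ->
  exists phi : 'rV[R]_m -> R, [/\ elipschitz phi 1, forall x, 0 <= phi x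
    & forall x, A x <-> phi x = 0].
Proof.
move=> cA; have [->|/set0P[a Aa]] := eqVneq A set0.
  exists (fun=> 1); split=> //; first by move=> x y; rewrite subrr normr0 mul1r enorm_ge0.
  by move=> x; split=> // /eqP; rewrite oner_eq0.
pose D x := [set enorm (x - y) | y in A].
have D0 x : D x !=set0 by exists (enorm (x - a)); exists a.
have Dlb x : lbound (D x) 0 by move=> _ [y _ <-]; exact: enorm_ge0.
have Dh x : has_lbound (D x) by exists 0.
have le_inf x y : A y -> inf (D x) <= enorm (x - y).
  by move=> Ay; apply: ge_inf => //; exists y.
have key x y : inf (D x) - inf (D y) <= enorm (x - y).
  rewrite lerBlDr -lerBlDl; apply: lb_le_inf => // _ [z Az <-].
  rewrite lerBlDl; apply: le_trans (le_inf _ _ Az) _.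
  exact: enorm_triangle.
exists (fun x => inf (D x)); split.
- by move=> x y; rewrite mul1r ler_norml key lerNl opprB enormBC key.
- by move=> x; apply: lb_le_inf.
- move=> x; split=> [Ax|i0].
    apply/le_anti/andP; split; last exact: lb_le_inf.
    by rewrite (le_trans (le_inf x x Ax))// subrr enorm0.
  apply: contrapT => nAx; have : open (~` A) by exact: closed_openC.
  move/open_enormP => /(_ x nAx)[e e0 h].
  have hi : has_inf (D x) by split.
  have [_ [y Ay <-]] := inf_adherent e0 hi.
  by rewrite i0 add0r => /h.
Qed.

Lemma compact_elipschitz_max (A : set 'rV[R]_m) (f : 'rV[R]_m -> R) L :
  A !=set0 -> compact A -> elipschitz f L ->
  exists2 c, A c & forall x, A x -> f x <= f c.
Proof.
move=> A0 cA fL; have [|c] := @EVT_max_rV R m f A A0 cA.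
  exact/continuous_subspaceT/(elipschitz_continuous fL).
by rewrite inE => Ac h; exists c => // x Ax; apply: h; rewrite inE.
Qed.

Lemma compact_elipschitz_min (A : set 'rV[R]_m) (f : 'rV[R]_m -> R) L :
  A !=set0 -> compact A -> elipschitz f L ->
  exists2 c, A c & forall x, A x -> f c <= f x.
Proof.
move=> A0 cA fL.
have [|c Ac h] := @compact_elipschitz_max A (fun x => - f x) L A0 cA.
  by move=> x y; rewrite -opprD normrN fL.
by exists c => // x /h; rewrite lerN2.
Qed.

Lemma closed_le_continuous (f : 'rV[R]_m -> R) a :
  continuous f -> closed [set x | f x <= a].
Proof.
by move=> cf; apply: (@preimage_closed _ _ f [set y | y <= a]) => //; exact: closed_le.
Qed.

Lemma open_gt_continuous (f : 'rV[R]_m -> R) a :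
  continuous f -> open [set x | a < f x].
Proof.
by move=> cf; apply: (@open_comp _ _ f [set y | a < y]) => //; exact: open_gt.
Qed.

Lemma sphere_normalize_gen x : x != 0 -> enorm ((enorm x)^-1 *: x) = 1.
Proof.
move=> x0; rewrite enormZ gtr0_norm ?invr_gt0 ?enorm_gt0// mulVf//.
by rewrite enorm_eq0.
Qed.

(** The difference splits into [(x - y) / |x|] and a multiple of [y] of length
    [| |y| - |x| | / |x|]; each is at most [|x - y|] because [|x| >= 1]. *)
Lemma enorm_normalizeB x y : 1 <= enorm x -> 1 <= enorm y ->
  enorm ((enorm x)^-1 *: x - (enorm y)^-1 *: y) <= 2 * enorm (x - y).
Proof.
move=> x1 y1; have x0 := lt_le_trans ltr01 x1; have y0 := lt_le_trans ltr01 y1.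
have -> : (enorm x)^-1 *: x - (enorm y)^-1 *: y =
    (enorm x)^-1 *: (x - y) + ((enorm y - enorm x) / (enorm x * enorm y)) *: y.
  by apply/rowP => i; rewrite !mxE; field; rewrite !gt_eqF.
apply: le_trans (enormD _ _) _; rewrite !enormZ !normrM !normfV.
rewrite !(gtr0_norm x0) (gtr0_norm (mulr_gt0 _ _))// invfM -!mulrA.
rewrite mulVf ?gt_eqF// mulr1.
have i1 : (enorm x)^-1 <= 1 by rewrite invf_le1.
have i0 : 0 <= (enorm x)^-1 by rewrite invr_ge0 ltW.
have := ler_enorm_dist y x; rewrite enormBC => h.
have := enorm_ge0 (x - y) => h0.
have h1 : (enorm x)^-1 * enorm (x - y) <= enorm (x - y) by rewrite ler_piMl.
have h2 : `|enorm y - enorm x| * (enorm x)^-1 <= enorm (x - y).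
  by rewrite (le_trans _ h)// ler_piMr.
by lra.
Qed.

End Euclid.

(** * Hausdorff measure of the sphere *)

Section HausdorffCovers.
Variables (R : realType) (m : nat).
Local Notation T := ('rV[R]_m).
Local Notation H := (@hausdorff R m).

Lemma ball_volume_gt0 k : (0 < ball_volume R k)%R.
Proof.
suff : ((0 < ball_volume R k) && (0 < ball_volume R k.+1))%R by case/andP.
elim: k => [|k /andP[h1 h2]]; first by rewrite /= ltr01 ltr0n.
by rewrite h2 /= mulr_gt0 // divr_gt0 ?ltr0n// mulr_gt0 ?ltr0n// pi_gt0.
Qed.

Lemma diameter_leP (A : set T) (d : R) :
  (forall x y, A x -> A y -> enorm (x - y) <= d) <-> (diameter A <= d%:E)%E.
Proof.
split=> [h|h x y Ax Ay].
  by apply: ge_ereal_sup => _ [[x y] [/= Ax Ay] <-]; rewrite lee_fin h.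
by rewrite -lee_fin (le_trans _ h)//; apply: ereal_sup_ubound; exists (x, y).
Qed.

Lemma hausdorff_gauge_le k (A : set T) (d : R) : (0 <= d)%R -> (diameter A <= d%:E)%E ->
  (hausdorff_gauge k A <= (ball_volume R k * (d / 2) ^+ k)%:E)%E.
Proof.
move=> d0 dA; rewrite /hausdorff_gauge; case: eqVneq => [_|/set0P A0].
  by rewrite lee_fin mulr_ge0 ?ball_volume_ge0// exprn_ge0// divr_ge0.
rewrite EFinM lee_wpmul2l ?lee_fin ?ball_volume_ge0//.
have : (0 <= diameter A)%E by exact: diameter_ge0.
case: (diameter A) dA => [r| |]//; rewrite !lee_fin => rd r0.
by rewrite -EFin_expe lee_fin lerXn2r ?nnegrE ?mulr_ge0 ?ler_wpM2r.
Qed.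

Lemma hausdorff_gauge_fin k (A : set T) (d : R) : A !=set0 -> diameter A = d%:E ->
  hausdorff_gauge k A = (ball_volume R k * (d / 2) ^+ k)%:E.
Proof.
move=> /set0P A0 dA; rewrite /hausdorff_gauge (negbTE A0) dA.
by rewrite EFinM EFin_expe.
Qed.

Lemma le_diameter (A B : set T) : A `<=` B -> (diameter A <= diameter B)%E.
Proof.
move=> AB; apply: ereal_sup_le => _ [p [/AB h1 /AB h2] <-].
by exists p.
Qed.

Lemma le_hausdorff_gauge k (A B : set T) : A `<=` B ->
  (hausdorff_gauge k A <= hausdorff_gauge k B)%E.
Proof.
move=> AB; rewrite {1}/hausdorff_gauge; case: eqVneq => [_|/set0P A0].
  exact: hausdorff_gauge_ge0.
have B0 : B !=set0 by case: A0 => x /AB; exists x.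
rewrite /hausdorff_gauge; case: eqVneq B0 => [-> []//|_ B0].
rewrite lee_wpmul2l ?lee_fin ?ball_volume_ge0//.
have i0 : (0 <= (2^-1 : R)%:E)%E by rewrite lee_fin invr_ge0.
have dA : (0 <= diameter A * (2^-1)%:E)%E by rewrite mule_ge0// diameter_ge0.
have dAB : (diameter A * (2^-1)%:E <= diameter B * (2^-1)%:E)%E.
  by rewrite lee_wpmul2r// le_diameter.
elim: k => [//|k ih]; rewrite !expeS; apply: lee_pmul => //.
exact: expe_ge0.
Qed.

Lemma hausdorff_delta_finite_cover k delta (A : set T) (N : nat) (F : nat -> set T) (d : R) :
  (0 <= d <= delta)%R -> A `<=` \bigcup_(i in `I_N) F i ->
  (forall i, (i < N)%N -> diameter (F i) <= d%:E)%E ->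
  (hausdorff_delta k delta A <= (N%:R * (ball_volume R k * (d / 2) ^+ k))%:E)%E.
Proof.
move=> /andP[d0 dd] AF dF.
pose F' i := if (i < N)%N then F i else set0.
set c := (ball_volume R k * (d / 2) ^+ k)%R.
have c0 : (0 <= c)%R by rewrite mulr_ge0 ?ball_volume_ge0// exprn_ge0// divr_ge0.
apply: (@le_trans _ _ (\sum_(i <oo) hausdorff_gauge k (F' i))%E).
  apply: ereal_inf_lbound; exists F' => //; split.
    by move=> x /AF[i /= iN Fx]; exists i => //; rewrite /F' iN.
  move=> i; rewrite /F'; case: ifP => [iN|_].
    by rewrite (le_trans (dF _ iN))// lee_fin.
  rewrite /diameter (_ : [set _ | _ in _] = set0) ?ereal_sup0 ?leNye//.
  by rewrite -subset0 => x [p [[]]].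
apply: lime_le; first by apply: is_cvg_nneseries => i _ _; exact: hausdorff_gauge_ge0.
apply: nearW => n.
have gF i : (hausdorff_gauge k (F' i) <= ((i < N)%N%:R * c)%:E)%E.
  rewrite /F'; case: ifP => [iN|_]; last by rewrite mul0r /hausdorff_gauge eqxx.
  by rewrite mul1r hausdorff_gauge_le// dF.
have h : (\sum_(0 <= i < n) hausdorff_gauge k (F' i) <= ((minn n N)%:R * c)%:E)%E.
  elim: n => [|j ih]; first by rewrite big_geq// min0n mul0r.
  rewrite big_nat_recr//=.
  have -> : minn j.+1 N = (minn j N + (j < N)%N)%N by case: (ltnP j N); lia.
  by rewrite natrD mulrDl EFinD leeD.
apply: le_trans h _; rewrite lee_fin ler_wpM2r// ler_nat geq_minr.
by [].
Qed.

Lemma interval_cell (B t : R) (M : nat) : (0 < B)%R -> (0 < M)%N -> (`|t| <= B)%R ->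
  exists i : 'I_M, (- B + 2 * B / M%:R * i%:R <= t <= - B + 2 * B / M%:R * i.+1%:R)%R.
Proof.
case: M => // M B0 _; rewrite ler_norml => /andP[t1 t2].
pose w := (2 * B / M.+1%:R)%R.
have w0 : (0 < w)%R by rewrite divr_gt0 ?mulr_gt0.
have wM : (w * M.+1%:R = 2 * B)%R by rewrite /w divfK// pnatr_eq0.
(* Truncation would send the right endpoint to cell [M], which does not exist; it is put in the last
   cell instead. *)
have [-> |tB] := eqVneq t B.
  exists ord_max; rewrite -/w /= wM; apply/andP; split; last by lra.
  have : (w * M%:R <= w * M.+1%:R)%R by rewrite ler_pM2l// ler_nat.
  by rewrite wM; lra.
have tw : (0 <= (t + B) / w)%R by rewrite divr_ge0//; [lra|exact: ltW].
have /andP[k1 k2] := truncn_itv tw.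
have kM : (Num.truncn ((t + B) / w) < M.+1)%N.
  rewrite -(ltr_nat R); apply: le_lt_trans k1 _.
  rewrite ltr_pdivrMr// mulrC wM.
  have : (t < B)%R by rewrite lt_neqAle tB.
  by lra.
exists (Ordinal kM); rewrite -/w /=; move: k1 k2.
rewrite ler_pdivlMr// ltr_pdivrMr// ![(_ * w)%R]mulrC => k1 k2.
by apply/andP; split; lra.
Qed.

Lemma div_truncn_le (a d : R) (M : nat) : (0 < d)%R ->
  (Num.truncn (a / d) < M)%N -> (a / M%:R <= d)%R.
Proof.
move=> d0 tM; have M0 : (0 < M%:R :> R)%R by rewrite ltr0n; case: M tM.
rewrite ler_pdivrMr// mulrC -ler_pdivrMr// ltW//.
by apply: lt_le_trans (truncnS_gt _) _; rewrite ler_nat.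
Qed.

(** The coordinates [phi] map [A] into the cube [[-B, B]^J], and their inverse is Lipschitz with
    constant [C]. Cutting the cube into [M ^ #|J|] cells of side [2 B / M] covers [A] by sets of
    diameter at most [2 C B / M]. For [k = #|J|] the bound does not depend on [M]; for
    [k = #|J| + 1] it is of order [1 / M]. *)
Lemma hausdorff_delta_cells (J : finType) k delta (A : set T) (phi : J -> T -> R)
    (B C : R) (M : nat) :
  (0 < B)%R -> (0 <= C)%R -> (0 < M)%N -> (2 * C * (B / M%:R) <= delta)%R ->
  (forall x j, A x -> (`|phi j x| <= B)%R) ->
  (forall x y (e : R), A x -> A y -> (0 <= e)%R -> (forall j, `|phi j x - phi j y| <= e)%R ->
     (enorm (x - y) <= C * e)%R) ->
  (hausdorff_delta k delta A <=
     ((M ^ #|J|)%:R * (ball_volume R k * (C * (B / M%:R)) ^+ k))%:E)%E.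
Proof.
move=> B0 C0 M0 Cd AB AC.
pose w := (2 * B / M%:R)%R.
have w0 : (0 <= w)%R by rewrite divr_ge0// mulr_ge0// ltW.
have dE : (2 * C * (B / M%:R) = C * w)%R by rewrite /w; ring.
pose G (f : {ffun J -> 'I_M}) := [set x | A x /\
  forall j, (- B + w * (f j)%:R <= phi j x <= - B + w * (f j).+1%:R)%R].
pose F i := if insub i is Some i' then G (enum_val (i' : 'I_#|{ffun J -> 'I_M}|)) else set0.
have -> : (M ^ #|J|)%N = #|{ffun J -> 'I_M}| by rewrite card_ffun card_ord.
have -> : (C * (B / M%:R) = (C * w) / 2)%R by rewrite /w; lra.
apply: (@hausdorff_delta_finite_cover k delta A _ F).
- by rewrite -dE Cd andbT dE mulr_ge0.
- move=> x Ax.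
  have /choice[f hf] : forall j, exists i : 'I_M,
      (- B + w * i%:R <= phi j x <= - B + w * i.+1%:R)%R.
    by move=> j; apply: interval_cell => //; exact: AB.
  exists (enum_rank [ffun j => f j]) => //=.
  rewrite /F valK enum_rankK; split=> // j.
  by rewrite ffunE; exact: hf.
- move=> i iN; apply/diameter_leP => x y; rewrite /F; case: insubP => [u _ _|//].
  move=> [Ax hx] [Ay hy]; apply: AC => // j.
  have := hx j; have := hy j; rewrite -addn1 natrD mulrDr mulr1 ler_norml.
  by move=> /andP[? ?] /andP[? ?]; apply/andP; split; lra.
Qed.

Lemma hausdorff_cells_finite (J : finType) (A : set T) (phi : J -> T -> R) (B C : R) :
  (0 < B)%R -> (0 <= C)%R -> 
  (forall x j, A x -> (`|phi j x| <= B)%R) ->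
  (forall x y (e : R), A x -> A y -> (0 <= e)%R -> (forall j, `|phi j x - phi j y| <= e)%R ->
     (enorm (x - y) <= C * e)%R) ->
  (H #|J| A < +oo)%E.
Proof.
move=> B0 C0 AB AC; apply: (@le_lt_trans _ _ (ball_volume R #|J| * (C * B) ^+ #|J|)%:E); last exact: ltry.
apply: ge_ereal_sup => _ [d /= d0 <-].
have [M M0 Md] : exists2 M, (0 < M)%N & (2 * C * (B / M%:R) <= d)%R.
  exists (Num.truncn (2 * C * B / d)).+1 => //.
  by rewrite mulrA div_truncn_le.
apply: le_trans (hausdorff_delta_cells #|J| B0 C0 M0 Md AB AC) _.
rewrite lee_fin natrX mulrCA -exprMn.
by rewrite (_ : (M%:R * (C * (B / M%:R)) = C * B)%R)//; field; rewrite pnatr_eq0 -lt0n.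
Qed.

Lemma hausdorff_cells_null (J : finType) (A : set T) (phi : J -> T -> R) (B C : R) :
  (0 < B)%R -> (0 <= C)%R -> 
  (forall x j, A x -> (`|phi j x| <= B)%R) ->
  (forall x y (e : R), A x -> A y -> (0 <= e)%R -> (forall j, `|phi j x - phi j y| <= e)%R ->
     (enorm (x - y) <= C * e)%R) ->
  H #|J|.+1 A = 0%E.
Proof.
move=> B0 C0 AB AC; apply/eqP; rewrite eq_le hausdorff_ge0 andbT.
apply: ge_ereal_sup => _ [d /= d0 <-].
apply/lee_addgt0Pr => e e0; rewrite add0e.
(* The bound given by the cells is [K / M]. The first truncation in [M] makes the cells finer than
   [d], the second makes [K / M <= e]. *)
pose K := (ball_volume R #|J|.+1 * (C * B) ^+ #|J|.+1)%R.
pose M := (Num.truncn (2 * C * B / d) + Num.truncn (K / e)).+1.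
have M0 : (0 < M%:R :> R)%R by rewrite ltr0n.
have Md : (2 * C * (B / M%:R) <= d)%R.
  by rewrite mulrA div_truncn_le// ltnS leq_addr.
apply: le_trans (hausdorff_delta_cells #|J|.+1 B0 C0 _ Md AB AC) _ => //.
rewrite lee_fin natrX (_ : _ * _ = K / M%:R)%R; last first.
  rewrite /K [(C * (B / _))%R]mulrA expr_div_n (exprSr M%:R).
  have : (M%:R ^+ #|J| != 0 :> R)%R by rewrite expf_neq0// gt_eqF.
  set a := ((_ * B) ^+ _)%R; set b := (M%:R ^+ #|J|)%R => b0.
  by field; rewrite b0 gt_eqF.
by rewrite div_truncn_le// ltnS leq_addl.
Qed.

Lemma card_ord_close (M D : nat) (X : {set 'I_M}) :
  (forall g g', g \in X -> g' \in X -> (g - g' <= D)%N) -> (#|X| <= D.+1)%N.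
Proof.
move=> h; have [->|[g0 g0X]] := set_0Vmem X; first by rewrite cards0.
case: (@arg_minnP _ g0 (fun i => i \in X) (fun i => nat_of_ord i)) => // a aX amin.
pose f (g : 'I_M) : 'I_D.+1 := inord (g - a).
rewrite -[leqRHS]card_ord -(card_in_imset (f := f)); first exact: max_card.
move=> g g' gX g'X /(congr1 val) /=; rewrite !inordK ?ltnS ?h// => e.
by apply: val_inj => /=; have := amin _ gX; have := amin _ g'X; lia.
Qed.

(** Each coordinate of the elements of [X] stays in an integer interval of length at most [D]. This
    bounds how many grid points a set of small diameter can contain. *)
Lemma card_ffun_close (J : finType) (M : nat) (D : R) (X : {set {ffun J -> 'I_M}}) :
  (0 <= D)%R ->
  (forall g g', g \in X -> g' \in X -> forall j, (`|(g j)%:R - (g' j)%:R| <= D)%R) ->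
  (#|X|%:R <= (D + 1) ^+ #|J|)%R.
Proof.
move=> D0 h; pose d := Num.truncn D; have /andP[d1 _] := truncn_itv D0.
pose F j := ((fun g : {ffun J -> 'I_M} => g j) @: X).
have XF : (#|X| <= #|family (fun j => mem (F j))|)%N.
  apply: subset_leq_card; apply/fintype.subsetP => g gX; apply/familyP => j.
  by apply/imsetP; exists g.
have cF j : (#|mem (F j)| <= d.+1)%N.
  apply: card_ord_close => _ _ /imsetP[g gX ->] /imsetP[g' g'X ->].
  have := h _ _ gX g'X j.
  case: (leqP (g' j) (g j)) => gg; last first.
    by move=> _; move: gg => /ltnW; rewrite -subn_eq0 => /eqP ->.
  rewrite -natrB// normr_nat => hD.
  by rewrite /d truncn_ge_nat.
apply: (@le_trans _ _ ((d.+1 ^ #|J|)%:R)%R).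
  rewrite ler_nat (leq_trans XF)// card_family.
  rewrite cardE /image_mem; elim: (enum _) => //= j s ih; rewrite expnS leq_mul//.
  exact: cF.
by rewrite natrX lerXn2r ?nnegrE ?addr_ge0// -natr1 lerD2r.
Qed.

(** A counting argument in place of Lebesgue measure. [A] contains [M ^ n] points indexed by a grid
    and spaced at least [1 / (L M)] apart per grid step. Given a cover of [A], the pieces are
    enlarged to open sets, finitely many suffice by compactness, and for large [M] a piece of size
    [s] holds at most [(4 L s M) ^ n] grid points. Since all [M ^ n] points are covered, the sum of
    the [(4 L s) ^ n] is at least 1, and removing the enlargement costs at most one half. *)
Lemma hausdorff_delta_grid_ge (J : finType) (A : set T) (L : R)
    (b : forall M : nat, {ffun J -> 'I_M} -> T) :
  (0 < #|J|)%N -> compact A -> (0 < L)%R ->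
  (forall M g, (0 < M)%N -> A (b M g)) ->
  (forall M (g g' : {ffun J -> 'I_M}) j, (0 < M)%N -> (`|(g j)%:R - (g' j)%:R| <= L * M%:R * enorm (b M g - b M g'))%R) ->
  (0 < H #|J| A)%E.
Proof.
move=> J0 cA L0 Ab bL; set n := #|J|.
pose k := (ball_volume R n / (2 * (16 * L) ^+ n))%R.
have k0 : (0 < k)%R by rewrite divr_gt0 ?ball_volume_gt0// mulr_gt0// exprn_gt0// mulr_gt0.
apply: (@lt_le_trans _ _ k%:E); first by rewrite lte_fin.
apply: le_trans (le_hausdorff_deltaT _ _ (@ltr01 R)).
apply: le_ereal_inf_tmp => _ [F [AF dF] <-].
have dfin i : exists d : R, [/\ (0 <= d)%R,
   (forall x y, F i x -> F i y -> enorm (x - y) <= d)%R &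
   ((ball_volume R n * (d / 2) ^+ n)%:E <= hausdorff_gauge n (F i))%E].
  have [F0|/set0P F0] := eqVneq (F i) set0.
    exists 0%R; split=> //; first by rewrite F0.
    by rewrite mul0r expr0n gtn_eqF// mulr0 hausdorff_gauge_ge0.
  have := diameter_ge0 F0; have := dF i.
  case E : (diameter (F i)) => [d| |]//; rewrite !lee_fin => _ d0.
  exists d; split=> //; last by rewrite (hausdorff_gauge_fin n F0 E).
  by apply/diameter_leP; rewrite E.
have [d /all_and3[d0 dFi dg]] := choice dfin.
(* The enlargement makes [s i] positive even for a single point; its contributions [2^-(i+2)] add up
   to at most [1 / 2]. *)
pose s i := (d i + (2 ^+ i.+2)^-1 / (8 * L))%R.
have s0 i : (0 < s i)%R by rewrite ltr_wpDl// divr_gt0 ?invr_gt0 ?exprn_gt0 ?mulr_gt0.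
pose O i := [set x | exists2 c, (A `&` F i) c & (enorm (c - x) < s i)%R].
have [D _ AD] : finite_subset_cover [set: nat] O A.
  move: cA; rewrite compact_cover; apply.
    move=> i _; apply/open_enormP => x [c Ac cx].
    exists (s i - enorm (c - x))%R; first by rewrite subr_gt0.
    move=> y; rewrite ltrBrDl => h; exists c => //.
    exact: le_lt_trans (enorm_triangle x _ _) h.
  move=> x Ax; have [i _ Fx] := AF x Ax.
  by exists i => //; exists x => //; rewrite subrr enorm0.
pose N := (\max_(i <- finmap.enum_fset D) i).+1.
have AN x : A x -> exists2 i : 'I_N, O i x & true.
  move=> /AD[i /= iD Ox].
  have iN : (i < N)%N by rewrite /N ltnS; apply: leq_bigmax_seq.
  by exists (Ordinal iN).
have sumlt : (1 <= \sum_(i < N) (4 * L * s i) ^+ n)%R.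
  (* Large enough that [1 <= L * s i * M] for every [i]. Two points of [O i] are at most
     [s i + d i + s i <= 3 * s i] apart, and the [+ 1] of the count is absorbed when 3 becomes 4. *)
  pose M := (\sum_(i < N) (Num.truncn (1 / (L * s i))).+1)%N.
  have M0 : (0 < M)%N.
    by rewrite /M big_ord_recl addSn.
  have MN (i : 'I_N) : (1 <= L * s i * M%:R)%R.
    rewrite mulrC -ler_pdivrMr ?mulr_gt0// ltW//.
    apply: lt_le_trans (truncnS_gt _) _.
    by rewrite ler_nat /M (bigD1 i)//= leq_addr.
  pose X (i : 'I_N) := [set g : {ffun J -> 'I_M} | `[< O i (b M g) >]]%SET.
  have cX i : (#|X i|%:R <= (4 * L * s i * M%:R) ^+ n :> R)%R.
    have Ls0 : (0 <= 3 * (L * s i * M%:R))%R by rewrite !mulr_ge0// ?ltW// s0.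
    apply: le_trans (card_ffun_close Ls0 _) _; last first.
      rewrite lerXn2r ?nnegrE ?addr_ge0// ?mulr_ge0// ?(ltW L0)// ?(ltW (s0 _))//.
      by have := MN i; lra.
    move=> g g'; rewrite !finset.in_set => /asboolP[c [_ Fc] cg] /asboolP[c' [_ Fc'] cg'] j.
    apply: le_trans (bL _ _ _ _ M0) _.
    have := enorm_triangle c (b M g) (b M g').
    have := enorm_triangle c' c (b M g').
    have := dFi _ _ _ Fc Fc'; rewrite (enormBC (b M g) c).
    have : (d i <= s i)%R by rewrite lerDl ltW// divr_gt0 ?invr_gt0 ?exprn_gt0 ?mulr_gt0.
    move=> h1 h2 h3 h4.
    have -> : (3 * (L * s i * M%:R) = L * M%:R * (3 * s i))%R by ring.
    by rewrite ler_wpM2l ?mulr_ge0// ?ltW//; lra.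
  have cc : (M ^ n <= \sum_(i < N) #|X i|)%N.
    have -> : (M ^ n)%N = #|[set: {ffun J -> 'I_M}]%SET| by rewrite cardsT card_ffun card_ord.
    apply: (@leq_trans #|(\bigcup_(i < N) X i)%SET|).
      apply: subset_leq_card; apply/fintype.subsetP => g _; apply/bigcupP.
      by have [i Oi _] := AN _ (Ab _ g M0); exists i => //; rewrite finset.in_set; apply/asboolP.
    elim/big_rec2: _ => [|i c Y _ ih]; first by rewrite cards0.
    by rewrite (leq_trans (leq_card_setU _ _))// leq_add2l.
  have Mn : (0 < M%:R ^+ n :> R)%R by rewrite exprn_gt0// ltr0n.
  rewrite -(ler_pM2r Mn) mul1r -natrX; apply: le_trans (_ : (\sum_(i < N) #|X i|)%:R <= _)%R.
    by rewrite ler_nat.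
  rewrite natr_sum mulr_suml; apply: ler_sum => i _.
  by rewrite natrX -exprMn cX.
have half : (1 / 2 <= \sum_(i < N) (8 * L * d i) ^+ n)%R.
  have h1 : (\sum_(i < N) (4 * L * s i) ^+ n <=
      \sum_(i < N) ((8 * L * d i) ^+ n + (2 ^+ i.+2)^-1))%R.
    apply: ler_sum => i _; set e := ((2 ^+ i.+2)^-1)%R.
    have e0 : (0 < e)%R by rewrite invr_gt0 exprn_gt0.
    have e1 : (e <= 1)%R by rewrite invf_le1 ?exprn_gt0// exprn_ege1// ler1n.
    (* A mean is at most the larger of its two terms, so its power is at most
       [(8 L d_i) ^ n + e ^ n], and [e ^ n <= e]. *)
    have -> : (4 * L * s i = (8 * L * d i + e) / 2)%R.
      by rewrite /s -/e; field; rewrite gt_eqF.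
    have a0 : (0 <= 8 * L * d i)%R by rewrite !mulr_ge0// ltW.
    have een : (e ^+ n <= e)%R by rewrite -[leRHS]expr1 ler_wiXn2l// ltW.
    have [le|le] := leP e (8 * L * d i)%R.
      apply: le_trans (_ : (8 * L * d i) ^+ n <= _)%R; last by rewrite lerDl ltW.
      by rewrite lerXn2r ?nnegrE// ?divr_ge0// ?addr_ge0// ?(ltW e0)//; lra.
    apply: le_trans (_ : e ^+ n <= _)%R; last by rewrite ler_wpDl// exprn_ge0.
    by rewrite lerXn2r ?nnegrE// ?divr_ge0// ?addr_ge0// ?(ltW e0)//; lra.
  have h2 : (\sum_(i < N) (2 ^+ i.+2)^-1 <= 1 / 2 :> R)%R.
    suff : (\sum_(i < N) (2 ^+ i.+2)^-1 = 1 / 2 - (2 ^+ N.+1)^-1 :> R)%R.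
      by move=> ->; rewrite gerBl invr_ge0 exprn_ge0.
    elim: (N) => [|j ih]; first by rewrite big_ord0 expr1; lra.
    rewrite big_ord_recr /= ih (exprS _ j.+1) invfM.
    by set x := (_ ^- _)%R; lra.
  by move: (le_trans sumlt h1); rewrite big_split /=; lra.
apply: (@le_trans _ _ (\sum_(0 <= i < N) hausdorff_gauge n (F i))%E); last first.
  by apply: nneseries_lim_ge => i _ _; exact: hausdorff_gauge_ge0.
rewrite big_mkord; apply: (@le_trans _ _ (\sum_(i < N) (ball_volume R n * (d i / 2) ^+ n)%:E)%E).
  rewrite sumEFin lee_fin.
  have -> : (\sum_(i < N) ball_volume R n * (d i / 2) ^+ n =
      ball_volume R n / (16 * L) ^+ n * \sum_(i < N) (8 * L * d i) ^+ n)%R.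
    rewrite mulr_sumr; apply: eq_bigr => i _; rewrite -mulrA -exprVn -exprMn.
    by congr (_ * _ ^+ _)%R; field; rewrite gt_eqF.
  have L16 : (0 < (16 * L) ^+ n)%R by rewrite exprn_gt0// mulr_gt0.
  have -> : k = (ball_volume R n / (16 * L) ^+ n * (1 / 2))%R.
    rewrite /k; move: (gt_eqF L16); set z := ((16 * L) ^+ n)%R => z0.
    by field; rewrite z0.
  by rewrite ler_wpM2l// divr_ge0// ltW// ball_volume_gt0.
by apply: lee_sum => i _; exact: dg.
Qed.

Lemma hausdorff0_ge1 (A : set T) : A !=set0 -> (1 <= H 0 A)%E.
Proof.
move=> [x Ax]; apply: le_trans (le_hausdorff_deltaT _ _ (@ltr01 R)).
apply: le_ereal_inf_tmp => _ [F [AF dF] <-].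
have [i _ Fx] := AF x Ax.
have -> : (1 = hausdorff_gauge 0 (F i))%E.
  rewrite /hausdorff_gauge expe0 mule1; case: eqVneq => // F0.
  by move: Fx; rewrite F0.
apply: le_trans (nneseries_lim_ge i.+1 _); last by move=> j _ _; exact: hausdorff_gauge_ge0.
rewrite big_nat_recr//= leeDr// sume_ge0// => j _; exact: hausdorff_gauge_ge0.
Qed.

Lemma hausdorff_delta_anti k (d1 d2 : R) (A : set T) : (d1 <= d2)%R ->
  (hausdorff_delta k d2 A <= hausdorff_delta k d1 A)%E.
Proof.
move=> d12; apply: ereal_inf_le_tmp => _ [F [AF dF] <-]; exists F => //; split=> // i.
by rewrite (le_trans (dF i))// lee_fin.
Qed.

(** A covering set of diameter at most [d < d0] cannot meet both [A] and [B], so every cover of the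
    union splits into a cover of each. *)
Lemma hausdorff_delta_separated k (d d0 : R) (A B : set T) : (d < d0)%R ->
  (forall x y, A x -> B y -> (d0 <= enorm (x - y))%R) ->
  (hausdorff_delta k d A + hausdorff_delta k d B <= hausdorff_delta k d (A `|` B))%E.
Proof.
move=> dd AB; apply: le_ereal_inf_tmp => _ [F [ABF dF] <-].
apply: (@le_trans _ _ (\sum_(i <oo) (hausdorff_gauge k (F i `&` A)
     + hausdorff_gauge k (F i `&` B)))%E).
  rewrite nneseriesD; [|by move=> *; exact: hausdorff_gauge_ge0..].
  apply: leeD; apply: ereal_inf_lbound.
    exists (fun i => F i `&` A) => //; split.
      by move=> x Ax; have [i _ Fx] := ABF _ (or_introl Ax); exists i.
    by move=> i; apply: le_trans (dF i); apply: le_diameter => x [].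
  exists (fun i => F i `&` B) => //; split.
    by move=> x Ax; have [i _ Fx] := ABF _ (or_intror Ax); exists i.
  by move=> i; apply: le_trans (dF i); apply: le_diameter => x [].
apply: lee_nneseries => [i _ _|i _].
  by rewrite adde_ge0// hausdorff_gauge_ge0.
have [e|/set0P[x [Fx Ax]]] := eqVneq (F i `&` A) set0.
  rewrite e {1}/hausdorff_gauge eqxx add0e; apply: le_hausdorff_gauge.
  by move=> y [].
have -> : F i `&` B = set0.
  rewrite -subset0 => y [Fy By]; have := AB _ _ Ax By.
  have := (diameter_leP (F i) d).2 (dF i) _ _ Fx Fy.
  by move=> h1 h2; have := le_lt_trans (le_trans h2 h1) dd; rewrite ltxx.
rewrite {2}/hausdorff_gauge eqxx adde0; apply: le_hausdorff_gauge.
by move=> y [].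
Qed.

(** The metric outer measure property. The two suprema over scales are taken independently; any pair
    of scales is dominated by one common scale below [d0]. *)
Lemma hausdorff_separated k (d0 : R) (A B : set T) : (0 < d0)%R ->
  (forall x y, A x -> B y -> (d0 <= enorm (x - y))%R) ->
  (H k A + H k B <= H k (A `|` B))%E.
Proof.
move=> d0p AB.
have key (d1 d2 : R) : (0 < d1)%R -> (0 < d2)%R ->
    (hausdorff_delta k d1 A + hausdorff_delta k d2 B <= H k (A `|` B))%E.
  move=> d1p d2p; pose d := Num.min (Num.min d1 d2) (d0 / 2)%R.
  have dp : (0 < d)%R by rewrite !lt_min d1p d2p divr_gt0.
  have dd : (d < d0)%R by rewrite gt_min; apply/orP; right; lra.
  apply: le_trans (le_hausdorff_deltaT k _ dp).
  apply: le_trans (hausdorff_delta_separated k dd AB).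
  apply: leeD; apply: hausdorff_delta_anti; rewrite !ge_min lexx ?orbT//.
have [-> | ] := eqVneq (H k (A `|` B)) +oo%E; first exact: leey.
move=> fin; have HAB : (H k (A `|` B)) \is a fin_num.
  by rewrite ge0_fin_numE ?hausdorff_ge0// ltey.
have HB : (H k B) \is a fin_num.
  rewrite ge0_fin_numE ?hausdorff_ge0//; apply: le_lt_trans (_ : _ <= H k (A `|` B))%E _.
    by apply: le_hausdorff => x; right.
  by rewrite ltey.
rewrite -leeBrDr//; apply: ge_ereal_sup => _ [d1 /= d1p <-].
have D1 : hausdorff_delta k d1 A \is a fin_num.
  rewrite ge0_fin_numE ?hausdorff_delta_ge0//.
  apply: le_lt_trans (le_hausdorff_deltaT k _ d1p) _.
  apply: le_lt_trans (_ : _ <= H k (A `|` B))%E _; last by rewrite ltey.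
  by apply: le_hausdorff => x; left.
rewrite leeBrDr// -leeBrDl//; apply: ge_ereal_sup => _ [d2 /= d2p <-].
by rewrite leeBrDl//; exact: key.
Qed.

(** Each [Q i] is a layer of values of [phi], with a gap between [b i.+1] and [a i]. As [phi] is
    1-Lipschitz, a new layer lies at positive distance from all earlier ones, which permits
    induction. *)
Lemma hausdorff_separated_seq k (X : set T) (Q : nat -> set T) (phi : T -> R) (a b : nat -> R) :
  elipschitz phi 1 ->
  (forall i x, Q i x -> (a i <= phi x < b i)%R) ->
  (forall i, (b i.+1 < a i)%R) -> (forall i, (a i.+1 <= a i)%R) ->
  (forall i, Q i `<=` X) ->
  forall N, (\sum_(0 <= i < N) H k (Q i) <= H k X)%E.
Proof.
move=> philip Qab ba aa QX N.
suff h : (\sum_(0 <= i < N) H k (Q i) <= H k (\bigcup_(i in `I_N) Q i))%E.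
  apply: le_trans h _; apply: le_hausdorff => x [i _]; exact: QX.
elim: N => [|N ih]; first by rewrite big_geq// hausdorff_ge0.
rewrite big_nat_recr//= IIS bigcup_setU bigcup_set1.
apply: (@le_trans _ _ (H k (\bigcup_(i < N) Q i) + H k (Q N))%E); first exact: leeD.
case: N {ih} => [|N].
  by rewrite II0 bigcup_set0 hausdorff0 add0e set0U.
apply: (@hausdorff_separated k (a N - b N.+1)%R); first by rewrite subr_gt0.
move=> x y [i /= iN /Qab/andP[ax _]] /Qab/andP[_ by_].
have aN : (a N <= a i)%R.
  rewrite ltnS in iN; elim: (N) iN => [|j ih]; first by rewrite leqn0 => /eqP ->.
  by rewrite leq_eqVlt => /orP[/eqP ->//|/ih]; exact: le_trans.
have := philip x y; rewrite mul1r; apply: le_trans.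
by apply: le_trans (ler_norm _); lra.
Qed.

(** Caratheodory's criterion. With [phi] the distance to [A], the part [Xn n] of [X] where
    [phi >= 1 / (n + 1)] is separated from [A]. What is left of [X] outside [A] is a union of layers
    [Q i] with [i >= n], whose total measure is the tail of a convergent series. *)
Lemma hausdorff_caratheodory_closed k (A : set T) : closed A ->
  caratheodory_measurable (hausdorff_outer R m k) A.
Proof.
move=> cA; apply: le_caratheodory_measurable => X.
have [phi [philip phi0 phiA]] := closed_elipschitz_zero cA.
have [->|] := eqVneq (hausdorff_outer R m k X) +oo%E; first exact: leey.
rewrite /= => Xfin; have HX : (H k X < +oo)%E by rewrite ltey.
have HXA : (H k (X `&` A) < +oo)%E.
  by apply: le_lt_trans HX; apply: le_hausdorff => x [].
pose r i : R := (i.+1%:R)^-1%R.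
have r0 i : (0 < r i)%R by rewrite invr_gt0.
have rS i : (r i.+1 < r i)%R by rewrite ltf_pV2 ?posrE// ltr_nat.
pose Xn n := X `&` [set x | (r n <= phi x)%R].
pose Q i := X `&` [set x | (r i.+1 <= phi x < r i)%R].
have Xsep n : (H k (X `&` A) + H k (Xn n) <= H k X)%E.
  apply: (@le_trans _ _ (H k ((X `&` A) `|` Xn n))).
    apply: (@hausdorff_separated k (r n)) => // x y [_ /phiA px] [_ /= py].
    have := philip y x; rewrite mul1r px subr0 enormBC; apply: le_trans.
    by rewrite (le_trans py)// ler_norm.
  by apply: le_hausdorff => x [[]|[]].
(* Consecutive layers touch, but layers of equal parity are separated, so the even and the odd ones
   each add up to at most [H k X]. *)
have sumQ N : (\sum_(0 <= i < N) H k (Q i) <= H k X + H k X)%E.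
  apply: (@le_trans _ _ (\sum_(0 <= i < N) H k (Q i.*2) + \sum_(0 <= i < N) H k (Q i.*2.+1))%E).
    rewrite -big_split /=.
    have -> : (\sum_(0 <= i < N) (H k (Q i.*2) + H k (Q i.*2.+1)) =
               \sum_(0 <= i < N.*2) H k (Q i))%E.
      elim: N => [|N ih]; first by rewrite !big_geq.
      by rewrite big_nat_recr//= ih doubleS !big_nat_recr//= addeA.
    rewrite -addnn [leRHS](big_cat_nat (n := N)) ?leq_addr//= leeDl// sume_ge0// => i _.
    exact: hausdorff_ge0.
  apply: leeD.
    apply: (@hausdorff_separated_seq k X (fun i => Q i.*2) phi (fun i => r i.*2.+1) (fun i => r i.*2)) => //.
    - by move=> i x [_].
    - by move=> i; rewrite doubleS; exact: rS.
    - by move=> i; rewrite doubleS ltW// (lt_trans (rS _))// .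
    - by move=> i x [].
  apply: (@hausdorff_separated_seq k X (fun i => Q i.*2.+1) phi (fun i => r i.*2.+2) (fun i => r i.*2.+1)) => //.
  - by move=> i x [_].
  - by move=> i; rewrite doubleS ltW// (lt_trans (rS _))// .
  - by move=> i x [].
have tail : (\sum_(n <= i <oo) H k (Q i) @[n --> \oo] --> 0)%E.
  apply: nneseries_tail_cvg; last by move=> i _; exact: hausdorff_ge0.
  apply: le_lt_trans (_ : _ <= H k X + H k X)%E _; last by rewrite lte_add_pinfty.
  apply: lime_le; last by apply: nearW.
  by apply: is_cvg_nneseries => i _ _; exact: hausdorff_ge0.
have bound n : (H k (X `&` A) + H k (X `&` ~` A) <= H k X + \sum_(n <= i <oo) H k (Q i))%E.
  apply: le_trans (leeD (Xsep n) (lexx _)); rewrite -addeA leeD2l//.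
  apply: (@le_trans _ _ (H k (Xn n `|` \bigcup_i Q (i + n)%N))%E).
    apply: le_hausdorff => x [Xx nAx].
    have px : (0 < phi x)%R by rewrite lt_def phi0 andbT; apply/eqP => /phiA.
    have [rp|pr] := leP (r n) (phi x); first by left.
    right; have ex : exists j, (r (j + n)%N <= phi x)%R.
      exists (Num.truncn (1 / phi x)).
      rewrite /r -[_^-1]div1r div_truncn_le// ltnS leq_addr//.
    case: (ex_minnP ex) => -[|j] hj jmin; first by move: hj; rewrite add0n leNgt pr.
    exists j => //; split=> //=; rewrite -addSn hj /= ltNge.
    by apply/negP => /jmin; rewrite ltnn.
  apply: le_trans (outer_measureU2 (hausdorff_outer R m k) _ _) _; rewrite leeD2l//.
  apply: le_trans (hausdorff_sigma_subadditive k _) _.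
  by rewrite -(@nneseries_addn R (fun i => H k (Q i)) n)// => i; exact: hausdorff_ge0.
have Xf : H k X \is a fin_num by rewrite ge0_fin_numE// hausdorff_ge0.
have := cvgeD (fin_num_adde_defr 0%E Xf) (@cvg_cst _ (H k X) _ _ _) tail.
rewrite adde0 => cv; apply: (@cvge_to_ge _ _ _ _ _ _ _ (cv _ _)); exact: nearW.
Qed.

Lemma hausdorff_finite_union (I : finType) k (A : I -> set T) (B : set T) :
  (forall i, H k (A i) < +oo)%E -> B `<=` \bigcup_i A i -> (H k B < +oo)%E.
Proof.
move=> hA BA; pose U := \big[setU/set0]_(i <- enum I) A i.
apply: (@le_lt_trans _ _ (H k U)).
  apply: le_hausdorff => x /BA[i _ Ax].
  rewrite /U -bigcup_seq; exists i => //=; exact: mem_enum.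
rewrite /U; elim/big_ind: _ => //; first by rewrite hausdorff0 ltry.
move=> X Y hX hY; apply: le_lt_trans (outer_measureU2 (hausdorff_outer R m k) _ _) _.
exact: lte_add_pinfty.
Qed.

Lemma hausdorff_countable_null (I : countType) k (A : I -> set T) (B : set T) :
  (forall i, H k (A i) = 0%E) -> B `<=` \bigcup_i A i -> H k B = 0%E.
Proof.
move=> hA BA; apply/eqP; rewrite eq_le hausdorff_ge0 andbT.
pose F i := if unpickle i is Some x then A x else set0.
apply: (@le_trans _ _ (H k (\bigcup_i F i))).
  apply: le_hausdorff => x /BA[i _ Ax]; exists (pickle i) => //.
  by rewrite /F pickleK.
apply: le_trans (hausdorff_sigma_subadditive k _) _.
rewrite eseries0// => i _ _; rewrite /F; case: (unpickle i) => [x|]; first exact: hA.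
by rewrite hausdorff0.
Qed.

End HausdorffCovers.

(** * Charts of the sphere, its finite measure and the positive measure of caps *)

Section SphereCharts.
Variables (R : realType) (n : nat).
Local Notation T := ('rV[R]_n.+1).
Local Notation H := (@hausdorff R n.+1).
Implicit Types (u z a : T) (k : 'I_n.+1).

Lemma sphere_neq0 u : sphere u -> u != 0.
Proof. by move=> su; rewrite -enorm_eq0 su oner_eq0. Qed.

Lemma sphereN u : sphere u -> sphere (- u).
Proof. by rewrite /sphere /= enormN. Qed.

Lemma sphere_normalize x : x != 0 -> sphere ((enorm x)^-1 *: x : T).
Proof. exact: sphere_normalize_gen. Qed.

Lemma closed_sphere : closed (@sphere R n).
Proof.
have -> : @sphere R n = [set x | enorm x <= 1] `&` [set x | - enorm x <= - 1].
  by apply/seteqP; split=> x /=; [move=> -> //|rewrite lerN2 => -[? ?]; apply/le_anti/andP].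
apply: closedI; apply: closed_le_continuous; first exact: continuous_enorm.
by move=> x; apply: continuousN; exact: continuous_enorm.
Qed.

Lemma compact_sphere : compact (@sphere R n).
Proof.
apply: (@enorm_closed_bounded_compact _ _ _ 1); first exact: closed_sphere.
by move=> x ->.
Qed.

Lemma sphere_coord_large u : sphere u -> exists k, n.+1%:R^-1 <= `|u 0 k|.
Proof.
move=> su; case: (@arg_maxP _ _ _ (ord0 : 'I_n.+1) xpredT (fun i => `|u 0 i|)) => // k _ hk.
exists k; rewrite -[leLHS]mul1r ler_pdivrMr// mulrC.
apply: (@le_trans _ _ (enorm u)); first by have -> : enorm u = 1 := su.
by apply: enorm_le_coord => i; exact: hk.
Qed.

(** The chart is the radial projection [u / |u_k|] to the face [x_k = 1] or [x_k = -1]. Both sides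
    here are the common sign, so this coordinate carries no information and [n] coordinates
    remain. *)
Lemma sphere_chart_fixed k u z : 0 < u 0 k * z 0 k ->
  `|u 0 k|^-1 * u 0 k = `|z 0 k|^-1 * z 0 k.
Proof.
move=> uz; have [u0 z0] : u 0 k != 0 /\ z 0 k != 0.
  by split; apply: contraTneq uz => ->; rewrite ?mul0r ?mulr0 ltxx.
rewrite ![_^-1 * _]mulrC.
have [up|un] := ltP 0 (u 0 k).
  have zp : 0 < z 0 k by rewrite -(pmulr_rgt0 _ up).
  by rewrite !gtr0_norm// !mulfV.
have un' : u 0 k < 0 by rewrite lt_neqAle u0.
have zn : z 0 k < 0 by rewrite -(nmulr_rgt0 _ un').
by rewrite !ltr0_norm// !invrN !mulrN !mulfV.
Qed.

(** The chart is inverted by normalization, applied to vectors of length at least 1: this gives the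
    factor 2, while [n.+1] comes from bounding the Euclidean norm by coordinates. *)
Lemma sphere_chart_coord k u z (e : R) : sphere u -> sphere z ->
  0 < u 0 k * z 0 k -> 0 <= e ->
  (forall j, j != k -> `| `|u 0 k|^-1 * u 0 j - `|z 0 k|^-1 * z 0 j| <= e) ->
  enorm (u - z) <= 2 * n.+1%:R * e.
Proof.
move=> su sz uz e0 he.
have [u0 z0] : u 0 k != 0 /\ z 0 k != 0.
  by split; apply: contraTneq uz => ->; rewrite ?mul0r ?mulr0 ltxx.
have au : 0 < `|u 0 k| by rewrite normr_gt0.
have az : 0 < `|z 0 k| by rewrite normr_gt0.
pose u' := `|u 0 k|^-1 *: u; pose z' := `|z 0 k|^-1 *: z.
have eu : enorm u' = `|u 0 k|^-1 by rewrite enormZ su mulr1 normrV ?normr_id// unitfE gt_eqF.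
have ez : enorm z' = `|z 0 k|^-1 by rewrite enormZ sz mulr1 normrV ?normr_id// unitfE gt_eqF.
have uE : u = (enorm u')^-1 *: u' by rewrite eu scalerA invrK mulfV ?gt_eqF// scale1r.
have zE : z = (enorm z')^-1 *: z' by rewrite ez scalerA invrK mulfV ?gt_eqF// scale1r.
rewrite uE zE; apply: le_trans (enorm_normalizeB _ _) _.
- by rewrite eu invf_ge1// -su coord_le_enorm.
- by rewrite ez invf_ge1// -sz coord_le_enorm.
rewrite -mulrA ler_wpM2l//; apply: enorm_le_coord => j; rewrite !mxE.
have [->|jk] := eqVneq j k; last exact: he.
by rewrite (sphere_chart_fixed uz) subrr normr0.
Qed.

Lemma card_neq k : #|{: {j : 'I_n.+1 | j != k}}| = n.
Proof. by rewrite card_sig; have := cardC1 k; rewrite card_ord. Qed.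

(** The index consists of a coordinate and a sign. Some coordinate of a unit vector has absolute
    value at least [n.+1%:R^-1], so these pieces cover the sphere, and this threshold bounds the
    chart on each. *)
Definition sphere_piece (kb : 'I_n.+1 * bool) : set T :=
  [set u | sphere u /\ n.+1%:R^-1 <= (-1) ^+ kb.2 * u 0 kb.1].

Lemma sphere_piece_cover : @sphere R n `<=` \bigcup_kb sphere_piece kb.
Proof.
move=> u su; have [k hk] := sphere_coord_large su.
have [uk|uk] := leP 0 (u 0 k).
  by exists (k, false) => //; split=> //=; rewrite mul1r -(ger0_norm uk).
by exists (k, true) => //; split=> //=; rewrite mulN1r -(ltr0_norm uk).
Qed.

Lemma sphere_piece_bound kb u j : sphere_piece kb u ->
  `| `|u 0 kb.1|^-1 * u 0 j | <= n.+1%:R.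
Proof.
move=> [su hu]; have hk : n.+1%:R^-1 <= `|u 0 kb.1|.
  by apply: le_trans hu _; apply: le_trans (ler_norm _) _; rewrite normrM normr_sign mul1r.
have n0 : 0 < n.+1%:R :> R by rewrite ltr0n.
have k0 : 0 < `|u 0 kb.1| by apply: lt_le_trans hk; rewrite invr_gt0.
rewrite normrM normfV normr_id -[leRHS]mulr1; apply: ler_pM => //.
- by rewrite -[leRHS]invrK lef_pV2 ?posrE ?invr_gt0.
- by rewrite -su coord_le_enorm.
Qed.

Lemma sphere_piece_mul_gt0 kb u z : sphere_piece kb u -> sphere_piece kb z ->
  0 < u 0 kb.1 * z 0 kb.1.
Proof.
move=> [_ hu] [_ hz]; have n0 : 0 < n.+1%:R^-1 :> R by rewrite invr_gt0.
have := mulr_gt0 (lt_le_trans n0 hu) (lt_le_trans n0 hz).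
by rewrite mulrACA -expr2 sqrr_sign mul1r.
Qed.

Lemma hausdorff_sphere_finite : (H n (@sphere R n) < +oo)%E.
Proof.
apply: hausdorff_finite_union sphere_piece_cover => kb.
rewrite -[X in H X]( card_neq kb.1).
apply: (@hausdorff_cells_finite _ _ _ _ (fun j u => `|u 0 kb.1|^-1 * u 0 (val j)) n.+1%:R (2 * n.+1%:R)).
- by rewrite ltr0n.
- by rewrite mulr_ge0.
- by move=> x j; exact: sphere_piece_bound.
- move=> x y e hx hy e0 he; apply: (@sphere_chart_coord kb.1) => //.
  + by case: hx.
  + by case: hy.
  + exact: sphere_piece_mul_gt0 hx hy.
  + by move=> j jk; have := he (exist _ j jk).
Qed.

(** [a] is projected to [a'] on a face of the cube, a fine grid is laid on that face near [a'], and
    normalization sends the grid into the cap. The chart is Lipschitz there, so the image points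
    stay spread out as the grid bound demands. *)
Lemma hausdorff_cap_gt0 a (e : R) : sphere a -> 0 < e ->
  (0 < H n (@sphere R n `&` [set u | (enorm (u - a) < e)%R]))%E.
Proof.
(* For [n = 0] the charts have no coordinates, and the grid bound asks for at least one; [H 0] of
   any nonempty set is at least 1. *)
move=> sa e0; have [n0|n0] := posnP n.
  apply: lt_le_trans (_ : 1 <= _)%E => //.
  have -> : H n = H 0 by rewrite n0.
  apply: hausdorff0_ge1.
  by exists a; split=> //=; rewrite subrr enorm0.
have [[k b] _ [_ /= hk]] := sphere_piece_cover sa.
pose sg : R := (-1) ^+ b; rewrite -/sg in hk.
have sg2 : sg * sg = 1 by rewrite /sg -expr2 sqrr_sign.
have nsg : `|sg| = 1 by rewrite normr_sign.
have m0 : 0 < n.+1%:R :> R by rewrite ltr0n.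
have ak : 0 < sg * a 0 k by apply: lt_le_trans hk; rewrite invr_gt0.
pose a' := (sg * a 0 k)^-1 *: a.
have a'k : a' 0 k = sg.
  rewrite mxE -[X in _ * X]mul1r -sg2 -mulrA mulrCA mulVf ?mulr1// gt_eqF//.
have ea' : 1 <= enorm a' by rewrite -nsg -a'k coord_le_enorm.
have aE : a = (enorm a')^-1 *: a'.
  rewrite /a' enormZ sa mulr1 gtr0_norm ?invr_gt0// scalerA invrK.
  by rewrite mulfV ?scale1r// gt_eqF.
(* Grid points are then within [e / 4] of [a'], hence within [e / 2] of [a] after normalization. *)
pose r := e / (4 * n.+1%:R).
have r0 : 0 < r by rewrite divr_gt0// mulr_gt0.
pose c := (enorm a' + n.+1%:R * r)^-1.
have c0 : 0 < c by rewrite invr_gt0 ltr_pwDr// ?mulr_gt0// (le_trans _ ea').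
pose J := {j : 'I_n.+1 | j != k}.
pose y (M : nat) (g : {ffun J -> 'I_M}) : T := a' + r *: \row_j
  (if insub j is Some j' then (g j')%:R / M%:R else 0).
have yk M g : y M g 0 k = sg.
  by rewrite /y mxE a'k !mxE insubF ?eqxx// mulr0 addr0.
have y1 M g : 1 <= enorm (y M g) by rewrite -nsg -(yk M g) coord_le_enorm.
have ya M g : enorm (y M g - a') <= n.+1%:R * r.
  apply: enorm_le_coord => j; rewrite /y addrAC subrr add0r !mxE.
  rewrite normrM gtr0_norm//; rewrite -[leRHS]mulr1 ler_wpM2l ?(ltW r0)//.
  case: insubP => [j' _ _|_]; last by rewrite normr0.
  rewrite ger0_norm ?divr_ge0//; have M0 : (0 < M)%N := leq_ltn_trans (leq0n _) (ltn_ord (g j')).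
  by rewrite ler_pdivrMr ?ltr0n// mul1r ler_nat ltnW.
pose bb M g := (enorm (y M g))^-1 *: y M g.
(* A closed part of the cap, as the grid bound needs compactness. The constraint by [c] keeps the
   [k]-th coordinate away from 0; grid points satisfy it since that coordinate is
   [1 / enorm (y M g)] up to sign. *)
pose A := @sphere R n `&` ([set u | enorm (u - a) <= e / 2] `&` [set u | - (sg * u 0 k) <= - c]).
have bbk M g : sg * bb M g 0 k = (enorm (y M g))^-1.
  by rewrite mxE yk mulrCA sg2 mulr1.
have Abb M g : A (bb M g).
  split; first by apply: sphere_normalize; rewrite -enorm_gt0 (lt_le_trans _ (y1 M g)).
  split=> /=.
    rewrite aE; apply: le_trans (enorm_normalizeB (y1 M g) ea') _.
    have := ya M g; rewrite (_ : n.+1%:R * r = e / 4); last by rewrite /r; field; rewrite gt_eqF.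
    by lra.
  rewrite lerN2 bbk lef_pV2 ?posrE ?(lt_le_trans ltr01)//; last first.
    by rewrite -[1]addr0 lerD// mulr_ge0// ltW.
  by rewrite -lerBlDl (le_trans (ler_enormB _ _))// ya.
apply: (@lt_le_trans _ _ (H n A)); last first.
  by apply: le_hausdorff => x [sx [/= xa _]]; split=> //=; rewrite (le_lt_trans xa)//; lra.
have cA : compact A.
  apply: (@enorm_closed_bounded_compact _ _ _ 1); last by move=> x [->].
  apply: closedI; first exact: closed_sphere.
  apply: closedI; apply: closed_le_continuous.
    apply: (@elipschitz_continuous _ _ _ 1) => x z; rewrite mul1r.
    by have := ler_enorm_dist (x - a) (z - a); rewrite opprB addrA subrK.
  apply: (@elipschitz_continuous _ _ _ 1) => x z; rewrite mul1r.
  rewrite -opprD normrN -mulrBr normrM nsg mul1r.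
  exact: coord_le_enormB.
(* The quotients [v / be] and [v' / be'] differ by at most [2 d / c ^ 2] when the points are [d]
   apart, and one grid step changes the quotient by [r / M]. *)
clearbody c; rewrite -[X in H X]( card_neq k); set L := 2 / (r * c ^+ 2).
apply: (@hausdorff_delta_grid_ge _ _ _ _ L bb) => //.
- by rewrite card_neq.
- by rewrite divr_gt0// mulr_gt0// exprn_gt0.
move=> M g g' j M0; set d := enorm _.
have yj h : y M h 0 (val j) = a' 0 (val j) + r * ((h j)%:R / M%:R).
  by rewrite /y !mxE valK.
have bj h : y M h 0 (val j) = (sg * bb M h 0 k)^-1 * bb M h 0 (val j).
  by rewrite bbk invrK [bb M h 0 _]mxE mulrA mulfV ?mul1r// gt_eqF// (lt_le_trans ltr01).
have M0' : 0 < M%:R :> R by rewrite ltr0n.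
have E : (g j)%:R - (g' j)%:R = M%:R / r * (y M g 0 (val j) - y M g' 0 (val j)).
  by rewrite !yj; field; rewrite !gt_eqF.
have Mr0 : 0 <= M%:R / r by rewrite divr_ge0// ltW.
rewrite E normrM (ger0_norm Mr0) !bj.
have [_ [_ /=]] := Abb M g; have [_ [_ /=]] := Abb M g'; rewrite !lerN2.
set be' : R := sg * _; set be : R := sg * _ => hbe' hbe.
have le1 h : sg * bb M h 0 k <= 1 by rewrite bbk invf_le1// (lt_le_trans ltr01).
have b1 := le1 g; have b1' := le1 g'; rewrite -/be -/be' in b1 b1'.
have be0 := lt_le_trans c0 hbe; have be'0 := lt_le_trans c0 hbe'.
have dbe : `|be' - be| <= d.
  rewrite /be /be' -mulrBr normrM nsg mul1r distrC.
  exact: coord_le_enormB.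
clearbody be be'; set v : R := bb M g 0 (val j); set v' : R := bb M g' 0 (val j).
have dv : `|v - v'| <= d by exact: coord_le_enormB.
have v1 : `|v'| <= 1 by have [<- _] := Abb M g'; exact: coord_le_enorm.
have d0 : 0 <= d := enorm_ge0 _.
have -> : be^-1 * v - be'^-1 * v' = ((v - v') * be' + v' * (be' - be)) / (be * be').
  by field; rewrite !gt_eqF.
rewrite normrM normfV (gtr0_norm (mulr_gt0 be0 be'0)).
have h1 : `|(v - v') * be' + v' * (be' - be)| <= 2 * d.
  apply: le_trans (ler_normD _ _) _; rewrite (normrM (v - v')) (normrM v') (gtr0_norm be'0).
  have : `|v - v'| * be' <= d * 1 by apply: ler_pM => //; exact: ltW.
  have : `|v'| * `|be' - be| <= 1 * d by apply: ler_pM.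
  by lra.
have h2 : (be * be')^-1 <= (c ^+ 2)^-1.
  rewrite lef_pV2 ?posrE ?mulr_gt0 ?exprn_gt0// expr2.
  by apply: ler_pM => //; exact: ltW.
have -> : L * M%:R * d = M%:R / r * (2 * d * (c ^+ 2)^-1).
  by rewrite /L; field; rewrite !gt_eqF.
rewrite ler_wpM2l//; apply: ler_pM => //.
by rewrite invr_ge0 mulr_ge0// ltW.
Qed.

End SphereCharts.

(** * Gauges and support functions *)

Section Gauge.
Variables (R : realType) (n : nat).
Local Notation T := ('rV[R]_n.+1).
Implicit Types (N : T -> R) (x y u v : T).

(** A norm without symmetry: homogeneity is only for nonnegative factors, as a convex body need not
    be symmetric about the origin. *)
Definition gauge N := [/\ forall x y, N (x + y) <= N x + N y,
  forall t x, 0 <= t -> N (t *: x) = t * N x & forall x, x != 0 -> 0 < N x].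

Definition gauge_ball N : set T := [set x | N x <= 1].

(** It bounds the Lipschitz constant, is linear in [N], and involves finitely many values of [N].
    Hence it can serve as a normalization that survives pointwise limits. *)
Definition gauge_size N := \sum_(i < n.+1) (N (delta_mx 0 i) + N (- delta_mx 0 i)).

(** Decompose [x] along the vectors [e_i] or [- e_i] with nonnegative coefficients. Asking for
    nonnegativity rather than positivity lets this apply to a limit of gauges before it is known to
    be a gauge. *)
Lemma sublinear_elipschitz N :
  (forall x y, N (x + y) <= N x + N y) -> (forall t x, 0 <= t -> N (t *: x) = t * N x) ->
  (forall x, 0 <= N x) -> elipschitz N (gauge_size N).
Proof.
move=> ND NZ N0.
have N00 : N 0 = 0 by rewrite -(scale0r 0) NZ// mul0r.
have le x : N x <= gauge_size N * enorm x.
  rewrite [in leLHS](row_sum_delta x) mulr_suml.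
  apply: (@le_trans _ _ (\sum_(i < n.+1) N (x 0 i *: delta_mx 0 i))).
    elim/big_rec2: _ => [|i a b _ ih]; first by rewrite N00.
    by apply: le_trans (ND _ _) _; rewrite lerD2l.
  apply: ler_sum => i _; have xi := coord_le_enorm x i.
  set e := delta_mx 0 i.
  apply: (@le_trans _ _ ((N e + N (- e)) * `|x 0 i|)); last by rewrite ler_wpM2l// addr_ge0.
  have [x0|/ltW x0] := leP 0 (x 0 i).
    by rewrite NZ// ger0_norm// mulrC ler_wpM2r// lerDl.
  rewrite -(opprK (x 0 i)) scaleNr -scalerN NZ ?oppr_ge0// opprK ler0_norm// mulrC.
  by rewrite ler_wpM2r ?oppr_ge0// lerDr.
move=> x y; rewrite ler_norml; apply/andP; split.
  rewrite lerNl opprB lerBlDr enormBC; apply: le_trans (lerD (le _) (lexx _)).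
  by apply: le_trans (ND _ _); rewrite subrK.
rewrite lerBlDr; apply: le_trans (lerD (le _) (lexx _)).
by apply: le_trans (ND _ _); rewrite subrK.
Qed.

Section Fixed.
Variable N : T -> R.
Hypothesis gN : gauge N.
Local Notation h := (support_function (gauge_ball N)).

Lemma gauge_add x y : N (x + y) <= N x + N y. Proof. by case: gN. Qed.

Lemma gauge_scale t x : 0 <= t -> N (t *: x) = t * N x. Proof. by case: gN => _ + _; apply. Qed.

Lemma gauge_gt0 x : x != 0 -> 0 < N x. Proof. by case: gN => _ _; apply. Qed.

Lemma gauge0 : N 0 = 0.
Proof. by rewrite -(scale0r 0) gauge_scale// mul0r. Qed.

Lemma gauge_ge0 x : 0 <= N x.
Proof. by have [->|/gauge_gt0/ltW//] := eqVneq x 0; rewrite gauge0. Qed.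

Lemma gauge_elipschitz : elipschitz N (gauge_size N).
Proof.
by apply: sublinear_elipschitz; [exact: gauge_add|exact: gauge_scale|exact: gauge_ge0].
Qed.

Lemma gauge_le_enorm x : N x <= gauge_size N * enorm x.
Proof.
by have := gauge_elipschitz x 0; rewrite gauge0 !subr0; apply: le_trans (ler_norm _).
Qed.

Lemma delta_neq0 (i : 'I_n.+1) : (delta_mx 0 i : T) != 0.
Proof.
apply/eqP => /rowP/(_ i); rewrite !mxE !eqxx => /eqP.
by rewrite oner_eq0.
Qed.

Lemma gauge_size_gt0 : 0 < gauge_size N.
Proof.
rewrite /gauge_size big_ord_recl ltr_pwDl//.
  by rewrite addr_gt0// gauge_gt0 ?oppr_eq0 ?delta_neq0.
by apply: sumr_ge0 => i _; rewrite addr_ge0// gauge_ge0.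
Qed.

Lemma gauge_lower_bound : exists2 c, 0 < c & forall x, c * enorm x <= N x.
Proof.
have [|u su hu] := compact_elipschitz_min _ (@compact_sphere R n) gauge_elipschitz.
  by exists (delta_mx 0 0); exact: sphere_delta.
exists (N u); first exact/gauge_gt0/sphere_neq0.
move=> x; have [->|x0] := eqVneq x 0; first by rewrite enorm0 mulr0 gauge0.
have := hu _ (sphere_normalize x0); rewrite gauge_scale ?invr_ge0 ?enorm_ge0//.
by rewrite mulrC ler_pdivlMr// enorm_gt0.
Qed.

Lemma gauge_normalize x : x != 0 -> N ((N x)^-1 *: x) = 1.
Proof.
move=> x0; rewrite gauge_scale ?invr_ge0 ?gauge_ge0//.
by rewrite mulVf// gt_eqF// gauge_gt0.
Qed.

Lemma support_gauge_ball_has_sup v : has_sup [set dot v x | x in gauge_ball N].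
Proof.
have [c c0 hc] := gauge_lower_bound.
split; first by exists (dot v 0); exists 0 => //=; rewrite /gauge_ball /= gauge0.
exists (enorm v / c) => _ [x Nx <-]; apply: le_trans (Cauchy_Schwarz _ _) _.
rewrite ler_wpM2l ?enorm_ge0// -[leRHS]mul1r ler_pdivlMr//.
by rewrite mulrC (le_trans (hc x)).
Qed.

Lemma dot_le_support v x : dot v x <= h v * N x.
Proof.
have [->|x0] := eqVneq x 0; first by rewrite dotC dot0l gauge0 mulr0.
have Nx := gauge_gt0 x0.
rewrite -ler_pdivrMr// mulrC -dotZr; apply: ub_le_sup.
  by have [] := support_gauge_ball_has_sup v.
by exists ((N x)^-1 *: x) => //; rewrite /gauge_ball /= gauge_normalize.
Qed.

Lemma support_gauge_ball_le v b : 0 <= b -> (forall x, dot v x <= b * N x) -> h v <= b.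
Proof.
move=> b0 hb; apply: ge_sup; first by have [] := support_gauge_ball_has_sup v.
move=> _ [x Nx <-]; apply: le_trans (hb x) _.
by rewrite -[leRHS]mulr1 ler_wpM2l.
Qed.

Lemma support_gauge_ball_ge0 v : 0 <= h v.
Proof.
apply: ub_le_sup; first by have [] := support_gauge_ball_has_sup v.
exists 0; last by rewrite dotC dot0l.
by rewrite /gauge_ball /= gauge0.
Qed.

Lemma support_gauge_ball_gt0 v : v != 0 -> 0 < h v.
Proof.
move=> v0; rewrite lt_def support_gauge_ball_ge0 andbT; apply/eqP => h0.
have := dot_le_support v v; rewrite h0 mul0r -sqr_enorm leNgt exprn_gt0//.
by rewrite enorm_gt0.
Qed.

Lemma support_gauge_ball_elipschitz : exists L, elipschitz h L.
Proof.
have [c c0 hc] := gauge_lower_bound; exists (c^-1).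
have key v w : h v - h w <= c^-1 * enorm (v - w).
  rewrite lerBlDr; apply: support_gauge_ball_le.
    by rewrite addr_ge0 ?support_gauge_ball_ge0// mulr_ge0 ?enorm_ge0// invr_ge0 ltW.
  move=> x; rewrite -[v in leLHS](subrK w) dotDl mulrDl lerD ?dot_le_support//.
  apply: le_trans (Cauchy_Schwarz _ _) _.
  rewrite (mulrC c^-1) -mulrA ler_wpM2l ?enorm_ge0// mulrC ler_pdivlMr//.
  by rewrite mulrC.
by move=> v w; rewrite ler_norml key lerNl opprB enormBC key.
Qed.

Lemma radial_gauge_ball u : u != 0 -> radial_function (gauge_ball N) u = (N u)^-1.
Proof.
move=> u0; have Nu := gauge_gt0 u0; rewrite /radial_function.
have -> : [set l : R | 0 < l /\ gauge_ball N (l *: u)] = [set` `]0, (N u)^-1]].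
  apply/seteqP; split=> l /=; rewrite in_itv /= /gauge_ball.
    move=> [l0] /=; rewrite gauge_scale ?(ltW l0)// l0 => hl.
    by rewrite -[leRHS]mul1r ler_pdivlMr.
  move=> /andP[l0 hl]; split=> //=; rewrite gauge_scale ?(ltW l0)//.
  by rewrite -ler_pdivlMr// mul1r.
by rewrite sup_itv// bnd_simp invr_gt0.
Qed.

(** Multiplying by [N u = 1 / rho(u)] makes outer normality the equality case of
    [dot v u <= h v * N u]. This is the form of the Gauss image used from here on. *)
Lemma outer_normal_gauge_ball u v : u != 0 ->
  outer_normal (gauge_ball N) (radial_function (gauge_ball N) u *: u) v <->
  dot v u = h v * N u.
Proof.
move=> u0; have Nu := gauge_gt0 u0; rewrite /outer_normal radial_gauge_ball// dotZl dotC.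
split=> [<-|->]; first by rewrite mulrAC mulVf ?mul1r// gt_eqF.
by rewrite mulrCA mulVf ?mulr1// gt_eqF.
Qed.

Lemma gauge_ball_interior : (gauge_ball N)° 0.
Proof.
apply/nbhs_enormP; have s0 := gauge_size_gt0.
exists (gauge_size N)^-1; first by rewrite invr_gt0.
move=> y; rewrite sub0r enormN => /ltW hy; apply: le_trans (gauge_le_enorm y) _.
by rewrite mulrC -ler_pdivlMr// mul1r.
Qed.

Lemma convex_body_gauge_ball : convex_body (gauge_ball N).
Proof.
split; last by exists 0; exact: gauge_ball_interior.
  move=> x y l; rewrite !inE /gauge_ball /= => xK yK.
  rewrite /conv /=; apply: le_trans (gauge_add _ _) _.
  have l0 : 0 <= l%:num by [].
  have l1 : 0 <= unstable.onem l%:num by rewrite subr_ge0.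
  rewrite !gauge_scale//.
  have := ler_wpM2l l0 xK; have := ler_wpM2l l1 yK.
  by rewrite /unstable.onem; lra.
have [c c0 hc] := gauge_lower_bound.
apply: (@enorm_closed_bounded_compact _ _ _ c^-1).
  by apply: closed_le_continuous; exact: elipschitz_continuous gauge_elipschitz.
move=> x Nx; rewrite -[leRHS]mul1r ler_pdivlMr// mulrC.
by rewrite (le_trans (hc x)).
Qed.

End Fixed.

Lemma gauge_scale_gauge N c : gauge N -> 0 < c -> gauge (fun x => c * N x).
Proof.
move=> [NA NZ N0] c0; split=> [x y|t x t0|x x0].
- by rewrite -mulrDr ler_wpM2l// ltW.
- by rewrite NZ// mulrCA.
- by rewrite mulr_gt0// N0.
Qed.

Lemma support_gauge_ball_mono N N' v a : gauge N -> gauge N' -> 0 <= a ->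
  (forall x, N x <= a * N' x) ->
  support_function (gauge_ball N') v <= a * support_function (gauge_ball N) v.
Proof.
move=> gN gN' a0 NN'; apply: support_gauge_ball_le => //.
  by rewrite mulr_ge0// support_gauge_ball_ge0.
move=> x; apply: le_trans (dot_le_support gN v x) _.
by rewrite -mulrA mulrCA ler_wpM2l// support_gauge_ball_ge0.
Qed.

Lemma support_gauge_ball_scale N c v : gauge N -> 0 < c ->
  support_function (gauge_ball (fun x => c * N x)) v = c^-1 * support_function (gauge_ball N) v.
Proof.
move=> gN c0; have gc := gauge_scale_gauge gN c0.
have ci0 : 0 <= c^-1 by rewrite invr_ge0 ltW.
apply/le_anti/andP; split.
  by apply: support_gauge_ball_mono => // x; rewrite mulrA mulVf ?gt_eqF// mul1r.
rewrite mulrC ler_pdivrMr// mulrC.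
by apply: support_gauge_ball_mono => //; exact: ltW.
Qed.

(** For [f] between positive bounds, this is the gauge of the Wulff shape of [1 / f], the set of [x]
    with [dot v x <= 1 / f v] for all unit [v]. *)
Definition polar_gauge (f : T -> R) x := sup [set f v * dot v x | v in @sphere R n].

Section PolarGauge.
Variables (f : T -> R) (a b : R).
Hypothesis a0 : 0 < a.
Hypothesis fab : forall v, sphere v -> a <= f v <= b.

Lemma polar_gauge_has_sup x : has_sup [set f v * dot v x | v in @sphere R n].
Proof.
split; first by exists (f (delta_mx 0 0) * dot (delta_mx 0 0) x);
  exists (delta_mx 0 0) => //; exact: sphere_delta.
exists (b * enorm x) => _ [v sv <-]; have /andP[af fb] := fab sv.
apply: (@le_trans _ _ (f v * enorm x)).
  rewrite ler_wpM2l ?(le_trans (ltW a0))//.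
  by have := Cauchy_Schwarz v x; rewrite (_ : enorm v = 1)// mul1r.
by rewrite ler_wpM2r// enorm_ge0.
Qed.

Lemma le_polar_gauge v x : sphere v -> f v * dot v x <= polar_gauge f x.
Proof.
by move=> sv; apply: ub_le_sup; [have [] := polar_gauge_has_sup x|exists v].
Qed.

Lemma polar_gauge_le x c : (forall v, sphere v -> f v * dot v x <= c) -> polar_gauge f x <= c.
Proof.
move=> hc; apply: ge_sup; first by have [] := polar_gauge_has_sup x.
by move=> _ [v sv <-]; exact: hc.
Qed.

Lemma gauge_polar_gauge : gauge (polar_gauge f).
Proof.
have Z t x : 0 <= t -> polar_gauge f (t *: x) <= t * polar_gauge f x.
  move=> t0; apply: polar_gauge_le => v sv.
  by rewrite dotZr mulrCA ler_wpM2l// le_polar_gauge.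
split=> [x y|t x|x x0].
- by apply: polar_gauge_le => v sv; rewrite dotDr mulrDr lerD// le_polar_gauge.
- rewrite le_eqVlt => /orP[/eqP <-|t0].
    rewrite mul0r scale0r; apply/le_anti/andP; split.
      by apply: polar_gauge_le => v sv; rewrite dotC dot0l mulr0.
    by have := le_polar_gauge 0 (@sphere_delta R n); rewrite dotC dot0l mulr0.
  apply/le_anti/andP; split; first exact: Z (ltW t0).
  rewrite -ler_pdivlMl//; apply: le_trans (Z _ _ _); last by rewrite invr_ge0 ltW.
  by rewrite scalerA mulVf ?scale1r// gt_eqF.
- have sx := sphere_normalize x0; apply: lt_le_trans (le_polar_gauge _ sx).
  have /andP[af _] := fab sx; apply: mulr_gt0; first exact: lt_le_trans af.
  by rewrite dotZl -sqr_enorm mulr_gt0// ?invr_gt0 ?exprn_gt0// enorm_gt0.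
Qed.

(** The hyperplane [dot v x = 1 / f v] may miss the Wulff shape, so this is an inequality. Its sign
    is the favourable one, as a smaller support function raises the functional. *)
Lemma support_polar_gauge_le v : sphere v ->
  support_function (gauge_ball (polar_gauge f)) v <= (f v)^-1.
Proof.
move=> sv; have /andP[af _] := fab sv; have f0 := lt_le_trans a0 af.
apply: support_gauge_ball_le; first exact: gauge_polar_gauge.
  by rewrite invr_ge0 ltW.
by move=> x; rewrite mulrC ler_pdivlMr// mulrC le_polar_gauge.
Qed.

End PolarGauge.

End Gauge.

(** * Almost every direction has at most one outer normal *)

Section Uniqueness.
Variables (R : realType) (n : nat).
Local Notation T := ('rV[R]_n.+1).
Variable N : T -> R.
Hypothesis gN : gauge N.
Implicit Types (p u z : T).

(** For a sublinear [N] these two conditions describe the subdifferential at [u]. They are stable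
    under positive scaling of [u], so sphere points may be replaced by their chart images. *)
Definition subgradient p u := (forall x, dot p x <= N x) /\ dot p u = N u.

Lemma subgradient_scale p u t : 0 <= t -> subgradient p u -> subgradient p (t *: u).
Proof. by move=> t0 [h1 h2]; split=> //; rewrite dotZr gauge_scale// h2. Qed.

Lemma subgradient_enorm p u : subgradient p u -> enorm p <= gauge_size N.
Proof.
move=> [h _]; have [->|p0] := eqVneq p 0; first by rewrite enorm0 ltW// gauge_size_gt0.
have := le_trans (h p) (gauge_le_enorm gN p).
by rewrite -sqr_enorm expr2 ler_pM2r// enorm_gt0.
Qed.

(* Monotonicity of subgradients: the points where the [i]-th coordinate of a
   subgradient jumps across [a, b] form a Lipschitz graph over the other
   coordinates. *)
Lemma subgradient_jump p p' u z i k (a b e : R) :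
  a < b -> 0 <= e -> subgradient p u -> subgradient p' z -> b <= p 0 i -> p' 0 i <= a ->
  u 0 k = z 0 k -> k != i -> (forall j, j != k -> j != i -> `|u 0 j - z 0 j| <= e) ->
  u 0 i <= z 0 i ->
  z 0 i - u 0 i <= 2 * gauge_size N * n.+1%:R / (b - a) * e.
Proof.
move=> ab e0 sp sp' pi p'i uzk ki uz uzi; set L := gauge_size N.
have L0 : 0 < L := gauge_size_gt0 gN.
have mono : 0 <= dot (p - p') (u - z).
  rewrite dotBl !dotBr sp.2 sp'.2.
  by have := sp.1 z; have := sp'.1 u; lra.
rewrite /dot (bigD1 i)//= !mxE in mono.
have hi : (p 0 i - p' 0 i) * (u 0 i - z 0 i) <= (b - a) * (u 0 i - z 0 i).
  by apply: ler_wnM2r; lra.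
have hs : \sum_(j < n.+1 | j != i) (p - p') 0 j * (u - z) 0 j <= n.+1%:R * (2 * L * e).
  apply: (@le_trans _ _ (\sum_(j < n.+1) (2 * L * e))); last first.
    by rewrite sumr_const card_ord -[leLHS]mulr_natl.
  have Le0 : 0 <= 2 * L * e by rewrite !mulr_ge0// ltW.
  rewrite big_mkcond; apply: ler_sum => j _; case: ifP => // ji.
  have [->|jk] := eqVneq j k; first by rewrite !mxE uzk subrr mulr0.
  apply: le_trans (ler_norm _) _; rewrite normrM; apply: ler_pM => //.
    apply: le_trans (coord_le_enorm _ _) _; apply: le_trans (enormB_le _ _) _.
    by have := subgradient_enorm sp; have := subgradient_enorm sp'; rewrite -/L; lra.
  by rewrite !mxE; exact: uz.
rewrite mulrAC ler_pdivlMr ?subr_gt0//.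
by lra.
Qed.

(** Points of a chart where two subgradients are separated, in coordinate [i], by a rational
    interval. Rational endpoints keep the family countable. *)
Definition jump_piece (t : ('I_n.+1 * bool) * 'I_n.+1 * (rat * rat)) : set T :=
  let: (kb, i, (a, b)) := t in
  [set u | [/\ kb.1 != i, ratr a < ratr b :> R, sphere_piece kb u &
     exists p, exists p', [/\ subgradient p u, subgradient p' u,
       ratr b <= p 0 i & p' 0 i <= ratr a]]].

Lemma card_neq2 (k i : 'I_n.+1) : k != i -> #|{: {j : 'I_n.+1 | (j != k) && (j != i)}}|.+1 = n.
Proof.
move=> ki; rewrite card_sig; have := cardC1 k; rewrite card_ord /= => E; rewrite -[RHS]E.
rewrite [RHS](cardD1 i) !inE eq_sym ki add1n; congr _.+1; apply: eq_card => j.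
by rewrite !inE andbC.
Qed.

(** In the chart, coordinate [i] is a Lipschitz function of the other [n - 1] coordinates, by
    monotonicity of subgradients. So [n - 1] coordinates parametrize the piece, and its
    [n]-dimensional measure vanishes. *)
Lemma jump_piece_null t : hausdorff n (jump_piece t) = 0%E.
Proof.
case: t => -[kb i] [a b]; have [/eqP ki|ki] := boolP (kb.1 == i).
  rewrite (_ : jump_piece _ = set0) ?hausdorff0// -subset0 => u [].
  by rewrite ki eqxx.
have [ab|ba] := ltP (ratr a : R) (ratr b); last first.
  rewrite (_ : jump_piece _ = set0) ?hausdorff0// -subset0 => u [] _.
  by rewrite ltNge ba.
set A := jump_piece _.
pose C1 := 2 * gauge_size N * n.+1%:R / (ratr b - ratr a).
have C10 : 0 <= C1.
  by rewrite divr_ge0 ?mulr_ge0 ?subr_ge0 ?(ltW ab)// ltW// gauge_size_gt0.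
(* The upper subgradient is taken at [u] and the lower one at [z]. Each point of the piece has both,
   so the bound also holds with the two points exchanged. *)
have step u z (e : R) : A u -> A z -> 0 <= e ->
   (forall j, j != kb.1 -> j != i -> `| `|u 0 kb.1|^-1 * u 0 j - `|z 0 kb.1|^-1 * z 0 j| <= e) ->
   `|u 0 kb.1|^-1 * u 0 i <= `|z 0 kb.1|^-1 * z 0 i ->
   `|z 0 kb.1|^-1 * z 0 i - `|u 0 kb.1|^-1 * u 0 i <= C1 * e.
  move=> [_ _ pu [p [_ [sp _ pb _]]]] [_ _ pz [_ [p' [_ sp' _ p'a]]]] e0 he hle.
  have := @subgradient_jump p p' (`|u 0 kb.1|^-1 *: u) (`|z 0 kb.1|^-1 *: z)
    i kb.1 (ratr a) (ratr b) e ab e0.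
  rewrite !mxE; apply => //.
  - by apply: subgradient_scale => //; rewrite invr_ge0.
  - by apply: subgradient_scale => //; rewrite invr_ge0.
  - exact: sphere_chart_fixed (sphere_piece_mul_gt0 pu pz).
  - by move=> j jk ji; rewrite !mxE; exact: he.
rewrite -[X in hausdorff X](card_neq2 ki).
apply: (@hausdorff_cells_null _ _ _ _ (fun j u => `|u 0 kb.1|^-1 * u 0 (val j)) n.+1%:R
   (2 * n.+1%:R * (1 + C1))).
- by rewrite ltr0n.
- by rewrite !mulr_ge0// addr_ge0.
- by move=> u j [_ _ pu _]; exact: sphere_piece_bound pu.
move=> u z e Au Az e0 he; have [_ _ pu _] := Au; have [_ _ pz _] := Az.
rewrite -mulrA; apply: (@sphere_chart_coord _ _ kb.1).
- by case: pu.
- by case: pz.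
- exact: sphere_piece_mul_gt0 pu pz.
- by rewrite mulr_ge0// addr_ge0.
move=> j jk; have he' l : l != kb.1 -> l != i ->
    `| `|u 0 kb.1|^-1 * u 0 l - `|z 0 kb.1|^-1 * z 0 l| <= e.
  move=> lk li; have lki : (l != kb.1) && (l != i) by rewrite lk li.
  by have := he (exist _ l lki).
have eC : e <= (1 + C1) * e by rewrite mulrDl mul1r lerDl mulr_ge0.
have [->|ji] := eqVneq j i; last exact: le_trans (he' _ jk ji) eC.
apply: (@le_trans _ _ (C1 * e)); last by rewrite mulrDl mul1r lerDr.
have [le|/ltW le] := leP (`|u 0 kb.1|^-1 * u 0 i) (`|z 0 kb.1|^-1 * z 0 i).
  by rewrite distrC ger0_norm ?subr_ge0//; exact: step.
rewrite ger0_norm ?subr_ge0//; apply: step => // l lk li.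
by rewrite distrC; exact: he'.
Qed.

(** Distinct subgradients at [u] have the same product with [u]. As the chart coordinate of [u] is
    nonzero, they must differ in some other coordinate, where rationals separate them. *)
Lemma subgradient_unique_ae :
  hausdorff n [set u : T | sphere u /\ exists p, exists p',
    [/\ subgradient p u, subgradient p' u & p != p']] = 0%E.
Proof.
apply: (hausdorff_countable_null jump_piece_null).
move=> u [su [p [p' [sp sp' pp']]]].
have [kb _ pu] := sphere_piece_cover su.
have uk : u 0 kb.1 != 0.
  have := sphere_piece_mul_gt0 pu pu.
  by apply: contraTneq => ->; rewrite mul0r ltxx.
have [i ki ppi] : exists2 i, kb.1 != i & p 0 i != p' 0 i.
  apply: contrapT => h; move/eqP: pp'; apply.
  have hi i : kb.1 != i -> p 0 i = p' 0 i.
    by move=> ki; apply: contrapT => /eqP pi; apply: h; exists i.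
  have : dot (p - p') u = 0 by rewrite dotBl sp.2 sp'.2 subrr.
  rewrite /dot (bigD1 kb.1)//= big1 => [|i ik]; last first.
    by rewrite !mxE hi 1?eq_sym// subrr mul0r.
  rewrite addr0 !mxE => /eqP; rewrite mulf_eq0 (negbTE uk) orbF subr_eq0 => /eqP pk.
  by apply/rowP => i; have [<-//|/hi] := eqVneq kb.1 i.
wlog lt : p p' sp sp' ppi {pp'} / p' 0 i < p 0 i.
  move=> wl; have := ppi; rewrite neq_lt => /orP[lt|lt]; last exact: (wl p p').
  by apply: (wl p' p) => //; rewrite eq_sym.
have [b] := rat_in_itvoo lt; rewrite in_itv /= => /andP[pb bp].
have [a] := rat_in_itvoo pb; rewrite in_itv /= => /andP[pa ap].
exists (kb, i, (a, b)) => //; split=> //; exists p, p'; split=> //; exact: ltW.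
Qed.

(** A unit normal [v] at [u] yields the subgradient [v / h(v)], and [v] is recovered from it by
    normalization, so distinct normals give distinct subgradients. *)
Lemma normal_unique_ae :
  hausdorff n [set u : T | sphere u /\ exists v, exists v',
    [/\ sphere v, sphere v', dot v u = support_function (gauge_ball N) v * N u,
     dot v' u = support_function (gauge_ball N) v' * N u & v != v']] = 0%E.
Proof.
apply/eqP; rewrite eq_le hausdorff_ge0 andbT -subgradient_unique_ae.
apply: le_hausdorff => u [su [v [v' [sv sv' vu v'u vv']]]]; split=> //.
have h0 w : sphere w -> 0 < support_function (gauge_ball N) w.
  by move=> /sphere_neq0; exact: support_gauge_ball_gt0.
have sub w : sphere w -> dot w u = support_function (gauge_ball N) w * N u ->
    subgradient ((support_function (gauge_ball N) w)^-1 *: w) u.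
  move=> sw wu; split=> [x|]; rewrite dotZl.
    by rewrite mulrC ler_pdivrMr ?h0// mulrC dot_le_support.
  by rewrite wu mulrA mulVf ?mul1r// gt_eqF// h0.
exists ((support_function (gauge_ball N) v)^-1 *: v).
exists ((support_function (gauge_ball N) v')^-1 *: v'); split; [exact: sub..|].
apply: contra vv' => /eqP E; have := congr1 (@enorm _ _) E.
rewrite !enormZ sv sv' !mulr1 !gtr0_norm ?invr_gt0 ?h0// => E2.
move: E; rewrite E2 => /(scalerI _) -> //.
by rewrite invr_eq0 gt_eqF// h0.
Qed.

End Uniqueness.

(** * Measurability on the sphere and in the ambient space *)

Section MeasurabilityLemmas.
Variables (R : realType) (n : nat).
Local Notation T := ('rV[R]_n.+1).
Local Notation C := (caratheodory_type (hausdorff_outer R n.+1 n)).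
Local Notation sigma := (spherical_measure R n).

Lemma open_sphere_typeP (O : set (sphere_type R n)) :
  open O <-> exists2 U : set T, open U & (@svec R n) @^-1` U = O.
Proof. by split. Qed.

Lemma sphere_svec (v : sphere_type R n) : sphere (svec v).
Proof. by case: v => v sv; exact: (set_mem sv). Qed.

Lemma svec_surj (u : T) : sphere u -> exists v : sphere_type R n, svec v = u.
Proof. by move=> su; exists (exist _ u (mem_set su)). Qed.

Lemma svec_inj : injective (@svec R n).
Proof. exact: val_inj. Qed.

Lemma borel_open_svec (U : set T) : open U ->
  measurable ((@svec R n) @^-1` U : set (borel_sphere R n)).
Proof. by move=> oU; apply: sub_sigma_algebra; apply/open_sphere_typeP; exists U. Qed.

Lemma borel_closed_svec (A : set T) : closed A ->
  measurable ((@svec R n) @^-1` A : set (borel_sphere R n)).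
Proof.
by move=> cA; rewrite -[A]setCK; apply: measurableC; apply: borel_open_svec; exact: closed_openC.
Qed.

Lemma measurable_closed_cara (A : set T) : closed A -> measurable (A : set C).
Proof. exact: hausdorff_caratheodory_closed. Qed.

Lemma measurable_open_cara (A : set T) : open A -> measurable (A : set C).
Proof.
by move=> oA; rewrite -[A]setCK; apply: measurableC; apply: measurable_closed_cara; exact: open_closedC.
Qed.

Lemma measurable_null_cara (A : set T) : hausdorff n A = 0%E -> measurable (A : set C).
Proof.
move=> A0; apply: le_caratheodory_measurable => X.
have -> : hausdorff_outer R n.+1 n (X `&` A) = 0%E.
  apply/eqP; rewrite eq_le outer_measure_ge0 andbT -A0.
  by apply: le_hausdorff => x [].
by rewrite add0e; apply: le_outer_measure => x [].
Qed.

Lemma measurable_fun_gt d (X : measurableType d) (f : X -> R) :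
  (forall a, measurable [set x | a < f x]) -> measurable_fun [set: X] f.
Proof.
move=> h; apply: (measurability (@RGenOInfty.G R)) => [|_ [_ [a ->] <-]].
  exact: RGenOInfty.measurableE.
rewrite setTI; have -> : f @^-1` `]a, +oo[%classic = [set x | a < f x]; last exact: h.
by apply/seteqP; split=> x /=; rewrite in_itv/= andbT.
Qed.

Lemma measurable_elipschitz_cara (f : T -> R) L : elipschitz f L ->
  measurable_fun [set: C] (f : C -> R).
Proof.
move=> fL; apply: measurable_fun_gt => a; apply: measurable_open_cara.
by apply: open_gt_continuous; exact: elipschitz_continuous fL.
Qed.

Lemma measurable_elipschitz_svec (f : T -> R) L : elipschitz f L ->
  measurable_fun [set: borel_sphere R n] (fun v => f (svec v)).
Proof.
move=> fL; apply: measurable_fun_gt => a.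
apply: (@borel_open_svec [set x | a < f x]).
by apply: open_gt_continuous; exact: elipschitz_continuous fL.
Qed.

Lemma measurable_sphere_cara : measurable (@sphere R n : set C).
Proof. by apply: measurable_closed_cara; exact: closed_sphere. Qed.

Lemma spherical_measure_sphere_lty : (sigma (@sphere R n) < +oo)%E.
Proof. exact: hausdorff_sphere_finite. Qed.

Lemma spherical_measure_cap_gt0 (a : T) (e : R) : sphere a -> 0 < e ->
  (0 < sigma (@sphere R n `&` [set u | (enorm (u - a) < e)%R]))%E.
Proof. exact: hausdorff_cap_gt0. Qed.

Lemma measurable_cap (a : T) (e : R) :
  measurable (@sphere R n `&` [set u | (enorm (u - a) < e)%R] : set C).
Proof.
apply: measurableI; first exact: measurable_sphere_cara.
apply: measurable_open_cara; apply/open_enormP => x /= xa.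
exists (e - enorm (x - a)); first by rewrite subr_gt0.
move=> y; rewrite ltrBrDr => h; apply: le_lt_trans h.
by rewrite (enormBC x y); exact: enorm_triangle.
Qed.

End MeasurabilityLemmas.

(** * Energy of a gauge *)

Section PowerIntegral.
Context d (C : measurableType d) (R : realType) (sigma : {measure set C -> \bar R}).
Variable p : R.
Hypothesis p0 : 0 < p.
Implicit Types (f g : C -> R) (A B : set C).

Definition power_integral f A : \bar R := (\int[sigma]_(u in A) (f u `^ p)%:E)%E.

Definition nonneg_measurable f := measurable_fun setT f /\ forall u, 0 <= f u.

Lemma power_integral_ge0 f A : (0 <= power_integral f A)%E.
Proof. by apply: integral_ge0 => u _; rewrite lee_fin powR_ge0. Qed.

Lemma measurable_powR_EFin f A : nonneg_measurable f ->
  measurable_fun A (fun u => (f u `^ p)%:E : \bar R).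
Proof.
move=> [mf _]; apply/measurable_funTS/measurable_EFinP.
by apply: (@measurableT_comp _ _ _ _ _ _ (@powR R ^~ p)) => //; exact: measurable_powR.
Qed.

Lemma le_power_integral f g A : nonneg_measurable f -> nonneg_measurable g -> measurable A ->
  (forall u, A u -> f u <= g u) -> (power_integral f A <= power_integral g A)%E.
Proof.
move=> mf mg mA fg; apply: ge0_le_integral => //.
- by move=> u _; rewrite lee_fin powR_ge0.
- exact: measurable_powR_EFin.
- exact: measurable_powR_EFin.
- move=> u Au; rewrite lee_fin ge0_ler_powR ?nnegrE ?mf.2 ?mg.2//; first exact: ltW.
  exact: fg.
Qed.

Lemma power_integral_scale f A c : nonneg_measurable f -> measurable A -> 0 < c ->
  (power_integral (fun u => (c * f u)%R) A = (c `^ p)%:E * power_integral f A)%E.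
Proof.
move=> mf mA c0; rewrite /power_integral -ge0_integralZl_EFin ?powR_ge0//.
- by apply: eq_integral => u _; rewrite -EFinM powRM ?mf.2// ltW.
- by move=> u _; rewrite lee_fin powR_ge0.
- exact: measurable_powR_EFin.
Qed.

Lemma power_integral_subset f A B : nonneg_measurable f -> measurable A -> measurable B ->
  A `<=` B -> (power_integral f A <= power_integral f B)%E.
Proof.
move=> mf mA mB AB; apply: ge0_subset_integral => //; first exact: measurable_powR_EFin.
by move=> u _; rewrite lee_fin powR_ge0.
Qed.

Lemma power_integral_setU f A B : nonneg_measurable f -> measurable A -> measurable B ->
  [disjoint A & B] ->
  (power_integral f (A `|` B) = power_integral f A + power_integral f B)%E.
Proof.
move=> mf mA mB AB; apply: ge0_integral_setU => //; first exact: measurable_powR_EFin.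
by move=> u _; rewrite lee_fin powR_ge0.
Qed.

Lemma power_integral_ge f A c : nonneg_measurable f -> measurable A -> 0 <= c ->
  (forall u, A u -> c <= f u) -> ((c `^ p)%:E * sigma A <= power_integral f A)%E.
Proof.
move=> mf mA c0 cN; rewrite -integral_cst//; apply: ge0_le_integral => //.
- by move=> u _ /=; rewrite lee_fin powR_ge0.
- exact: measurable_powR_EFin.
- move=> u Au; rewrite lee_fin ge0_ler_powR ?nnegrE ?mf.2//; first exact: ltW.
  exact: cN.
Qed.

Lemma power_integral_le f A c : nonneg_measurable f -> measurable A -> 0 <= c ->
  (forall u, A u -> f u <= c) -> (power_integral f A <= (c `^ p)%:E * sigma A)%E.
Proof.
move=> mf mA c0 cN; rewrite -integral_cst//; apply: ge0_le_integral => //.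
- by move=> u _; rewrite lee_fin powR_ge0.
- exact: measurable_powR_EFin.
- move=> u Au; rewrite lee_fin ge0_ler_powR ?nnegrE ?mf.2//; first exact: ltW.
  exact: cN.
Qed.

(** Growth by a factor of at most [e^t], confined to [B], adds at most [e^(p t) - 1] times the
    integral over [B]. *)
Lemma power_integral_perturb f g S B t : nonneg_measurable f -> nonneg_measurable g ->
  measurable S -> measurable B -> B `<=` S -> (power_integral f S < +oo)%E -> 0 < t ->
  (forall u, S u -> g u <= expR t * f u) ->
  (forall u, S u -> ~ B u -> g u <= f u) ->
  (power_integral g S <= power_integral f S + (expR (p * t) - 1)%:E * power_integral f B)%E.
Proof.
move=> mf mg mS mB BS fin t0 h1 h2.
have mD : measurable (S `\` B) by exact: measurableD.
have SE : (S `\` B) `|` B = S by rewrite setUC setDUK.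
have dis : [disjoint (S `\` B) & B] by apply/disj_setPS => x [[]].
have mt : nonneg_measurable (fun u => expR t * f u).
  split; last by move=> u; rewrite mulr_ge0 ?expR_ge0// mf.2.
  by apply: measurable_funM => //; exact: mf.1.
have ep : expR t `^ p = expR (p * t) by rewrite -expRM mulrC.
have fB : power_integral f B \is a fin_num.
  by rewrite ge0_fin_numE ?power_integral_ge0// (le_lt_trans _ fin)// power_integral_subset.
rewrite -SE !power_integral_setU//.
apply: (@le_trans _ _ (power_integral f (S `\` B) + (expR (p * t))%:E * power_integral f B)%E).
  apply: leeD; first by apply: le_power_integral => // u [su nB]; exact: h2.
  rewrite -ep -power_integral_scale// ?expR_gt0//; apply: le_power_integral => // u Bu.
  by apply: h1; exact: BS.
rewrite -[leRHS]addeA leeD2l// EFinB muleBl//.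
by rewrite mul1e addeC subeK.
Qed.

End PowerIntegral.

Section Energy.
Variables (R : realType) (n : nat) (p : R).
Hypothesis p0 : 0 < p.
Local Notation T := ('rV[R]_n.+1).
Local Notation C := (caratheodory_type (hausdorff_outer R n.+1 n)).
Local Notation sigma := (spherical_measure R n).
Local Notation S := (@sphere R n).
Implicit Types (N : T -> R) (A B : set C).

Lemma nonneg_measurable_gauge N : gauge N -> nonneg_measurable (N : C -> R).
Proof.
move=> gN; split; last exact: (gauge_ge0 gN).
exact: measurable_elipschitz_cara (gauge_elipschitz gN).
Qed.

Definition energy N (A : set C) : \bar R := power_integral sigma p (N : C -> R) A.

Lemma energy_sphere_lty N : gauge N -> (energy N S < +oo)%E.
Proof.
move=> gN.
have h : (energy N S <= (gauge_size N `^ p)%:E * sigma S)%E.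
  apply: (power_integral_le sigma p0 (nonneg_measurable_gauge gN) (@measurable_sphere_cara R n)).
    exact/ltW/gauge_size_gt0.
  by move=> u su; apply: le_trans (gauge_le_enorm gN u) _; have -> : enorm u = 1 := su; rewrite mulr1.
apply: le_lt_trans h _.
rewrite lte_mul_pinfty ?lee_fin ?powR_ge0//; exact: spherical_measure_sphere_lty.
Qed.

Lemma energy_lty N A : gauge N -> measurable A -> A `<=` S -> (energy N A < +oo)%E.
Proof.
move=> gN mA AS; apply: le_lt_trans (energy_sphere_lty gN).
exact: (power_integral_subset sigma p (nonneg_measurable_gauge gN) mA (@measurable_sphere_cara R n) AS).
Qed.

(* Sealed, so that unification does not unfold integrals. *)
Fact total_energy_key : {f : (T -> R) -> R | forall N, f N = fine (energy N S)}.
Proof. by exists (fun N => fine (energy N S)). Qed.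

Definition total_energy : (T -> R) -> R := sval total_energy_key.

Lemma total_energyE N : gauge N -> energy N S = (total_energy N)%:E.
Proof.
move=> gN; rewrite /total_energy (svalP total_energy_key) fineK// ge0_fin_numE; last exact: power_integral_ge0.
exact: energy_sphere_lty.
Qed.

Lemma total_energy_ge N A c : gauge N -> measurable A -> A `<=` S -> 0 <= c ->
  (forall u, A u -> c <= N u) -> ((c `^ p)%:E * sigma A <= (total_energy N)%:E)%E.
Proof.
move=> gN mA AS c0 cN; rewrite -total_energyE//.
apply: le_trans (power_integral_ge sigma p0 (nonneg_measurable_gauge gN) mA c0 cN) _.
exact: (power_integral_subset sigma p (nonneg_measurable_gauge gN) mA (@measurable_sphere_cara R n) AS).
Qed.

Lemma total_energy_gt0 N : gauge N -> 0 < total_energy N.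
Proof.
move=> gN; have [c c0 hc] := gauge_lower_bound gN.
rewrite -lte_fin; have h := @total_energy_ge N S c gN
  (@measurable_sphere_cara R n) (@subset_refl _ _) (ltW c0).
apply: lt_le_trans (h _); last first.
  by move=> u su; have := hc u; have -> : enorm u = 1 := su; rewrite mulr1.
rewrite mule_gt0// ?lte_fin ?powR_gt0//.
apply: lt_le_trans (spherical_measure_cap_gt0 (sphere_delta R n) ltr01) _.
by apply: le_hausdorff => x [].
Qed.

Lemma le_total_energy N N' : gauge N -> gauge N' -> (forall u, sphere u -> N u <= N' u) ->
  total_energy N <= total_energy N'.
Proof.
move=> gN gN' NN'; rewrite -lee_fin -!total_energyE//.
exact: (le_power_integral sigma p0 (nonneg_measurable_gauge gN) (nonneg_measurable_gauge gN')
  (@measurable_sphere_cara R n)).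
Qed.

Lemma total_energy_scale N c : gauge N -> 0 < c ->
  total_energy (fun u => c * N u) = c `^ p * total_energy N.
Proof.
move=> gN c0; apply: EFin_inj; rewrite EFinM -!total_energyE//; last exact: gauge_scale_gauge.
exact: (power_integral_scale sigma p (nonneg_measurable_gauge gN) (@measurable_sphere_cara R n) c0).
Qed.

Lemma total_energy_perturb N N' B t : gauge N -> gauge N' -> measurable B -> 0 < t ->
  B `<=` S ->
  (forall u, sphere u -> N' u <= expR t * N u) ->
  (forall u, sphere u -> ~ B u -> N' u <= N u) ->
  ((total_energy N')%:E <= (total_energy N)%:E + (expR (p * t) - 1)%:E * energy N B)%E.
Proof.
move=> gN gN' mB t0 BS h1 h2; rewrite -!total_energyE//.
have := @power_integral_perturb _ _ _ sigma p p0 _ _ S B t (nonneg_measurable_gauge gN) (nonneg_measurable_gauge gN')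
  (@measurable_sphere_cara R n) mB BS.
have := energy_sphere_lty gN.
by move=> h; apply.
Qed.

End Energy.

(** * The integral of the logarithm of the support function *)

Section LogSupport.
Variables (R : realType) (n : nat).
Variable mu : {finite_measure set (borel_sphere R n) -> \bar R}.
Local Notation T := ('rV[R]_n.+1).
Local Notation h N := (support_function (gauge_ball N)).
Implicit Types (N : T -> R).

Definition total_mass : R := locked (fine (mu setT)).

Lemma total_massE : total_mass = fine (mu setT).
Proof. by rewrite /total_mass -lock. Qed.

Lemma bounded_integrable_sphere (g : borel_sphere R n -> R) (a b : R) :
  measurable_fun setT g -> (forall v, a <= g v <= b) -> mu.-integrable setT (EFin \o g).
Proof.
move=> mg ab; apply: measurable_bounded_integrable => //; first by rewrite ltey_eq fin_num_measure.
exists (`|a| + `|b|); split=> [|M hM x _ /=]; first exact: num_real.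
apply: le_trans (ltW hM); have /andP[ax xb] := ab x.
rewrite ler_norml; apply/andP; split.
  have := ler_norm (- a); rewrite normrN; have := normr_ge0 b.
  by move=> *; lra.
by rewrite (le_trans xb)// (le_trans (ler_norm _))// lerDr.
Qed.

Lemma support_sphere_bounds N : gauge N -> exists a b : R, [/\ 0 < a, 0 < b &
  forall v, sphere v -> a <= h N v <= b].
Proof.
move=> gN; have [L hL] := support_gauge_ball_elipschitz gN.
have s0 := gauge_size_gt0 gN.
have key v : sphere v -> (gauge_size N)^-1 <= h N v <= L.
  move=> sv; have e1 : enorm v = 1 := sv; apply/andP; split.
    have h1 := dot_le_support gN v v; rewrite -sqr_enorm e1 expr1n in h1.
    rewrite -[leLHS]mul1r ler_pdivrMr//; apply: le_trans h1 _.
    rewrite ler_wpM2l ?support_gauge_ball_ge0//.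
    by have := gauge_le_enorm gN v; rewrite e1 mulr1.
  have := hL v 0; have -> : h N 0 = 0.
    apply/le_anti; rewrite support_gauge_ball_ge0// andbT.
    by apply: support_gauge_ball_le => // x; rewrite dot0l mul0r.
  by rewrite !subr0 e1 mulr1; apply: le_trans (ler_norm _).
exists (gauge_size N)^-1, L; split=> //; first by rewrite invr_gt0.
have := key _ (sphere_delta R n) => /andP[h1 h2]; apply: lt_le_trans (le_trans h1 h2).
by rewrite invr_gt0.
Qed.

Lemma measurable_log_support N : gauge N ->
  measurable_fun setT (fun v : borel_sphere R n => ln (h N (svec v))).
Proof.
move=> gN; have [L hL] := support_gauge_ball_elipschitz gN.
apply: (@measurableT_comp _ _ _ _ _ _ (@ln R)); first exact: measurable_ln.
exact: measurable_elipschitz_svec hL.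
Qed.

Lemma log_support_bounds N : gauge N -> exists a b : R,
  forall v : borel_sphere R n, a <= ln (h N (svec v)) <= b.
Proof.
move=> gN; have [a [b [a0 b0 ab]]] := support_sphere_bounds gN.
exists (ln a), (ln b) => v; have /andP[h1 h2] := ab _ (sphere_svec v).
by rewrite !ler_ln ?posrE ?h1// (lt_le_trans a0).
Qed.

Lemma integrable_log_support N : gauge N ->
  mu.-integrable setT (EFin \o (fun v : borel_sphere R n => ln (h N (svec v)))).
Proof.
move=> gN; have [a [b ab]] := log_support_bounds gN.
exact: bounded_integrable_sphere (measurable_log_support gN) ab.
Qed.

Fact log_support_key : {f : (T -> R) -> R | forall N, f N = (\int[mu]_v ln (h N (svec v)))%R}.
Proof. by exists (fun N => \int[mu]_v ln (h N (svec v)))%R. Qed.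

Definition log_support : (T -> R) -> R := sval log_support_key.

Lemma log_supportE N : log_support N = (\int[mu]_v ln (h N (svec v)))%R.
Proof. exact: (svalP log_support_key). Qed.

Lemma log_support_le N (g : borel_sphere R n -> R) : gauge N ->
  mu.-integrable setT (EFin \o g) -> (forall v, ln (h N (svec v)) <= g v) ->
  log_support N <= \int[mu]_v g v.
Proof.
by move=> gN ig hg; rewrite log_supportE; apply: le_Rintegral => //; exact: integrable_log_support.
Qed.

Lemma log_support_ge N (g : borel_sphere R n -> R) : gauge N ->
  mu.-integrable setT (EFin \o g) -> (forall v, g v <= ln (h N (svec v))) ->
  \int[mu]_v g v <= log_support N.
Proof.
by move=> gN ig hg; rewrite log_supportE; apply: le_Rintegral => //; exact: integrable_log_support.
Qed.

(** Effect of multiplying the support function by [e^c] everywhere and by [e^t] on [A]. The constant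
    [c] serves dilations, [t] serves the perturbation on a closed set. *)
Lemma log_support_add_indic N c t (A : set (borel_sphere R n)) : gauge N -> measurable A ->
  \int[mu]_v (ln (h N (svec v)) + (c + t * \1_A v)) =
  log_support N + (c * total_mass + t * fine (mu A)).
Proof.
move=> gN mA; rewrite log_supportE total_massE.
have ic : mu.-integrable setT (EFin \o (fun=> c)) by exact: finite_measure_integrable_cst.
have iA : mu.-integrable setT (EFin \o (\1_A : _ -> R)) by exact: integrable_indic.
have itA : mu.-integrable setT (EFin \o (fun v => t * \1_A v)).
  by apply: (integrableZl measurableT t iA).
have ict : mu.-integrable setT (EFin \o (fun v => c + t * \1_A v)).
  by apply: (integrableD measurableT ic itA).
rewrite RintegralD//; last exact: integrable_log_support.
rewrite RintegralD// RintegralZl// Rintegral_cst//; congr (_ + (_ + _ * _)).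
by rewrite /Rintegral integral_indic// setIT.
Qed.

Lemma integrable_log_support_add N c t (A : set (borel_sphere R n)) : gauge N -> measurable A ->
  mu.-integrable setT (EFin \o (fun v => ln (h N (svec v)) + (c + t * \1_A v))).
Proof.
move=> gN mA.
have ic : mu.-integrable setT (EFin \o (fun=> c)) by exact: finite_measure_integrable_cst.
have iA : mu.-integrable setT (EFin \o (\1_A : _ -> R)) by exact: integrable_indic.
have itA : mu.-integrable setT (EFin \o (fun v => t * \1_A v)).
  by apply: (integrableZl measurableT t iA).
have icA : mu.-integrable setT (EFin \o (fun v => c + t * \1_A v)).
  by apply: (integrableD measurableT ic itA).
have := integrableD measurableT (integrable_log_support gN) icA.
by apply.
Qed.

End LogSupport.

(** [f0] is a cluster point, in the product of the intervals [[0, b x]], of the filter generated by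
    the directed sets [A i]. Closeness is available at finitely many points at a time, as in the
    product topology. *)
Lemma compact_family (X : eqType) (R : realType) (I : Type) (A : I -> set (X -> R)) (b : X -> R) :
  inhabited I -> (forall i, A i !=set0) ->
  (forall i j, exists k, A k `<=` A i `&` A j) ->
  (forall i f, A i f -> forall x, 0 <= f x <= b x) ->
  exists f0 : X -> R, forall i (s : seq X) (e : R), 0 < e ->
    exists2 f, A i f & forall x, x \in s -> `|f x - f0 x| < e.
Proof.
move=> [i0] A0 AD Ab; pose W := forall x : X, (fun=> R) x.
pose F : set_system W := filter_from [set: I] A.
have FF : Filter F.
  apply: filter_from_filter; first by exists i0.
  by move=> i j _ _; have [k hk] := AD i j; exists k.
have PF : ProperFilter F by apply: filter_from_proper => i _; exact: A0.
have := @tychonoff X (fun=> R) (fun x => [set y | 0 <= y <= b x]).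
have cI x : compact [set y : R | 0 <= y <= b x].
  have -> : [set y : R | 0 <= y <= b x] = [set` `[0, b x]].
    by apply/seteqP; split=> y /=; rewrite in_itv.
  exact: segment_compact.
move=> /(_ cI) /(_ F PF) [|f0 [_ cl]].
  by exists i0 => // f /Ab.
exists f0 => i s e e0.
have nb : nbhs f0 [set f : W | forall x, x \in s -> `|f x - f0 x| < e].
  elim: s => [|x s ih]; first by apply: filterS filterT => f _ x; rewrite in_nil.
  have nx : nbhs f0 [set f : W | `|f x - f0 x| < e].
    have pc := @proj_continuous X (fun=> R) x f0.
    apply: (pc [set y : R | `|y - f0 x| < e]).
    by apply/nbhs_ballP; exists e => //= y; rewrite /ball /= distrC.
  apply: filterS (filterI nx ih) => f [fx fs] y.
  by rewrite in_cons => /orP[/eqP ->//|/fs].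
have Fi : F (A i) by exists i.
by have [f [Af hf]] := cl _ _ Fi nb; exists f.
Qed.

(** * The functional, its scale invariance and its continuity *)

Section Functional.
Variables (R : realType) (n : nat) (p : R).
Hypothesis p0 : 0 < p.
Variable mu : {finite_measure set (borel_sphere R n) -> \bar R}.
Local Notation T := ('rV[R]_n.+1).
Local Notation h N := (support_function (gauge_ball N)).
Local Notation m0 := (total_mass mu).
Implicit Types (N : T -> R).

Definition functional N := - log_support mu N - m0 / p * ln (total_energy p N).

Lemma total_mass_ge0 : 0 <= m0.
Proof. by rewrite total_massE; apply: fine_ge0; exact: measure_ge0. Qed.

(** The bound [N' <= b N] gives [h_N <= b h_N'], which controls the logarithmic term, and
    [a N <= N'] bounds the energy below by the factor [a^p]. With [a = b] this is scale invariance,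
    with both near 1 it is continuity. *)
Lemma functional_near N N' a b : gauge N -> gauge N' -> 0 < a -> 0 < b ->
  (forall x, a * N x <= N' x) -> (forall x, N' x <= b * N x) ->
  functional N' <= functional N + m0 * (ln b - ln a).
Proof.
move=> gN gN' a0 b0 aN bN.
have L : log_support mu N - m0 * ln b <= log_support mu N'.
  have := @log_support_add_indic R n mu N (- ln b) 0 set0 gN measurable0.
  rewrite mul0r addr0 mulNr (mulrC (ln b)) => <-.
  apply: log_support_ge => //; first exact: integrable_log_support_add.
  move=> v; rewrite mul0r addr0.
  have hN := support_gauge_ball_gt0 gN (sphere_neq0 (sphere_svec v)).
  have hN' := support_gauge_ball_gt0 gN' (sphere_neq0 (sphere_svec v)).
  rewrite lerBlDl -lnM ?posrE// ler_ln ?posrE// ?mulr_gt0//.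
  exact: support_gauge_ball_mono gN' gN (ltW b0) bN.
have I0 := total_energy_gt0 p0 gN.
have I : p * ln a + ln (total_energy p N) <= ln (total_energy p N').
  rewrite -ln_powR -lnM ?posrE ?powR_gt0// ler_ln ?posrE ?mulr_gt0 ?powR_gt0//.
    rewrite -total_energy_scale//; apply: le_total_energy => //.
    exact: gauge_scale_gauge.
  exact: total_energy_gt0.
have mp : 0 <= m0 / p by rewrite divr_ge0 ?total_mass_ge0// ltW.
have := ler_wpM2l mp I; rewrite mulrDr mulrA divfK ?gt_eqF// => I'.
rewrite /functional mulrBr.
move: (log_support mu N) (log_support mu N') (m0 * ln a) (m0 * ln b)
  (m0 / p * ln (total_energy p N)) (m0 / p * ln (total_energy p N')) L I'.
by clear => *; lra.
Qed.

Lemma functional_scale N c : gauge N -> 0 < c -> functional (fun x => c * N x) = functional N.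
Proof.
move=> gN c0; have gc := gauge_scale_gauge gN c0.
apply/le_anti/andP; split.
  have := @functional_near N _ c c gN gc c0 c0 (fun=> lexx _) (fun=> lexx _).
  by rewrite subrr mulr0 addr0.
have ci0 : 0 < c^-1 by rewrite invr_gt0.
have E x : c^-1 * (c * N x) = N x by rewrite mulrA mulVf ?mul1r// gt_eqF.
have := @functional_near _ N c^-1 c^-1 gc gN ci0 ci0.
by rewrite subrr mulr0 addr0; apply => x; rewrite E.
Qed.

(** The bound [N' <= N] alone enlarges the support function. Both hypotheses hold together when [N']
    is the gauge of the Wulff shape of [h N]. *)
Lemma functional_mono N N' : gauge N -> gauge N' -> (forall x, N' x <= N x) ->
  (forall v, sphere v -> h N' v <= h N v) -> functional N <= functional N'.
Proof.
move=> gN gN' le hle; rewrite /functional; apply: lerB.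
  rewrite lerN2 [leRHS]log_supportE; apply: log_support_le => //; first exact: integrable_log_support.
  move=> v; have sv := sphere_svec v.
  by rewrite ler_ln ?posrE ?support_gauge_ball_gt0 ?sphere_neq0// hle.
rewrite ler_wpM2l//; first by rewrite divr_ge0 ?total_mass_ge0// ltW.
rewrite ler_ln ?posrE ?total_energy_gt0//.
by apply: le_total_energy.
Qed.

End Functional.

(** * Existence of a maximizer *)

Section Maximizer.
Variables (R : realType) (n : nat) (p : R).
Hypothesis p0 : 0 < p.
Variable mu : {finite_measure set (borel_sphere R n) -> \bar R}.
Hypothesis nconc : ~ (exists w : sphere_type R n, concentrated_in mu (closed_hemisphere w)).
Local Notation T := ('rV[R]_n.+1).
Local Notation h N := (support_function (gauge_ball N)).
Local Notation m0 := (total_mass mu).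
Local Notation J := (functional p mu).
Implicit Types (N : T -> R).

Lemma gauge_enorm : gauge (@enorm R n.+1).
Proof.
split=> [x y|t x t0|x]; first exact: enormD.
  by rewrite enormZ ger0_norm.
by rewrite enorm_gt0.
Qed.

(** The open hemisphere around [w] is the union of the sets [1 / (k + 1) <= dot w x] and the
    complement of the closed hemisphere of [- w]. If all these sets were null, [mu] would be
    concentrated in the latter. *)
Lemma open_hemisphere_mass (w : T) : sphere w -> exists2 d : R, 0 < d &
  0 < fine (mu ((@svec R n) @^-1` [set x | d <= dot w x])).
Proof.
move=> sw; have [w' ew'] := svec_surj (sphereN sw).
apply: contrapT => H; apply: nconc; exists w'; rewrite /concentrated_in.
pose A (k : nat) : set (borel_sphere R n) := (@svec R n) @^-1` [set x | k.+1%:R^-1 <= dot w x].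
have mA k : measurable (A k).
  apply: borel_closed_svec.
  have -> : [set x | k.+1%:R^-1 <= dot w x] = [set x | - dot w x <= - k.+1%:R^-1].
    by apply/seteqP; split=> x /=; rewrite lerN2.
  by apply: closed_le_continuous => x; apply: continuousN; exact: continuous_dot.
have A0 k : mu (A k) = 0%E.
  apply: contrapT => /eqP nz; apply: H; exists k.+1%:R^-1; first by rewrite invr_gt0.
  apply: fine_gt0; rewrite lt_def nz measure_ge0/=.
  by rewrite ltey_eq fin_num_measure//; exact: mA.
apply/eqP; rewrite -measure_le0; apply: le_trans (_ : _ <= mu (\bigcup_k A k))%E _.
  apply: le_measure; rewrite ?inE.
  - apply: measurableC; rewrite /closed_hemisphere.
    have -> : [set v | 0 <= dot (svec v) (svec w')] =
        (@svec R n) @^-1` [set x | dot w x <= 0] :> set (borel_sphere R n).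
      by apply/seteqP; split=> v /=; rewrite ew' dotNr dotC oppr_ge0.
    by apply: borel_closed_svec; apply: closed_le_continuous; exact: continuous_dot.
  - exact: bigcupT_measurable.
  - move=> v; rewrite /closed_hemisphere /= ew' dotNr oppr_ge0 => /negP; rewrite -ltNge dotC => d0.
    exists (Num.truncn (1 / dot w (svec v))) => //; rewrite /A /=.
    by rewrite -[leLHS]div1r div_truncn_le.
have := measure_sigma_subadditive mu mA (bigcupT_measurable _ mA) (@subset_refl _ _).
rewrite (eseries0 (fun k _ _ => A0 k)); exact.
Qed.

Lemma sphere_finite_net (e : R) : 0 < e ->
  exists s : seq T, forall u, sphere u -> exists2 x, x \in s & enorm (u - x) < e.
Proof.
move=> e0; have := @compact_sphere R n; rewrite compact_cover.
move=> /(_ T (@sphere R n) (fun x => [set u | enorm (u - x) < e])) [].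
- move=> x _; apply/open_enormP => u /= ux; exists (e - enorm (u - x)); first by rewrite subr_gt0.
  move=> y; rewrite ltrBrDr; apply: le_lt_trans.
  by rewrite (enormBC u y); exact: enorm_triangle.
- by move=> u su; exists u => //=; rewrite subrr enorm0.
move=> D _ hD; exists (finmap.enum_fset D) => u /hD[x /= xD ux].
by exists x.
Qed.

Lemma gauge_sphere_le N N' (a b : R) : gauge N -> gauge N' ->
  (forall u, sphere u -> a * N u <= b * N' u) -> forall x, a * N x <= b * N' x.
Proof.
move=> gN gN' hS x; have [->|x0] := eqVneq x 0; first by rewrite !gauge0// !mulr0.
have ex : 0 < enorm x by rewrite enorm_gt0.
have := hS _ (sphere_normalize x0); rewrite !gauge_scale ?invr_ge0 ?enorm_ge0//.
by rewrite mulrCA [X in _ <= X]mulrCA ler_pM2l// invr_gt0.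
Qed.

(** With this scale a gauge is 1-Lipschitz and at most the Euclidean norm, and its support function
    is at least 1 on the sphere. *)
Definition normalized N := gauge N /\ gauge_size N = 1.

Lemma normalize_gauge N : gauge N -> exists2 N', normalized N' & J N' = J N.
Proof.
move=> gN; have s0 := gauge_size_gt0 gN.
have is0 : 0 < (gauge_size N)^-1 by rewrite invr_gt0.
exists (fun x => (gauge_size N)^-1 * N x); last exact: functional_scale.
split; first exact: gauge_scale_gauge.
rewrite /gauge_size; under eq_bigr do rewrite -mulrDr.
by rewrite -mulr_sumr mulVf// gt_eqF.
Qed.

Lemma normalized_le_enorm N x : normalized N -> N x <= enorm x.
Proof. by move=> [gN s1]; have := gauge_le_enorm gN x; rewrite s1 mul1r. Qed.

Lemma normalized_support_ge1 N v : normalized N -> sphere v -> 1 <= h N v.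
Proof.
move=> nN sv; have e1 : enorm v = 1 := sv.
have := dot_le_support nN.1 v v; rewrite -sqr_enorm e1 expr1n => /le_trans; apply.
rewrite -[leRHS]mulr1 ler_wpM2l ?support_gauge_ball_ge0//; first exact: nN.1.
by have := normalized_le_enorm v nN; rewrite e1.
Qed.

(** Where [d <= dot w v], the bound [dot w v <= h v * N w] gives [ln (h v) >= ln d - ln (N w)];
    elsewhere normalization gives [ln (h v) >= 0]. Since [N] is 1-Lipschitz, [N >= e / 2] on a cap
    around [u0], which bounds the energy below. For fixed [d] and [e], if the set in question has
    positive mass, the bound tends to minus infinity with [N w]. *)
Lemma functional_degenerate N (w u0 : T) (d e : R) : normalized N -> sphere w -> sphere u0 ->
  0 < d -> 0 < e -> e <= N u0 ->
  J N <= (ln (N w) - ln d) * fine (mu ((@svec R n) @^-1` [set x | d <= dot w x])) -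
    m0 / p * ln ((e / 2) `^ p * fine (hausdorff n (@sphere R n `&` [set u | enorm (u - u0) < e / 2]))).
Proof.
move=> nN sw su0 d0 e0 eN; have gN := nN.1; set A := _ @^-1` _; set cap := _ `&` _.
have Nw : 0 < N w := gauge_gt0 gN (sphere_neq0 sw).
have mA : measurable (A : set (borel_sphere R n)).
  apply: borel_closed_svec.
  have -> : [set x | d <= dot w x] = [set x | - dot w x <= - d].
    by apply/seteqP; split=> x /=; rewrite lerN2.
  by apply: closed_le_continuous => x; apply: continuousN; exact: continuous_dot.
have L : (ln d - ln (N w)) * fine (mu A) <= log_support mu N.
  have iA : mu.-integrable setT (EFin \o (\1_A : borel_sphere R n -> R)) by exact: integrable_indic.
  have -> : (ln d - ln (N w)) * fine (mu A) = \int[mu]_v ((ln d - ln (N w)) * \1_A v).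
    by rewrite RintegralZl//; congr (_ * _); rewrite /Rintegral integral_indic// setIT.
  apply: log_support_ge => //; first by apply: (integrableZl measurableT _ iA).
  move=> v; have sv := sphere_svec v.
  have [vA|vA] := boolP (v \in A); last first.
    by rewrite indicE (negbTE vA) mulr0 ln_ge0// normalized_support_ge1.
  rewrite indicE vA mulr1 -ln_div ?posrE//.
  have dv : d <= dot w (svec v) by move: vA; rewrite inE.
  rewrite ler_ln ?posrE ?divr_gt0// ?support_gauge_ball_gt0 ?sphere_neq0//.
  rewrite ler_pdivrMr//; apply: le_trans dv _.
  by rewrite dotC; exact: dot_le_support.
have cap0 : (0 < hausdorff n cap)%E by apply: hausdorff_cap_gt0 => //; rewrite divr_gt0.
have capy : (hausdorff n cap < +oo)%E.
  by apply: le_lt_trans (hausdorff_sphere_finite R n); apply: le_hausdorff => x [].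
have capf : hausdorff n cap = (fine (hausdorff n cap))%:E.
  by rewrite fineK// ge0_fin_numE// ltW.
have I : (e / 2) `^ p * fine (hausdorff n cap) <= total_energy p N.
  rewrite -lee_fin EFinM -capf.
  have := @total_energy_ge R n p p0 N cap (e / 2) gN (measurable_cap _ _).
  apply; first by move=> x [].
    by rewrite divr_ge0// ltW.
  move=> u [su /= uu0]; have := gauge_elipschitz gN u u0; rewrite nN.2 mul1r ler_norml.
  by move=> /andP[h1 _]; lra.
have cp : 0 < (e / 2) `^ p * fine (hausdorff n cap).
  by rewrite mulr_gt0 ?powR_gt0 ?divr_gt0// fine_gt0// cap0.
have lnI : ln ((e / 2) `^ p * fine (hausdorff n cap)) <= ln (total_energy p N).
  by rewrite ler_ln ?posrE// (lt_le_trans cp).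
have mp : 0 <= m0 / p by rewrite divr_ge0 ?total_mass_ge0// ltW.
have := ler_wpM2l mp lnI; rewrite /functional.
have := L; rewrite -opprB mulNr.
move: (log_support mu N) (m0 / p * ln _) (m0 / p * ln _) (_ * fine (mu A)) => *.
by lra.
Qed.

(** The family is indexed by all gauges, [A i] being the normalized gauges at least as good as [i].
    It is directed because the better of two gauges gives the smaller set. A cluster point is at
    least as good as every gauge, and finiteness of the supremum never has to be discussed. *)
Lemma functional_maximizer : exists2 N0, gauge N0 & forall N, gauge N -> J N <= J N0.
Proof.
pose Idx := {N : T -> R | gauge N}.
pose A (i : Idx) := [set f : T -> R | normalized f /\ J (sval i) <= J f].
have [||||N0 near0] := @compact_family T R Idx A (@enorm R n.+1).
- by constructor; exists (@enorm R n.+1); exact: gauge_enorm.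
- move=> [N gN]; have [N' nN' JN'] := normalize_gauge gN.
  by exists N'; split => //=; rewrite JN'.
- move=> [N gN] [N' gN']; have [le|/ltW le] := leP (J N) (J N').
    by exists (exist _ N' gN') => f [/= nf hf]; split; split => //=; apply: le_trans hf.
  by exists (exist _ N gN) => f [/= nf hf]; split; split => //=; apply: le_trans hf.
- move=> i f [nf _] x; rewrite gauge_ge0 ?normalized_le_enorm//; exact: nf.1.
pose i0 : Idx := exist _ _ gauge_enorm.
have le_eps (x y : R) : (forall e, 0 < e -> x <= y + e) -> x <= y.
  by move=> xy; apply/ler_addgt0Pr.
(* Nonnegativity, subadditivity, homogeneity and size 1 each concern finitely many values, so they
   pass to [N0]. Strict positivity does not pass to limits and is obtained last, from the estimate
   for degenerate gauges. *)
have N0ge0 x : 0 <= N0 x.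
  apply: le_eps => e e0; have [f [nf _] fx] := near0 i0 [:: x] e e0.
  have := fx x (mem_head _ _); rewrite ltr_norml => /andP[? ?].
  by have := gauge_ge0 nf.1 x; lra.
have N0add x y : N0 (x + y) <= N0 x + N0 y.
  apply: le_eps => e e0; have e3 : 0 < e / 3 by rewrite divr_gt0.
  have [f [nf _] fx] := near0 i0 [:: x; y; x + y] _ e3.
  have := fx x; rewrite !inE eqxx => /(_ isT); rewrite ltr_norml => /andP[? ?].
  have := fx y; rewrite !inE eqxx orbT => /(_ isT); rewrite ltr_norml => /andP[? ?].
  have := fx (x + y); rewrite !inE eqxx !orbT => /(_ isT); rewrite ltr_norml => /andP[? ?].
  by have := gauge_add nf.1 x y; lra.
have N0Z t x : 0 <= t -> N0 (t *: x) = t * N0 x.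
  move=> t0; apply/eqP; rewrite -subr_eq0 -normr_le0; apply: le_eps => e e0; rewrite add0r.
  have t1 : 0 < 1 + t by rewrite ltr_pwDl.
  have e1 : 0 < e / (1 + t) by rewrite divr_gt0.
  have [f [nf _] fx] := near0 i0 [:: x; t *: x] _ e1.
  have /ltW h1 := fx x (mem_head _ _).
  have /ltW h2 : `|f (t *: x) - N0 (t *: x)| < e / (1 + t).
    by apply: fx; rewrite !inE eqxx orbT.
  have -> : N0 (t *: x) - t * N0 x = t * (f x - N0 x) - (f (t *: x) - N0 (t *: x)).
    by rewrite (gauge_scale nf.1)//; ring.
  apply: le_trans (ler_normB _ _) _; rewrite normrM (ger0_norm t0).
  have -> : e = t * (e / (1 + t)) + e / (1 + t) by field; rewrite gt_eqF.
  by rewrite lerD// ler_wpM2l.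
have N0lip : elipschitz N0 (gauge_size N0) by exact: sublinear_elipschitz.
have size_near f e : (forall i, `|f (delta_mx 0 i) - N0 (delta_mx 0 i)| <= e /\
     `|f (- delta_mx 0 i) - N0 (- delta_mx 0 i)| <= e) ->
    `|gauge_size f - gauge_size N0| <= n.+1%:R * (2 * e).
  move=> fe; rewrite /gauge_size -sumrB; apply: le_trans (ler_norm_sum _ _ _) _.
  apply: (@le_trans _ _ (\sum_(i < n.+1) (2 * e))); last first.
    by rewrite sumr_const card_ord -[leLHS]mulr_natl.
  apply: ler_sum => i _; have [h1 h2] := fe i.
  rewrite opprD addrACA; apply: le_trans (ler_normD _ _) _; lra.
have size1 : gauge_size N0 = 1.
  apply/eqP; rewrite -subr_eq0 -normr_le0; apply: le_eps => e e0; rewrite add0r.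
  have n0 : 0 < n.+1%:R :> R by rewrite ltr0n.
  have e1 : 0 < e / (2 * n.+1%:R) by rewrite divr_gt0// mulr_gt0.
  have [f [nf _] fx] := near0 i0 ([seq delta_mx 0 i | i <- enum 'I_n.+1] ++
     [seq - delta_mx 0 i | i <- enum 'I_n.+1]) _ e1.
  have : `|gauge_size f - gauge_size N0| <= n.+1%:R * (2 * (e / (2 * n.+1%:R))).
    apply: size_near => i; split; apply/ltW/fx; rewrite mem_cat.
      by rewrite (map_f (fun i => delta_mx 0 i)) ?mem_enum.
    by rewrite (map_f (fun i => - delta_mx 0 i)) ?mem_enum ?orbT.
  rewrite nf.2 distrC; have -> // : n.+1%:R * (2 * (e / (2 * n.+1%:R))) = e.
  by field; rewrite gt_eqF.
rewrite size1 in N0lip.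
(* A finite net of mesh [e / 3] and the Lipschitz constant 1 of both [f] and [N0] turn closeness on
   the net into closeness on the sphere. *)
have near i (e : R) : 0 < e -> exists2 f, A i f & forall u, sphere u -> `|f u - N0 u| <= e.
  move=> e0; have e3 : 0 < e / 3 by rewrite divr_gt0.
  have [s hs] := sphere_finite_net e3; have [f Af fx] := near0 i s _ e3.
  exists f => // u su; have [x xs ux] := hs u su.
  have := fx x xs; have := N0lip u x; have := gauge_elipschitz Af.1.1 u x.
  rewrite Af.1.2 !mul1r; move: (f u) (f x) (N0 u) (N0 x) => a b c d.
  by rewrite !ler_norml ltr_norml => /andP[? ?] /andP[? ?] /andP[? ?]; apply/andP; split; lra.
have [u0 su0 N0u0] : exists2 u0, sphere u0 & 0 < N0 u0.
  apply: contrapT => H; have : gauge_size N0 <= 0.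
    rewrite /gauge_size; apply: sumr_le0 => i _.
    have sd : sphere (delta_mx 0 i : T).
      rewrite /sphere /= /enorm /dot (bigD1 i)//= big1 ?addr0 => [|j ji].
        by rewrite !mxE !eqxx mulr1 sqrtr1.
      by rewrite !mxE (negbTE ji) andbF mulr0.
    have le0 u : sphere u -> N0 u <= 0.
      by move=> su; rewrite leNgt; apply/negP => lt; apply: H; exists u.
    have := le0 _ sd; have := le0 _ (sphereN sd).
    by lra.
  by rewrite size1 ler10.
have N0pos w : sphere w -> 0 < N0 w.
  move=> sw; rewrite lt_def N0ge0 andbT; apply/eqP => N0w.
  have [d d0 m1] := open_hemisphere_mass sw.
  set m1' := fine _ in m1.
  pose a := N0 u0 / 2; have a0 : 0 < a by rewrite divr_gt0.
  pose C1 := m0 / p * ln ((a / 2) `^ p * fine (hausdorff n (@sphere R n `&` [set u | enorm (u - u0) < a / 2]))).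
  (* If [N0 w = 0], a nearby [f] has [f w <= d * expR (- K)] while [f u0 >= a]. The degenerate
     estimate then puts [J f] below [J (@enorm R n.+1)], although [f] was taken at least as good as
     the Euclidean norm. *)
  pose K := (`|J (@enorm R n.+1)| + `|C1| + 1) / m1'.
  have e0 : 0 < d * expR (- K) by rewrite mulr_gt0// expR_gt0.
  pose e := Num.min a (d * expR (- K)); have ep : 0 < e by rewrite lt_min a0.
  have [f [nf /= Jf] fN] := near i0 e ep.
  have fw : f w <= d * expR (- K).
    have := fN w sw; rewrite N0w subr0 => /(le_trans (ler_norm _))/le_trans; apply.
    by rewrite ge_min lexx orbT.
  have fu0 : a <= f u0.
    have := fN u0 su0; rewrite ler_norml => /andP[h1 _].
    have : e <= a by rewrite ge_min lexx.
    by rewrite /a in h1 *; lra.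
  have := functional_degenerate nf sw su0 d0 a0 fu0; rewrite -/C1 -/m1' => hJ.
  have fw0 : 0 < f w by exact: (gauge_gt0 nf.1 (sphere_neq0 sw)).
  have lnf : ln (f w) - ln d <= - K.
    have : ln (f w) <= ln (d * expR (- K)) by rewrite ler_ln ?posrE.
    by rewrite lnM ?posrE ?expR_gt0// expRK; lra.
  have : (ln (f w) - ln d) * m1' <= - K * m1' by rewrite ler_wpM2r// ltW.
  rewrite mulNr /K divfK ?gt_eqF// => h3.
  have := ler_norm (- J (@enorm R n.+1)); have := ler_norm (- C1); rewrite !normrN.
  move: hJ Jf h3; clear; clearbody C1.
  move: (J f) (J (@enorm R n.+1)) (_ * m1') => *; lra.
have gN0 : gauge N0.
  split=> // x x0; have ex : 0 < enorm x by rewrite enorm_gt0.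
  have := N0pos _ (sphere_normalize x0); rewrite N0Z ?invr_ge0 ?enorm_ge0//.
  by rewrite pmulr_rgt0// invr_gt0.
exists N0 => // N gN; apply: le_eps => e e0.
have [c c0 hc] := gauge_lower_bound gN0.
have m1 : 0 < m0 + 1 by rewrite ltr_pwDr// total_mass_ge0.
(* The loss will be [m0 * (s + s)], which is at most [e]; the [+ 1] guards against division by
   zero. *)
pose s := e / (2 * (m0 + 1)); have s0 : 0 < s by rewrite divr_gt0// mulr_gt0.
have es1 : 1 < expR s by rewrite -expR0 ltr_expR.
have es2 : expR (- s) < 1 by rewrite -expR0 ltr_expR oppr_lt0.
(* An error of [eta * c <= eta * N0 u] is relative to [N0], so [f] lies between [expR (- s) * N0]
   and [expR s * N0]. *)
pose eta := Num.min (expR s - 1) (1 - expR (- s)).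
have eta0 : 0 < eta by rewrite lt_min !subr_gt0 es1 es2.
have [f [nf /= Jf] fN] := near (exist _ N gN) (eta * c) (mulr_gt0 eta0 c0).
apply: le_trans Jf _.
have uN u : sphere u -> eta * c <= eta * N0 u.
  move=> su; rewrite ler_wpM2l ?(ltW eta0)//.
  by have := hc u; have -> : enorm u = 1 := su; rewrite mulr1.
have e1 : eta <= expR s - 1 by rewrite ge_min lexx.
have e2 : eta <= 1 - expR (- s) by rewrite ge_min lexx orbT.
have lo : forall x, expR (- s) * N0 x <= 1 * f x.
  apply: gauge_sphere_le => //; first exact: nf.1.
  move=> u su; have := fN u su; rewrite ler_norml => /andP[h1 h2].
  have := uN u su; have := ler_wpM2r (N0ge0 u) e2; rewrite mulrBl !mul1r.
  by move: (expR _ * _) (eta * N0 u) (eta * c) h1 h2 => *; lra.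
have hi : forall x, 1 * f x <= expR s * N0 x.
  apply: gauge_sphere_le => //; first exact: nf.1.
  move=> u su; have := fN u su; rewrite ler_norml => /andP[h1 h2].
  have := uN u su; have := ler_wpM2r (N0ge0 u) e1; rewrite mulrBl !mul1r.
  by move: (expR _ * _) (eta * N0 u) (eta * c) h1 h2 => *; lra.
have := @functional_near R n p p0 mu N0 f (expR (- s)) (expR s) gN0 nf.1 (expR_gt0 _) (expR_gt0 _).
rewrite !expRK => /(_ _ _)/le_trans; apply.
- by move=> x; have := lo x; rewrite mul1r.
- by move=> x; have := hi x; rewrite mul1r.
rewrite lerD2l opprK (_ : m0 * (s + s) = e * (m0 / (m0 + 1))); last first.
  by rewrite /s; field; rewrite gt_eqF.
rewrite -[leRHS]mulr1 ler_wpM2l ?(ltW e0)// ler_pdivrMr// mul1r.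
by rewrite lerDl.
Qed.

End Maximizer.

(** * Euler-Lagrange equation *)

Section DensityPushforward.
Local Open Scope ereal_scope.
Context d d' (X : measurableType d) (Y : measurableType d') (R : realType).
Variables (sigma : {measure set X -> \bar R}) (S : set X) (g : X -> \bar R) (alpha : X -> Y).
Hypotheses (mS : measurable S) (mg : measurable_fun S g) (g0 : forall x, 0 <= g x)
  (malpha : measurable_fun S alpha).

(* The dummy [let] makes the hypotheses parameters of [push_density], so that
   the measure instance below can be inferred. *)
Definition push_density (eta : set Y) : \bar R :=
  let _ := (mS, mg, g0, malpha) in \int[sigma]_(x in S `&` alpha @^-1` eta) g x.

Let push_density0 : push_density set0 = 0.
Proof. by rewrite /push_density preimage_set0 setI0 integral_set0. Qed.

Let push_density_ge0 eta : 0 <= push_density eta.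
Proof. exact: integral_ge0. Qed.

Let push_density_sigma_additive : semi_sigma_additive push_density.
Proof.
move=> F mF tF mUF; rewrite /push_density preimage_bigcup setI_bigcupr.
have -> : \int[sigma]_(x in \bigcup_i (S `&` alpha @^-1` F i)) g x =
    \sum_(i <oo) \int[sigma]_(x in S `&` alpha @^-1` F i) g x.
  apply: ge0_integral_bigcup => //.
  - by move=> k; exact: malpha.
  - by apply: measurable_funS mg => // x [i _ []].
  - apply/trivIsetP => i j _ _ ij; rewrite -subset0 => x [[_ xi] [_ xj]].
    have /trivIsetP/(_ i j I I ij) := tF; rewrite -subset0 => /(_ (alpha x)).
    by apply.
apply: is_cvg_nneseries => i _ _; exact: integral_ge0.
Qed.

HB.instance Definition _ := isMeasure.Build _ _ _ push_density
  push_density0 push_density_ge0 push_density_sigma_additive.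

End DensityPushforward.

(** * One-sided variation at a maximizer *)

Section EulerLagrange.
Variables (R : realType) (n : nat) (p : R).
Hypothesis p0 : 0 < p.
Variable mu : {finite_measure set (borel_sphere R n) -> \bar R}.
Local Notation T := ('rV[R]_n.+1).
Local Notation C := (caratheodory_type (hausdorff_outer R n.+1 n)).
Local Notation S := (@sphere R n).
Local Notation sigma := (spherical_measure R n).
Local Notation supp N := (support_function (gauge_ball N)).
Local Notation m0 := (total_mass mu).
Local Notation J := (functional p mu).
Implicit Types (N : T -> R) (A : set T).

Definition gauge_normal_image N A : set T :=
  [set u | sphere u /\ exists v, [/\ sphere v, A v & dot v u = supp N v * N u]].

(** These are the directions in which the competitor can exceed [N]: outside this set,
    [expR t * dot v u <= supp N v * N u] for every unit [v] in [A]. *)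
Definition near_normal_image N A (t : R) : set T :=
  [set u | sphere u /\ exists v, [/\ sphere v, A v & supp N v * N u < expR t * dot v u]].

(** For fixed [v] the strict inequality is an open condition on [u], so the set is relatively open
    in the sphere even though [v] ranges over an uncountable set. *)
Lemma near_normal_image_measurable N A t : gauge N ->
  measurable (near_normal_image N A t : set C).
Proof.
move=> gN; have -> : near_normal_image N A t =
    S `&` \bigcup_(v in S `&` A) [set u | 0 < expR t * dot v u - supp N v * N u].
  apply/seteqP; split=> u.
    by move=> [su [v [sv Av lt]]]; split=> //; exists v => //=; rewrite subr_gt0.
  by move=> [su [v [sv Av] /=]]; rewrite subr_gt0 => lt; split=> //; exists v.
apply: measurableI; first exact: measurable_sphere_cara.
apply: measurable_open_cara; apply: bigcup_open => v [sv _]; apply: open_gt_continuous.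
apply: (@elipschitz_continuous _ _ _ (expR t * enorm v + supp N v * gauge_size N)) => x y.
have -> : expR t * dot v x - supp N v * N x - (expR t * dot v y - supp N v * N y) =
  expR t * (dot v x - dot v y) - supp N v * (N x - N y) by ring.
apply: le_trans (ler_normB _ _) _; rewrite !normrM mulrDl.
rewrite (ger0_norm (expR_ge0 t)) (ger0_norm (support_gauge_ball_ge0 gN v)) -!mulrA.
apply: lerD; first by rewrite ler_wpM2l ?expR_ge0// elipschitz_dot.
by rewrite ler_wpM2l ?support_gauge_ball_ge0// gauge_elipschitz.
Qed.

Lemma near_normal_image_sub N A t : gauge N -> 0 < t ->
  gauge_normal_image N A `<=` near_normal_image N A t.
Proof.
move=> gN t0 u [su [v [sv Av e]]]; split=> //; exists v; split=> //; rewrite e.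
have hN : 0 < supp N v * N u.
  by rewrite mulr_gt0 ?support_gauge_ball_gt0 ?gauge_gt0 ?sphere_neq0.
by rewrite ltr_pMl// -expR0 ltr_expR.
Qed.

Lemma near_normal_image_le N A t s : gauge N -> t <= s ->
  near_normal_image N A t `<=` near_normal_image N A s.
Proof.
move=> gN ts u [su [v [sv Av lt]]]; split=> //; exists v; split=> //.
have vu0 : 0 < dot v u.
  rewrite -(pmulr_rgt0 _ (expR_gt0 t)); apply: le_lt_trans lt.
  by rewrite mulr_ge0 ?support_gauge_ball_ge0 ?gauge_ge0.
by apply: lt_le_trans lt _; rewrite ler_wpM2r ?ler_expR// ltW.
Qed.

(** Let [v] maximize [dot v u - supp N v * N u] on the compact set [S] intersected with [A]. The
    maximum is at most 0, and a negative one is excluded by near normals with [t k] small. *)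
Lemma bigcap_near_normal_image N A (t : nat -> R) : gauge N -> closed A ->
  (forall e, 0 < e -> exists k, t k <= e) ->
  \bigcap_k near_normal_image N A (t k) `<=` gauge_normal_image N A.
Proof.
move=> gN cA tk u hu; have su : sphere u by have [] := hu 0%N I.
split=> //; pose gg v := dot v u - supp N v * N u.
have [L hL] := support_gauge_ball_elipschitz gN.
have gl : elipschitz gg (enorm u + L * N u).
  move=> v w; have -> : gg v - gg w = (dot u v - dot u w) - (supp N v - supp N w) * N u.
    by rewrite /gg !(dotC u); ring.
  apply: le_trans (ler_normB _ _) _; rewrite [leRHS]mulrDl; apply: lerD; first exact: elipschitz_dot.
  by rewrite normrM (ger0_norm (gauge_ge0 gN u)) mulrAC ler_wpM2r ?gauge_ge0.
have cSA : compact (S `&` A).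
  by apply: compact_closedI => //; exact: compact_sphere.
have [|v [sv Av] vmax] := compact_elipschitz_max _ cSA gl.
  by have [_ [v [sv Av _]]] := hu 0%N I; exists v.
exists v; split=> //; apply/eqP; rewrite eq_le dot_le_support//= leNgt; apply/negP => lt.
pose dl := supp N v * N u - dot v u; have dl0 : 0 < dl by rewrite subr_gt0.
(* Since [dot w u <= 1], the factor [expR (t k) <= 1 + dl] raises [dot w u] by at most [dl]; the
   near normal [w] would thus beat the maximizer [v]. *)
have [k hk] : exists k, t k <= ln (1 + dl).
  by apply: tk; rewrite ln_gt0// ltrDl.
have [_ [w [sw Aw hw]]] := hu k I.
have := vmax w (conj sw Aw); rewrite /gg => hg.
have ek : expR (t k) <= 1 + dl.
  have p1 : 0 < 1 + dl by rewrite addr_gt0.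
  have -> : 1 + dl = expR (ln (1 + dl)) by rewrite lnK.
  by rewrite ler_expR.
have dw1 : dot w u <= 1.
  have := Cauchy_Schwarz w u; have -> : enorm w = 1 := sw; have -> : enorm u = 1 := su.
  by rewrite mulr1.
have wu0 : 0 < dot w u.
  rewrite -(pmulr_rgt0 _ (expR_gt0 (t k))); apply: le_lt_trans hw.
  by rewrite mulr_ge0 ?support_gauge_ball_ge0 ?gauge_ge0.
have : expR (t k) * dot w u <= dot w u + dl.
  apply: le_trans (_ : (1 + dl) * dot w u <= _); first by rewrite ler_wpM2r// ltW.
  by rewrite mulrDl mul1r lerD2l ler_piMr// ltW.
by rewrite /dl in hg *; lra.
Qed.

Lemma gauge_normal_image_measurable N A : gauge N -> closed A ->
  measurable (gauge_normal_image N A : set C).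
Proof.
move=> gN cA; pose t k : R := k.+1%:R^-1.
have t0 k : 0 < t k by rewrite invr_gt0.
have -> : gauge_normal_image N A = \bigcap_k near_normal_image N A (t k).
  apply/seteqP; split=> [u uA k _|]; first exact: near_normal_image_sub.
  apply: bigcap_near_normal_image => // e e0.
  exists (Num.truncn (1 / e)); rewrite /t -[leLHS]div1r; exact: div_truncn_le.
by apply: bigcapT_measurable => k; exact: near_normal_image_measurable.
Qed.

(** Continuity from above for the finite surface measure: the near normal images decrease to the
    normal image as [t] tends to 0. *)
Lemma near_normal_image_excess N A (e : R) : gauge N -> closed A -> 0 < e ->
  exists2 t, 0 < t <= e &
    (sigma (near_normal_image N A t `\` gauge_normal_image N A) <= e%:E)%E.
Proof.
move=> gN cA e0; pose t k : R := k.+1%:R^-1.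
have t0 k : 0 < t k by rewrite invr_gt0.
pose D k : set C := near_normal_image N A (t k) `\` gauge_normal_image N A.
have mD k : measurable (D k).
  apply: measurableD; first exact: near_normal_image_measurable.
  exact: gauge_normal_image_measurable.
have small x : 0 < x -> exists k, t k <= x.
  move=> x0; exists (Num.truncn (1 / x)); rewrite /t -[leLHS]div1r; exact: div_truncn_le.
have capD : \bigcap_k D k = set0.
  rewrite -subset0 => u hu; have [_] := hu 0%N I; apply.
  by apply: (bigcap_near_normal_image gN cA small) => k _; have [] := hu k I.
have ndD : nonincreasing_seq D.
  apply/nonincreasing_seqP => k; apply/subsetPset => u [h1 h2]; split=> //.
  apply: near_normal_image_le h1 => //.
  by rewrite /t lef_pV2 ?posrE// ler_nat.
have D0 : (sigma (D 0%N) < +oo)%E.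
  apply: le_lt_trans (spherical_measure_sphere_lty R n).
  by apply: le_hausdorff => u [[]].
have := nonincreasing_cvg_mu D0 mD (bigcapT_measurable mD) ndD.
rewrite capD measure0 => cv.
have [k0 _ hk0] : \forall k \near \oo, (sigma (D k) < e%:E)%E.
  apply: (cv [set y | (y < e%:E)%E]); apply: open_nbhs_nbhs; split.
    exact: open_ereal_lt_ereal.
  by rewrite /= lte_fin.
have [k1 hk1] := small e e0.
pose k := maxn k0 k1; exists (t k).
  rewrite t0/=; apply: le_trans hk1; rewrite /t lef_pV2 ?posrE// ler_nat ltnS leq_maxr//.
by apply/ltW; apply: hk0; rewrite /= leq_maxl.
Qed.

(* The competitor is the gauge dual to the support function of [N] divided by
   [expR t] on [A]. *)
Lemma maximizer_closed_perturbation N A t : gauge N ->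
  (forall N', gauge N' -> J N' <= J N) -> closed A -> 0 < t ->
  t * fine (mu ((@svec R n) @^-1` A)) <=
    m0 / p / total_energy p N * ((expR (p * t) - 1) * fine (energy p N (near_normal_image N A t))).
Proof.
move=> gN Nmax cA t0.
have [a [b [a0 b0 ab]]] := support_sphere_bounds gN.
pose ft v := (supp N v)^-1 * expR (if v \in A then t else 0).
have ftb v : sphere v -> b^-1 <= ft v <= a^-1 * expR t.
  move=> sv; have /andP[h1 h2] := ab v sv; have s0 := lt_le_trans a0 h1.
  have e1 : 1 <= expR t by rewrite -expR0 ler_expR ltW.
  have i0 : 0 <= (supp N v)^-1 by rewrite invr_ge0 ltW.
  have h3 : b^-1 <= (supp N v)^-1 by rewrite lef_pV2 ?posrE.
  have h4 : (supp N v)^-1 <= a^-1 by rewrite lef_pV2 ?posrE.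
  rewrite /ft; apply/andP; split.
    rewrite -[leLHS]mulr1; apply: ler_pM => //; first by rewrite invr_ge0 ltW.
    by case: ifP => _; rewrite ?expR0.
  apply: ler_pM => //; first exact: expR_ge0.
  by case: ifP => _; rewrite ?expR0.
have bi0 : 0 < b^-1 by rewrite invr_gt0.
have gNt := gauge_polar_gauge bi0 ftb.
set Nt := polar_gauge ft in gNt.
have dN v u : sphere v -> (supp N v)^-1 * dot v u <= N u.
  move=> sv; have s0 := support_gauge_ball_gt0 gN (sphere_neq0 sv).
  by rewrite mulrC ler_pdivrMr// mulrC dot_le_support.
have mA : measurable ((@svec R n) @^-1` A : set (borel_sphere R n)) by exact: borel_closed_svec.
have L : log_support mu Nt <= log_support mu N - t * fine (mu ((@svec R n) @^-1` A)).
  have := @log_support_add_indic R n mu N 0 (- t) _ gN mA.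
  rewrite mul0r add0r mulNr => <-.
  apply: log_support_le => //; first exact: integrable_log_support_add.
  move=> v; have sv := sphere_svec v; rewrite add0r.
  have h1 := support_polar_gauge_le bi0 ftb sv; rewrite -/Nt in h1.
  have h2 : 0 < supp N (svec v) by exact: (support_gauge_ball_gt0 gN (sphere_neq0 sv)).
  have -> : ln (supp N (svec v)) + - t * \1_(svec (n:=n) @^-1` A) v = ln (ft (svec v))^-1.
    rewrite /ft invfM invrK lnM ?posrE ?invr_gt0 ?expR_gt0// lnV ?posrE ?expR_gt0// expRK.
    rewrite indicE mulNr; congr (_ - _).
    have -> : (v \in svec (n:=n) @^-1` A) = (svec v \in A).
      by apply/idP/idP; rewrite !inE.
    by case: ifP; rewrite ?mulr1 ?mulr0.
  rewrite ler_ln ?posrE//; first exact: (support_gauge_ball_gt0 gNt (sphere_neq0 sv)).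
  by rewrite invr_gt0 mulr_gt0 ?invr_gt0 ?expR_gt0.
set B := near_normal_image N A t.
have I : total_energy p Nt <= total_energy p N + (expR (p * t) - 1) * fine (energy p N B).
  have mB : measurable (B : set C) by exact: near_normal_image_measurable.
  have BS : B `<=` S by move=> u [].
  have fB : energy p N B \is a fin_num.
    rewrite ge0_fin_numE; last exact: power_integral_ge0.
    exact: energy_lty.
  rewrite -lee_fin EFinD EFinM fineK//; apply: total_energy_perturb => //.
    move=> u su; apply: (polar_gauge_le bi0 ftb) => v sv.
    rewrite /ft mulrAC mulrC.
    apply: (@le_trans _ _ (expR (if v \in A then t else 0) * N u)).
      by rewrite ler_wpM2l ?expR_ge0// dN.
    rewrite ler_wpM2r ?gauge_ge0// ler_expR; case: ifP => // _; exact: ltW.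
  move=> u su nB; apply: (polar_gauge_le bi0 ftb) => v sv; rewrite /ft.
  case: ifPn => [/set_mem Av|_]; last by rewrite expR0 mulr1 dN.
  rewrite leNgt; apply/negP => lt; apply: nB; split=> //; exists v; split=> //.
  have s0 := support_gauge_ball_gt0 gN (sphere_neq0 sv).
  by rewrite mulrC -ltr_pdivlMr// mulrC mulrA.
have I0 := total_energy_gt0 p0 gN; have It0 := total_energy_gt0 p0 gNt.
have := Nmax Nt gNt; rewrite /functional => hJ.
have mp : 0 <= m0 / p by rewrite divr_ge0 ?total_mass_ge0// ltW.
(* Comparing [J Nt <= J N] bounds [t * mu A] by [m0 / p] times this difference of logarithms, which
   [ln r <= r - 1] makes linear in the energy gained. *)
have hln : ln (total_energy p Nt) - ln (total_energy p N) <=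
    (expR (p * t) - 1) * fine (energy p N B) / total_energy p N.
  rewrite -ln_div ?posrE//.
  have r0 : 0 < total_energy p Nt / total_energy p N by rewrite divr_gt0.
  set r := _ / _ in r0 *; have rE : r = 1 + (r - 1) by rewrite subrKC.
  rewrite [in leLHS]rE; apply: le_trans (le_ln1Dx _) _; first by lra.
  have -> : r - 1 = (total_energy p Nt - total_energy p N) / total_energy p N.
    by rewrite mulrBl divff// gt_eqF.
  by rewrite ler_pM2r ?invr_gt0// lerBlDl.
have := ler_wpM2l mp hln; rewrite mulrBr => hm.
have -> : m0 / p / total_energy p N * ((expR (p * t) - 1) * fine (energy p N B)) =
  m0 / p * ((expR (p * t) - 1) * fine (energy p N B) / total_energy p N) by ring.
move: L hJ hm.
move: (m0 / p * ln (total_energy p Nt)) (m0 / p * ln (total_energy p N)) (m0 / p * (_ * _ / _)).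
move: (log_support _ _) (log_support _ _) (t * _) => *; lra.
Qed.

(** Divide the perturbation inequality by [t] and let [t] tend to 0: [(e^(p t) - 1) / (p t)] is at
    most [e^(p t)], and the near normal image exceeds the normal image by small measure, hence by
    small energy. *)
Lemma maximizer_closed_le N A : gauge N ->
  (forall N', gauge N' -> J N' <= J N) -> closed A ->
  (mu ((@svec R n) @^-1` A) <= (m0 / total_energy p N)%:E * energy p N (gauge_normal_image N A))%E.
Proof.
move=> gN Nmax cA; set G := gauge_normal_image N A.
have mG : measurable (G : set C) by exact: gauge_normal_image_measurable.
have GS : G `<=` S by move=> u [].
have I0 := total_energy_gt0 p0 gN.
have fG : energy p N G \is a fin_num.
  rewrite ge0_fin_numE; last exact: power_integral_ge0.
  exact: energy_lty.
have mA : measurable ((@svec R n) @^-1` A : set (borel_sphere R n)) by exact: borel_closed_svec.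
have fA : mu ((@svec R n) @^-1` A) \is a fin_num by exact: fin_num_measure.
rewrite -(fineK fA) -(fineK fG) -EFinM lee_fin.
set x := fine _; set y := fine _.
have y0 : 0 <= y by apply: fine_ge0; exact: power_integral_ge0.
have mI : 0 <= m0 / total_energy p N by rewrite divr_ge0 ?total_mass_ge0// ltW.
have s0 : 0 <= gauge_size N `^ p by exact: powR_ge0.
have key (e : R) : 0 < e -> x <= m0 / total_energy p N * (expR (p * e) * (y + gauge_size N `^ p * e)).
  move=> e0; have [t /andP[t0 te] ht] := near_normal_image_excess gN cA e0.
  set B := near_normal_image N A t in ht.
  have mB : measurable (B : set C) by exact: near_normal_image_measurable.
  have BS : B `<=` S by move=> u [].
  have mD : measurable (B `\` G : set C) by exact: measurableD.
  have EB : (energy p N B <= (y + gauge_size N `^ p * e)%:E)%E.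
    have -> : B = G `|` (B `\` G) by rewrite setDUK//; exact: near_normal_image_sub.
    have dis : [disjoint G & B `\` G] by apply/disj_setPS => u [? []].
    rewrite /energy (power_integral_setU sigma p (nonneg_measurable_gauge gN) mG mD dis).
    rewrite EFinD fineK//; apply: leeD; first exact: lexx.
    have DS u : (B `\` G) u -> N u <= gauge_size N.
      move=> [/BS su _]; have := gauge_le_enorm gN u.
      by have -> : enorm u = 1 := su; rewrite mulr1.
    apply: le_trans (power_integral_le sigma p0 (nonneg_measurable_gauge gN) mD (ltW (gauge_size_gt0 gN)) DS) _.
    by rewrite EFinM lee_wpmul2l// lee_fin.
  have fB : energy p N B \is a fin_num.
    rewrite ge0_fin_numE; last exact: power_integral_ge0.
    exact: energy_lty.
  have EB' : fine (energy p N B) <= y + gauge_size N `^ p * e by rewrite -lee_fin fineK.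
  have B0 : 0 <= fine (energy p N B) by apply: fine_ge0; exact: power_integral_ge0.
  have := maximizer_closed_perturbation gN Nmax cA t0; rewrite -/x -/B.
  (* This is [1 - x <= e^(- x)] multiplied by [e^x], at [x = p * t]. *)
  have pt : expR (p * t) - 1 <= p * t * expR (p * t).
    have := expR_ge1Dx (- (p * t)); have Ep := expR_gt0 (p * t); rewrite expRN.
    by rewrite -[leRHS]mul1r ler_pdivlMr// mulrBl mul1r; lra.
  move=> h1.
  have h2 : t * x <= t * (m0 / total_energy p N * (expR (p * t) * fine (energy p N B))).
    apply: le_trans h1 _.
    apply: (@le_trans _ _ (m0 / p / total_energy p N * (p * t * expR (p * t) * fine (energy p N B)))).
      rewrite ler_wpM2l ?ler_wpM2r//.
      by rewrite !divr_ge0 ?total_mass_ge0// ltW.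
    rewrite le_eqVlt; apply/orP; left; apply/eqP; field.
    by rewrite !gt_eqF.
  rewrite ler_pM2l// in h2; apply: le_trans h2 _.
  rewrite ler_wpM2l//; apply: ler_pM; [exact: expR_ge0|exact: B0| |exact: EB'].
  by rewrite ler_expR ler_wpM2l// ltW.
set c := m0 / total_energy p N in mI key *; set s := gauge_size N `^ p in s0 key.
clearbody c s x y; apply/ler_addgt0Pr => d d0.
(* For [eta <= 1], [(1 + eta) * (y + s * eta)] exceeds [y] by at most [eta * (y + 2 * s)]; the [+ 1]
   keeps [D] positive. *)
pose D := c * (y + 2 * s) + 1.
have D0 : 0 < D by rewrite ltr_wpDl// mulr_ge0// addr_ge0// mulr_ge0.
pose eta := Num.min 1 (d / D).
have eta0 : 0 < eta by rewrite lt_min ltr01 divr_gt0.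
have eta1 : eta <= 1 by rewrite ge_min lexx.
have etaD : eta * D <= d by rewrite -ler_pdivlMr// ge_min lexx orbT.
have p1 : 0 < 1 + eta by rewrite addr_gt0.
have l0 : 0 < ln (1 + eta) / p by rewrite divr_gt0// ln_gt0// ltrDl.
pose e := Num.min eta (ln (1 + eta) / p).
have e0 : 0 < e by rewrite lt_min eta0.
have ee : e <= eta by rewrite ge_min lexx.
have ep : expR (p * e) <= 1 + eta.
  have -> : 1 + eta = expR (ln (1 + eta)) by rewrite lnK.
  by rewrite ler_expR mulrC -ler_pdivlMr// ge_min lexx orbT.
apply: le_trans (key e e0) _.
have h1 : expR (p * e) * (y + s * e) <= (1 + eta) * (y + s * eta).
  apply: ler_pM; [exact: expR_ge0| |exact: ep|by rewrite lerD2l ler_wpM2l].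
  by rewrite addr_ge0// mulr_ge0// ltW.
apply: le_trans (ler_wpM2l mI h1) _.
have h2 : (1 + eta) * (y + s * eta) <= y + eta * (y + 2 * s).
  have : eta * (s * eta) <= eta * s.
    by rewrite ler_wpM2l ?(ltW eta0)// -[leRHS]mulr1 ler_wpM2l.
  by rewrite !mulrDl !mulrDr; lra.
apply: le_trans (ler_wpM2l mI h2) _.
rewrite mulrDr lerD2l mulrCA; apply: le_trans etaD.
by rewrite ler_wpM2l ?(ltW eta0)// lerDl.
Qed.

End EulerLagrange.

(** Complements and equal finite mass give [nu <= mu] on open sets. Exhausting an open set by closed
    ones gives [mu <= nu] there too, and open sets are a generating family stable under
    intersection. *)
Lemma borel_sphere_measure_eq (R : realType) (n : nat)
    (mu nu : {measure set (borel_sphere R n) -> \bar R}) :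
  (mu setT < +oo)%E -> mu setT = nu setT ->
  (forall A, closed A -> (mu ((@svec R n) @^-1` A) <= nu ((@svec R n) @^-1` A))%E) ->
  forall eta, measurable eta -> mu eta = nu eta.
Proof.
move=> muT munuT le eta meta.
have nuT : (nu setT < +oo)%E by rewrite -munuT.
pose X := borel_sphere R n.
have muI A : measurable (A : set X) -> (mu A < +oo)%E.
  by move=> mA; apply: le_lt_trans muT; apply: le_measure; rewrite ?inE.
have nuI A : measurable (A : set X) -> (nu A < +oo)%E.
  by move=> mA; apply: le_lt_trans nuT; apply: le_measure; rewrite ?inE.
have mC (m : {measure set X -> \bar R}) A : (m setT < +oo)%E -> measurable (A : set X) ->
    (m (~` A) = m setT - m A)%E.
  move=> mT mA; rewrite -setTD measureD ?setTI//; exact: measurableT.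
apply: (@measure_unique _ R (borel_sphere R n) (@open (sphere_type R n)) (fun=> setT)) => //.
- by move=> A B oA oB; exact: openI.
- by move=> _; exact: openT.
- by rewrite bigcup_const.
move=> _ /open_sphere_typeP [U oU <-].
have mU := borel_open_svec oU.
have cU : closed (~` U) by exact: open_closedC.
apply/le_anti/andP; split; last first.
  have := le _ cU; rewrite preimage_setC !mC// munuT => h.
  have fmu : mu ((@svec R n) @^-1` U) \is a fin_num by rewrite ge0_fin_numE// muI.
  have fnu : nu ((@svec R n) @^-1` U) \is a fin_num by rewrite ge0_fin_numE// nuI.
  have fT : nu setT \is a fin_num by rewrite ge0_fin_numE.
  move: h; rewrite -(fineK fmu) -(fineK fnu) -(fineK fT) -!EFinB !lee_fin.
  by move: (fine _) (fine _) (fine _) => a b c; lra.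
have [phi [phiL phi0 phiZ]] := closed_elipschitz_zero cU.
pose F k : set 'rV[R]_n.+1 := [set x | k.+1%:R^-1 <= phi x].
have cF k : closed (F k).
  have -> : F k = ~` [set x | phi x < k.+1%:R^-1].
    by apply/seteqP; split => x; rewrite /F /= leNgt => /negP.
  apply: open_closedC.
  have -> : [set x | phi x < k.+1%:R^-1] = [set x | 0 < k.+1%:R^-1 - phi x].
    by apply/seteqP; split => x /=; rewrite subr_gt0.
  apply: open_gt_continuous; apply: (@elipschitz_continuous _ _ _ 1) => x y.
  by rewrite opprB addrC addrA subrK distrC.
have mF k : measurable ((@svec R n) @^-1` F k : set X) by exact: borel_closed_svec.
have UF : (@svec R n) @^-1` U = \bigcup_k (@svec R n) @^-1` F k.
  apply/seteqP; split => v /=.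
    move=> Uv; have phv : 0 < phi (svec v).
      rewrite lt_neqAle phi0 andbT eq_sym; apply/eqP => /phiZ; exact.
    exists (Num.truncn (1 / phi (svec v))) => //=; rewrite /F /= -[leLHS]div1r; exact: div_truncn_le.
  move=> [k _] /=; rewrite /F /= => h; apply: contrapT => /phiZ e.
  by move: h; rewrite e leNgt invr_gt0 ltr0n.
have ndF : nondecreasing_seq (fun k => (@svec R n) @^-1` F k : set X).
  apply/nondecreasing_seqP => k; apply/subsetPset => v; rewrite /= /F /=.
  by apply: le_trans; rewrite lef_pV2 ?posrE// ler_nat.
have mUF : measurable (\bigcup_k (@svec R n) @^-1` F k : set X) by rewrite -UF.
have cv := nondecreasing_cvg_mu (mu := mu) mF mUF ndF; rewrite -UF in cv.
rewrite -(cvg_lim _ cv)//; apply: lime_le; first by apply/cvg_ex; eexists; exact: cv.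
apply: nearW => k /=; apply: le_trans (le _ (cF k)) _.
apply: le_measure; rewrite ?inE//.
by rewrite UF => v Fv; exists k.
Qed.

Lemma power_integral_negligible d (X : measurableType d) (R : realType)
    (sigma : {measure set X -> \bar R}) p f (A D : set X) : nonneg_measurable f ->
  measurable A -> measurable D -> sigma D = 0%E ->
  power_integral sigma p f A = power_integral sigma p f (A `\` D).
Proof.
move=> mf mA mD D0; apply: ge0_negligible_integral => //; first exact: measurable_powR_EFin.
by move=> u _; rewrite lee_fin powR_ge0.
Qed.

(** * Construction of the convex body *)

Section Solution.
Variables (R : realType) (n : nat).
Local Notation T := ('rV[R]_n.+1).
Local Notation C := (caratheodory_type (hausdorff_outer R n.+1 n)).
Local Notation S := (@sphere R n).
Local Notation sigma := (spherical_measure R n).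
Local Notation supp N := (support_function (gauge_ball N)).
Implicit Types (N : T -> R) (A : set T).

(* Passing to the Wulff shape of the support function of [N0] does not lower the
   functional, and a Wulff shape has an outer normal at each boundary point, since
   the supremum defining its gauge is attained. *)
Lemma maximizer_with_normals p (p0 : 0 < p)
    (mu : {finite_measure set (borel_sphere R n) -> \bar R}) N0 : gauge N0 ->
  (forall N, gauge N -> functional p mu N <= functional p mu N0) ->
  exists N, [/\ gauge N, (forall N', gauge N' -> functional p mu N' <= functional p mu N) &
    forall u, sphere u -> exists v, [/\ sphere v & dot v u = supp N v * N u]].
Proof.
move=> gN0 Nmax.
have [a [b [a0 b0 ab]]] := support_sphere_bounds gN0.
pose f v := (supp N0 v)^-1.
have fb v : sphere v -> b^-1 <= f v <= a^-1.
  move=> sv; have /andP[h1 h2] := ab v sv; have s0 := lt_le_trans a0 h1.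
  by apply/andP; split; rewrite lef_pV2 ?posrE.
have bi0 : 0 < b^-1 by rewrite invr_gt0.
have gN := gauge_polar_gauge bi0 fb.
set N := polar_gauge f in gN.
have NN0 x : N x <= N0 x.
  apply: (polar_gauge_le bi0 fb) => v sv; have s0 := support_gauge_ball_gt0 gN0 (sphere_neq0 sv).
  by rewrite mulrC ler_pdivrMr// mulrC dot_le_support.
have sle v : sphere v -> supp N v <= supp N0 v.
  by move=> sv; rewrite -[leRHS]invrK; exact: (support_polar_gauge_le bi0 fb).
have sge v : sphere v -> supp N0 v <= supp N v.
  move=> sv; rewrite -[leRHS]mul1r; apply: support_gauge_ball_mono => // x.
  by rewrite mul1r.
exists N; split=> // [N' gN'|u su].
  by apply: le_trans (Nmax N' gN') _; exact: functional_mono.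
pose t k : R := k.+1%:R^-1.
(* Vectors nearly attaining the supremum that defines [N u] put [u] in every near normal image, and
   compactness then yields an exact normal. This uses that [N] and [N0] have the same support
   function on the sphere. *)
have : gauge_normal_image N setT u.
  apply: (@bigcap_near_normal_image R n N setT t) => //.
  - move=> e e0; exists (Num.truncn (1 / e)); rewrite /t -[leLHS]div1r; exact: div_truncn_le.
  - move=> k _; split=> //.
    have Nu := gauge_gt0 gN (sphere_neq0 su).
    have lt : expR (- t k) * N u < N u.
      by rewrite gtr_pMl// -expR0 ltr_expR oppr_lt0 invr_gt0.
    have [_ [v sv <-] hv] := sup_gt (polar_gauge_has_sup bi0 fb u).1 lt.
    exists v; split=> //.
    have s0 := support_gauge_ball_gt0 gN0 (sphere_neq0 sv).
    have -> : supp N v = supp N0 v by apply/le_anti; rewrite sle// sge.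
    move: hv; rewrite expRN /f -[_ * dot v u]mulrC ltr_pdivlMr//.
    rewrite -(ltr_pM2l (expR_gt0 (t k))) !mulrA mulfV ?gt_eqF ?expR_gt0// mul1r.
    by rewrite [N u * _]mulrC.
by move=> [_ [v [sv _ e]]]; exists v.
Qed.

Lemma reverse_radial_gauss_image_gauge N (eta : set (sphere_type R n)) : gauge N ->
  reverse_radial_gauss_image (gauge_ball N) eta =
  [set u | sphere u /\ exists2 v, eta v & dot (svec v) u = supp N (svec v) * N u].
Proof.
move=> gN; apply/seteqP; split=> u [su [v ev h]]; split=> //; exists v => //.
  exact/(outer_normal_gauge_ball gN _ (sphere_neq0 su)).
exact/(outer_normal_gauge_ball gN _ (sphere_neq0 su)).
Qed.

Lemma reverse_radial_gauss_image_svec N A : gauge N ->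
  reverse_radial_gauss_image (gauge_ball N) ((@svec R n) @^-1` A) = gauge_normal_image N A.
Proof.
move=> gN; rewrite reverse_radial_gauss_image_gauge//; apply/seteqP; split=> u [su].
  by move=> [v Av e]; split=> //; exists (svec v); split=> //; exact: sphere_svec.
by move=> [v [/svec_surj[w <-] Av e]]; split=> //; exists w.
Qed.

(** [alpha] comes from the axiom of choice with no regularity. Its preimages differ from Gauss
    images by sets of directions with two normals, which are null. *)
Lemma normal_selection N : gauge N ->
  (forall u, sphere u -> exists v, [/\ sphere v & dot v u = supp N v * N u]) ->
  exists2 alpha : C -> borel_sphere R n, measurable_fun (S : set C) alpha &
    forall eta, S `&` alpha @^-1` eta `<=` reverse_radial_gauss_image (gauge_ball N) eta /\
      hausdorff n (reverse_radial_gauss_image (gauge_ball N) eta `\` (S `&` alpha @^-1` eta)) = 0%E.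
Proof.
move=> gN hn.
have /choice[alpha halpha] : forall u : T, exists v : sphere_type R n,
    sphere u -> dot (svec v) u = supp N (svec v) * N u.
  move=> u; have [su|nsu] := pselect (sphere u); last by exists point.
  by have [v [/svec_surj[w <-] e]] := hn u su; exists w.
have sub eta : S `&` alpha @^-1` eta `<=` reverse_radial_gauss_image (gauge_ball N) eta.
  rewrite reverse_radial_gauss_image_gauge// => u [su eu]; split=> //.
  by exists (alpha u) => //; exact: halpha.
have null eta :
    hausdorff n (reverse_radial_gauss_image (gauge_ball N) eta `\` (S `&` alpha @^-1` eta)) = 0%E.
  apply/eqP; rewrite eq_le hausdorff_ge0 andbT -(normal_unique_ae gN); apply: le_hausdorff.
  rewrite reverse_radial_gauss_image_gauge// => u [[su [v ev e]] nu]; split=> //.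
  exists (svec v), (svec (alpha u)); split=> //; try exact: sphere_svec.
    exact: halpha.
  by apply/eqP => /svec_inj ve; apply: nu; split=> //=; rewrite -ve.
(* The Gauss image of a closed set is measurable, and removing a null set keeps it so by
   completeness of the Caratheodory sigma-algebra. *)
have mcl A : closed A -> measurable (S `&` alpha @^-1` ((@svec R n) @^-1` A) : set C).
  move=> cA; set B := S `&` _; set G := reverse_radial_gauss_image (gauge_ball N) ((@svec R n) @^-1` A).
  have -> : B = G `\` (G `\` B) by rewrite setDD setIidr//; exact: sub.
  apply: measurableD; last by apply: measurable_null_cara; exact: null.
  by rewrite /G reverse_radial_gauss_image_svec//; exact: gauge_normal_image_measurable.
exists alpha => // mS.
apply: (@measurability _ _ C (borel_sphere R n) S alpha (@open (sphere_type R n))) => //.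
move=> _ [_ /open_sphere_typeP[U oU <-] <-].
have -> : S `&` alpha @^-1` ((@svec R n) @^-1` U) =
    S `\` (S `&` alpha @^-1` ((@svec R n) @^-1` (~` U))).
  apply/seteqP; split=> u /=; first by move=> [su Uu]; split=> // -[_]; apply.
  by move=> [su nU]; split=> //; apply: contrapT => h; apply: nU.
by apply: measurableD => //; apply: mcl; exact: open_closedC.
Qed.

Lemma dual_curvature_measure_gauge p N eta : gauge N ->
  dual_curvature_measure (- p) (gauge_ball N) eta =
  ((n.+1%:R^-1)%:E * energy p N (reverse_radial_gauss_image (gauge_ball N) eta))%E.
Proof.
move=> gN; rewrite /dual_curvature_measure /energy /power_integral; congr (_ * _)%E.
apply: eq_integral => u /set_mem [su _]; congr (_%:E).
have u0 := sphere_neq0 su.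
rewrite (radial_gauge_ball gN u0) -powR_inv1 ?gauge_ge0// -powRrM.
by rewrite mulrNN mul1r.
Qed.

Lemma energy_null_diff p N (A B : set C) : gauge N -> measurable B -> B `<=` A ->
  hausdorff n (A `\` B) = 0%E -> energy p N A = energy p N B.
Proof.
move=> gN mB BA AB0; have mD := measurable_null_cara AB0.
have mA : measurable A by rewrite -(setDUK BA); exact: measurableU.
rewrite /energy (power_integral_negligible (sigma:=sigma) p (nonneg_measurable_gauge gN) mA mD AB0).
by rewrite setDD (setIidr BA).
Qed.

Lemma reverse_radial_gauss_image_scale N c eta : gauge N -> 0 < c ->
  reverse_radial_gauss_image (gauge_ball (fun x => c * N x)) eta =
  reverse_radial_gauss_image (gauge_ball N) eta.
Proof.
move=> gN c0; rewrite !reverse_radial_gauss_image_gauge//; last exact: gauge_scale_gauge.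
apply/seteqP; split=> u [su [v ev e]]; split=> //; exists v => //; move: e;
  by rewrite support_gauge_ball_scale// mulrACA mulVf ?gt_eqF// mul1r.
Qed.

Lemma dual_curvature_measure_exists (q : R)
    (mu : {finite_measure set (borel_sphere R n) -> \bar R}) :
  q < 0 -> mu [set: borel_sphere R n] <> 0%E ->
  ~ (exists w : sphere_type R n, concentrated_in mu (closed_hemisphere w)) ->
  exists K : set T, [/\ convex_body K, K° 0 &
    forall eta : set (borel_sphere R n), measurable eta -> mu eta = dual_curvature_measure q K eta].
Proof.
move=> q0 mu0 nconc; pose p := - q; have p0 : 0 < p by rewrite oppr_gt0.
have -> : q = - p by rewrite opprK.
clearbody p.
have [N0 gN0 N0max] := functional_maximizer p0 nconc.
have [N [gN Nmax Nn]] := maximizer_with_normals p0 gN0 N0max.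
have [alpha malpha halpha] := normal_selection gN Nn.
have I0 := total_energy_gt0 p0 gN.
have muTE : mu setT = (total_mass mu)%:E by rewrite total_massE fineK// fin_num_measure.
have m0 : 0 < total_mass mu.
  by rewrite lt_neqAle total_mass_ge0 andbT eq_sym; apply/eqP => e; apply: mu0; rewrite muTE e.
(* The constant of the inequality on closed sets; [k] times the energy over the whole sphere is
   exactly the mass of [mu]. *)
pose k := total_mass mu / total_energy p N; have k0 : 0 < k by rewrite divr_gt0.
have root (x : R) : 0 < x -> 0 < x `^ p^-1 /\ (x `^ p^-1) `^ p = x.
  move=> x0; split; first exact: powR_gt0.
  by rewrite -powRrM mulVf ?gt_eqF// powRr1// ltW.
have [c0 cp] := root _ k0; set c := k `^ p^-1 in c0 cp.
(* [c ^ p = k] puts the constant into the density of [nu], while [s ^ p = n.+1 * k] also cancels the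
   factor [1 / n.+1] of the dual curvature measure; dilation leaves the Gauss image unchanged. *)
have nk0 : 0 < n.+1%:R * k by rewrite mulr_gt0.
have [s0 sp] := root _ nk0; set s := _ `^ p^-1 in s0 sp.
have gs := gauge_scale_gauge gN s0; have gc := gauge_scale_gauge gN c0.
exists (gauge_ball (fun x => s * N x)); split.
- exact: convex_body_gauge_ball.
- exact: gauge_ball_interior.
have mN := nonneg_measurable_gauge gN; have mcN := nonneg_measurable_gauge gc.
pose B eta : set C := S `&` alpha @^-1` eta.
have mS : measurable (S : set C) by exact: measurable_sphere_cara.
have mB eta : measurable eta -> measurable (B eta) by exact: malpha.
have mg : measurable_fun (S : set C) (fun u : C => ((c * N u) `^ p)%:E).
  exact: (measurable_powR_EFin p mcN).
have g0 (u : C) : (0 <= ((c * N u) `^ p)%:E)%E by rewrite lee_fin powR_ge0.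
pose nu : {measure set (borel_sphere R n) -> \bar R} := push_density sigma mS mg g0 malpha.
have nuE eta : measurable eta ->
    nu eta = (k%:E * energy p N (reverse_radial_gauss_image (gauge_ball N) eta))%E.
  move=> meta; have [sub null] := halpha eta.
  rewrite (energy_null_diff p gN (mB _ meta) sub null) -[in RHS]cp.
  exact: (power_integral_scale sigma p mN (mB _ meta) c0).
have curvE (eta : set (borel_sphere R n)) : measurable eta ->
    dual_curvature_measure (- p) (gauge_ball (fun x => s * N x)) eta = nu eta.
  move=> meta; rewrite (nuE _ meta) (dual_curvature_measure_gauge p _ gs).
  rewrite (reverse_radial_gauss_image_scale _ gN s0).
  have [sub null] := halpha eta.
  rewrite (energy_null_diff p gN (mB _ meta) sub null) (energy_null_diff p gs (mB _ meta) sub null).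
  rewrite /energy (power_integral_scale sigma p mN (mB _ meta) s0) sp muleA -EFinM.
  by rewrite mulKf// pnatr_eq0.
move=> eta meta; rewrite curvE//.
apply: borel_sphere_measure_eq meta; first by rewrite ltey_eq fin_num_measure.
- apply: (etrans muTE); rewrite (nuE _ measurableT).
  rewrite -[X in reverse_radial_gauss_image _ X](preimage_setT (@svec R n)).
  rewrite (reverse_radial_gauss_image_svec _ gN).
  have -> : gauge_normal_image N setT = S.
    apply/seteqP; split=> [u []//|u su]; split=> //.
    by have [v [sv e]] := Nn u su; exists v.
  by rewrite total_energyE// -EFinM /k divfK// gt_eqF.
- move=> A cA; rewrite nuE ?reverse_radial_gauss_image_svec//; last exact: borel_closed_svec.
  exact: maximizer_closed_le.
Qed.

End Solution.

(** * Supporting hyperplanes and necessity *)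

Section Separation.
Variables (R : realType) (n : nat).
Local Notation T := ('rV[R]_n.+1).
Variable K : set T.
Hypotheses (convK : convex_set K) (cptK : compact K).

Lemma convex_set_segment x y (t : R) : 0 <= t -> t <= 1 -> K x -> K y -> K (x + t *: (y - x)).
Proof.
move=> t0 t1 xK yK; have := convK (Itv01 t0 t1) (mem_set yK) (mem_set xK).
rewrite inE /conv /=; congr (K _); rewrite /unstable.onem scalerBr scalerBl scale1r.
by rewrite addrCA addrA addrC.
Qed.

(* [v] is the direction from the nearest point of [K] to [y]. *)
Lemma compact_convex_separation y : K !=set0 -> ~ K y ->
  exists2 v, sphere v & forall z, K z -> dot v z <= dot v y.
Proof.
move=> K0 nKy.
have [|x Kx xmin] := @compact_elipschitz_min _ _ K (fun z => enorm (z - y)) 1 K0 cptK.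
  move=> a b; rewrite mul1r; apply: le_trans (ler_enorm_dist _ _) _.
  by rewrite opprB addrA subrK.
have d0 : y - x != 0 by rewrite subr_eq0; apply/eqP => e; apply: nKy; rewrite e.
set d := y - x in d0.
have key z : K z -> dot d (z - x) <= 0.
  move=> Kz; set w := z - x; rewrite leNgt; apply/negP => dw.
  have D0 : 0 < dot d w + dot w w by rewrite ltr_wpDr ?dot_ge0.
  (* At most 1, and below the minimizer [dot d w / dot w w] of the squared distance along the
     segment. As [t * dot w w <= dot d w], that squared distance drops by at least [t * dot d w]. *)
  pose t := dot d w / (dot d w + dot w w).
  have t0 : 0 < t by rewrite divr_gt0.
  have t1 : t <= 1 by rewrite ler_pdivrMr// mul1r lerDl dot_ge0.
  have := xmin _ (convex_set_segment (ltW t0) t1 Kx Kz).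
  have -> : x + t *: (z - x) - y = - (d - t *: w).
    by rewrite opprB /d /w opprB addrAC [x - y]addrC addrC.
  have -> : x - y = - d by rewrite opprB.
  rewrite !enormN -ler_sqr ?nnegrE ?enorm_ge0// !sqr_enorm.
  have sq (a b : T) s : dot (a - s *: b) (a - s *: b) = dot a a - 2 * (s * dot a b) + s * (s * dot b b).
    by rewrite dotBl !dotBr !dotZl !dotZr (dotC b a); ring.
  rewrite sq.
  have tw : t * (dot d w + dot w w) = dot d w by rewrite divfK// gt_eqF.
  have ww := dot_ge0 w.
  have h1 : t * (t * dot w w) <= t * dot d w.
    by rewrite ler_wpM2l ?(ltW t0)//; rewrite -tw mulrDr lerDr mulr_ge0// ltW.
  have h2 : 0 < t * dot d w by rewrite mulr_gt0.
  by move: h1 h2; move: (t * dot d w) (t * (t * _)) (dot d d) => *; lra.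
exists ((enorm d)^-1 *: d); first exact: sphere_normalize.
move=> z Kz; rewrite !dotZl ler_wpM2l ?invr_ge0 ?enorm_ge0//.
have := key z Kz; rewrite dotBr subr_le0 => /le_trans; apply.
by rewrite -subr_ge0 -dotBr dot_ge0.
Qed.

Hypothesis intK : K° 0.

Let inner_ball : exists2 r, 0 < r & forall x, enorm x < r -> K x.
Proof.
have [r r0 h] := (nbhs_enormP 0 K).1 intK; exists r => // x xr.
by apply: h; rewrite sub0r enormN.
Qed.

Let K0 : K !=set0.
Proof. by exists 0; exact: nbhs_singleton. Qed.

Let outer_ball : exists2 M, 0 < M & forall x, K x -> enorm x <= M.
Proof.
have [c Kc h] := compact_elipschitz_max K0 cptK (@elipschitz_enorm R n.+1).
exists (enorm c + 1); first by rewrite ltr_wpDl ?enorm_ge0.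
by move=> x Kx; apply: le_trans (h x Kx) _; rewrite lerDl.
Qed.

Lemma support_has_sup v : has_sup [set dot v x | x in K].
Proof.
have [M _ hM] := outer_ball; split; first by have [x Kx] := K0; exists (dot v x); exists x.
exists (enorm v * M) => _ [x Kx <-]; apply: le_trans (Cauchy_Schwarz _ _) _.
by rewrite ler_wpM2l ?enorm_ge0// hM.
Qed.

Lemma dot_le_support_function v x : K x -> dot v x <= support_function K v.
Proof. by move=> Kx; apply: ub_le_sup; [have [] := support_has_sup v|exists x]. Qed.

Lemma support_function_le v c : (forall x, K x -> dot v x <= c) -> support_function K v <= c.
Proof.
move=> h; apply: ge_sup; first by have [] := support_has_sup v.
by move=> _ [x Kx <-]; exact: h.
Qed.

Lemma support_function_elipschitz : exists L, elipschitz (support_function K) L.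
Proof.
have [M _ hM] := outer_ball; exists M.
have le v w : support_function K v <= support_function K w + M * enorm (v - w).
  apply: support_function_le => x Kx; rewrite -[v in leLHS](subrK w) dotDl addrC.
  apply: lerD; first exact: dot_le_support_function.
  apply: le_trans (Cauchy_Schwarz _ _) _; rewrite mulrC.
  by rewrite ler_wpM2r ?enorm_ge0// hM.
move=> v w; rewrite ler_norml; have := le v w; have := le w v; rewrite (enormBC w v).
by move: (M * _) => z h1 h2; apply/andP; split; lra.
Qed.

Lemma radial_function_bounds : exists r M, [/\ 0 < r, 0 < M & forall u, sphere u ->
  r <= radial_function K u <= M].
Proof.
have [r r0 hr] := inner_ball; have [M M0 hM] := outer_ball.
exists (r / 2), M; split=> //; first by rewrite divr_gt0.
move=> u su; have eu : enorm u = 1 := su.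
have ub : ubound [set l : R | 0 < l /\ K (l *: u)] M.
  by move=> l [l0 /hM]; rewrite enormZ eu mulr1 gtr0_norm.
have hl : [set l : R | 0 < l /\ K (l *: u)] (r / 2).
  split; first by rewrite divr_gt0.
  by apply: hr; rewrite enormZ eu mulr1 gtr0_norm ?divr_gt0//; lra.
apply/andP; split; last by apply: ge_sup => //; exists (r / 2).
by apply: ub_le_sup => //; exists M.
Qed.

Lemma radial_function_mem u : sphere u -> K (radial_function K u *: u) /\
  forall l, radial_function K u < l -> ~ K (l *: u).
Proof.
move=> su; have eu : enorm u = 1 := su.
have [r [M [r0 M0 hb]]] := radial_function_bounds; have /andP[h1 h2] := hb u su.
have [r' r'0 hr] := inner_ball; have [M' M'0 hM] := outer_ball.
have hs : has_sup [set l : R | 0 < l /\ K (l *: u)].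
  split; last by exists M' => l [l0 /hM]; rewrite enormZ eu mulr1 gtr0_norm.
  exists (r' / 2); split; first by rewrite divr_gt0.
  by apply: hr; rewrite enormZ eu mulr1 gtr0_norm ?divr_gt0//; lra.
split; last first.
  move=> l lt Kl; move: (lt); rewrite ltNge => /negP; apply; apply: ub_le_sup; first exact: hs.2.
  by split=> //; apply: lt_trans lt; exact: lt_le_trans h1.
apply: contrapT => nK.
have oK : open (~` K) by apply: closed_openC; exact: (compact_closed (@norm_hausdorff _ _) cptK).
have [e e0 he] := (nbhs_enormP _ _).1 (open_nbhs_nbhs (conj oK nK)).
have [l [l0 Kl] lt] := sup_adherent e0 hs.
have hl : l <= radial_function K u by apply: ub_le_sup; [exact: hs.2|split].
apply: (he (l *: u)) Kl; rewrite -scalerBl enormZ eu mulr1.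
by rewrite ger0_norm ?subr_ge0//; move: lt; rewrite -/(radial_function K u) => lt; lra.
Qed.

(** The minimum over unit [v] of [support_function K v - dot x v] is attained and nonnegative.
    Separating [K] from points of the ray slightly beyond [x] shows that it is at most every
    [e > 0]. *)
Lemma outer_normal_exists u : sphere u ->
  exists2 v, sphere v & outer_normal K (radial_function K u *: u) v.
Proof.
move=> su; have eu : enorm u = 1 := su; have [Kx nK] := radial_function_mem su.
set x := _ *: u in Kx *.
have [L hL] := support_function_elipschitz.
have gL : elipschitz (fun v => support_function K v - dot x v) (L + enorm x).
  move=> v w; have -> : support_function K v - dot x v - (support_function K w - dot x w) =
    (support_function K v - support_function K w) - (dot x v - dot x w) by ring.
  apply: le_trans (ler_normB _ _) _.
  by rewrite mulrDl; apply: lerD; [exact: hL|exact: elipschitz_dot].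
have S0 : @sphere R n !=set0 by exists (delta_mx 0 0); exact: sphere_delta.
have [v sv vmin] := compact_elipschitz_min S0 (@compact_sphere R n) gL.
exists v => //; apply/eqP; rewrite dotC eq_le dot_le_support_function//=.
rewrite -subr_le0; apply/ler_addgt0Pr => e e0; rewrite add0r dotC.
have [|w sw hw] := @compact_convex_separation ((radial_function K u + e) *: u) K0.
  by apply: nK; rewrite ltrDl.
apply: le_trans (vmin w sw) _; rewrite lerBlDr; apply: support_function_le => z Kz.
apply: le_trans (hw z Kz) _; rewrite dotC scalerDl dotDl -/x addrC lerD2r dotZl.
rewrite -[leRHS]mulr1 ler_wpM2l ?(ltW e0)//.
have := Cauchy_Schwarz u w; rewrite eu; have -> : enorm w = 1 := sw.
by rewrite mulr1.
Qed.

(* The projection of such a boundary point along [w] is close to the origin, hence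
   interior to [K]; so no normal there makes a nonobtuse angle with [w]. *)
Lemma outer_normal_cap w : sphere w -> exists2 e, 0 < e &
  forall u, sphere u -> enorm (u + w) < e ->
    exists v, [/\ sphere v, dot v w < 0 & outer_normal K (radial_function K u *: u) v].
Proof.
move=> sw; have ew : enorm w = 1 := sw.
have [r r0 hr] := inner_ball; have [r' [M [r'0 M0 hb]]] := radial_function_bounds.
(* The bound 1 forces [dot u w < 0]; the bound [r / (4 * M)] keeps the projection of [x] along [w]
   within [r / 2] of the origin. *)
pose e := Num.min 1 (r / (4 * M)).
have e0 : 0 < e by rewrite lt_min ltr01 divr_gt0// mulr_gt0.
exists e => // u su ue; have [v sv nv] := outer_normal_exists su.
exists v; split=> //; rewrite ltNge; apply/negP => vw.
have ev : enorm v = 1 := sv.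
have /andP[r'M rM] := hb u su.
set x := _ *: u in nv; set d := u + w in ue.
have ww : dot w w = 1 by rewrite -sqr_enorm ew expr1n.
have dw : `|dot d w| <= enorm d by have := Cauchy_Schwarz_abs d w; rewrite ew mulr1.
have rho0 : 0 <= radial_function K u by exact: le_trans (ltW r'0) r'M.
have uw : dot u w < 0.
  have -> : u = d - w by rewrite addrK.
  rewrite dotBl ww subr_lt0; apply: le_lt_trans (ler_norm _) _; apply: le_lt_trans dw _.
  by apply: lt_le_trans ue _; rewrite ge_min lexx.
(* If [dot v w >= 0], the projection does not lower the product with [v], and the extra [r / 2]
   raises it above the support value although [z] is in [K]. *)
pose z := x - dot x w *: w + (r / 2) *: v.
have Kz : K z.
  apply: hr; apply: le_lt_trans (enormD _ _) _.
  rewrite enormZ ev mulr1 [`|r / 2|]gtr0_norm ?divr_gt0//.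
  have -> : x - dot x w *: w = radial_function K u *: (d - dot d w *: w).
    rewrite scalerBr scalerA /x dotZl /d dotDl ww scalerDr mulrDr mulr1 scalerDl.
    by rewrite opprD addrACA subrr addr0.
  rewrite enormZ ger0_norm//.
  have h1 : enorm (d - dot d w *: w) <= 2 * enorm d.
    apply: le_trans (enormB_le _ _) _; rewrite enormZ ew mulr1.
    by lra.
  have : radial_function K u * enorm (d - dot d w *: w) <= M * (2 * enorm d).
    by apply: ler_pM => //; exact: enorm_ge0.
  have : enorm d * (4 * M) < r.
    by rewrite -ltr_pdivlMr ?mulr_gt0//; apply: lt_le_trans ue _; rewrite ge_min lexx orbT.
  by move: (radial_function K u * _) => y; lra.
have vv : dot v v = 1 by rewrite -sqr_enorm ev expr1n.
have xw : dot x w = radial_function K u * dot u w by rewrite dotZl.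
have := dot_le_support_function v Kz; rewrite -nv (dotC x v) /z dotDr dotBr.
rewrite [dot v (_ *: w)]dotZr [dot v (_ *: v)]dotZr vv mulr1 xw.
have : radial_function K u * dot u w * dot v w <= 0.
  by rewrite mulr_le0_ge0// mulr_ge0_le0// ltW.
by move: (_ * _ * _) (dot v x) => a b; lra.
Qed.

End Separation.

(** Read off from the integral as a supremum over simple functions below the integrand. It is meant
    for the reverse radial Gauss image of a general [K], whose measurability is not established
    here. *)
Lemma ge0_subset_integral_lower d (X : measurableType d) (R : realType)
    (sigma : {measure set X -> \bar R}) (A B : set X) (f g : X -> \bar R) :
  A `<=` B -> (forall x, B x -> 0 <= f x)%E -> (forall x, A x -> 0 <= g x <= f x)%E ->
  (\int[sigma]_(x in A) g x <= \int[sigma]_(x in B) f x)%E.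
Proof.
move=> AB f0 gf; rewrite !ge0_integralE//; last by move=> x /gf/andP[].
apply: ge_ereal_sup => _ [h /= hg <-]; apply: ereal_sup_ubound; exists h => //= x.
apply: le_trans (hg x) _; rewrite !patchE; case: ifPn => [/set_mem Ax|_].
  by rewrite mem_set; [have /andP[] := gf x Ax|exact: AB].
by case: ifPn => // /set_mem; exact: f0.
Qed.

Lemma dual_curvature_measure_not_concentrated (R : realType) (n : nat) (q : R)
    (K : set 'rV[R]_n.+1) (w : sphere_type R n) : q < 0 -> convex_body K -> K° 0 ->
  (0 < dual_curvature_measure q K (~` closed_hemisphere w))%E.
Proof.
move=> q0 [convK cptK _] K0; have sw := sphere_svec w.
have [e e0 he] := outer_normal_cap convK cptK K0 sw.
have [r [M [r0 M0 hb]]] := radial_function_bounds cptK K0.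
pose cap : set (caratheodory_type (hausdorff_outer R n.+1 n)) :=
  @sphere R n `&` [set u | enorm (u - - svec w) < e].
have capG : cap `<=` reverse_radial_gauss_image K (~` closed_hemisphere w).
  move=> u [su]; rewrite /= opprK => ue; split=> //.
  have [v [/svec_surj[v' <-] vw nv]] := he u su ue; exists v' => //.
  by rewrite /closed_hemisphere /= leNgt vw.
have cap0 : (0 < spherical_measure R n cap)%E.
  by apply: spherical_measure_cap_gt0 e0; exact: sphereN.
have mcap : measurable cap by exact: measurable_cap.
rewrite /dual_curvature_measure mule_gt0 ?lte_fin ?invr_gt0//.
apply: (@lt_le_trans _ _ ((M `^ q)%:E * spherical_measure R n cap)%E).
  by rewrite mule_gt0// lte_fin powR_gt0.
rewrite -(integral_cst _ mcap); apply: (ge0_subset_integral_lower _ capG).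
  by move=> u _; rewrite lee_fin powR_ge0.
move=> u [su _]; rewrite !lee_fin powR_ge0/=.
have /andP[h1 h2] := hb u su; have rho0 := lt_le_trans r0 h1.
have [s s0 ->] : exists2 s, 0 < s & q = - s by exists (- q); rewrite ?oppr_gt0 ?opprK.
by rewrite !powRN lef_pV2 ?posrE ?powR_gt0// ge0_ler_powR ?nnegrE// ltW.
Qed.

Theorem mainTheorem1 (R : realType) (n : nat) (q : R)
  (mu : {finite_measure set (borel_sphere R n) -> \bar R}) :
  q < 0 -> mu [set: borel_sphere R n] <> 0%E ->
  (exists K : set 'rV[R]_n.+1,
     [/\ convex_body K, K° 0 &
         forall eta : set (borel_sphere R n), measurable eta ->
           mu eta = dual_curvature_measure q K eta])
  <->
  ~ (exists w : sphere_type R n, concentrated_in mu (closed_hemisphere w)).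
Proof.
move=> q0 mu0; split; last exact: dual_curvature_measure_exists.
move=> [K [cK K0 muE]] [w cw].
have mO : measurable (~` closed_hemisphere w : set (borel_sphere R n)).
  have -> : ~` closed_hemisphere w = (@svec R n) @^-1` [set v | 0 < - dot (svec w) v].
    by apply/seteqP; split=> v /=; rewrite /closed_hemisphere /= oppr_gt0 (dotC (svec w)) ltNge => /negP.
  apply: borel_open_svec; apply: open_gt_continuous.
  apply: (@elipschitz_continuous _ _ _ (enorm (svec w))) => x y.
  by rewrite -opprD normrN; exact: elipschitz_dot.
have := dual_curvature_measure_not_concentrated w q0 cK K0.
by rewrite -muE// cw ltxx.
Qed.
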